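(* Let $\mathcal K=\langle \mathcal R,\delta\rangle$ be a closed ordered differential field, where $\mathcal R=\langle R,<,+,\cdot\rangle$ is a real closed field and $\delta$ a derivation on $R$, and let $C=\ker(\delta)$ be its field of constants. Let $X\subseteq R^n$ be a set definable (with parameters) in the pair $\mathcal M=\langle \mathcal R, C\rangle$ (the ordered field $\mathcal R$ expanded by a unary predicate for $C$). Then $\operatorname{ldim}(X)=\delta\text{-}\dim(X)$.
   Context: A closed ordered differential field (CODF) is an ordered field with a derivation that is existentially closed among ordered differential fields (Singer's axioms). Definability is always with parameters. $\delta$-dimension: let $\mathcal K^*=\langle\mathcal R^*,\delta\rangle$ be an $|R|^+$-saturated elementary extension of $\mathcal K$; for $A\subseteq R^*$, $\operatorname{cl}^\delta_R(A)$ is the set of elements of $R^*$ that are differentially algebraic over the differential field generated by $A\cup R$; this is a pregeometry and $\operatorname{cl}^\delta_R$-$\dim(a)$ of a tuple $a$ is the size of a maximal $\operatorname{cl}^\delta_R$-independent subtuple (equivalently the differential transcendence degree over $R$ of $a$). For nonempty $X$ definable in $\mathcal K$, $\delta\text{-}\dim(X)=\max_{a\in X(R^* )}\operatorname{cl}^\delta_R\text{-}\dim(a)$, and $\delta\text{-}\dim(\emptyset)=-\infty$. Large dimension: let $\mathcal M^*=\langle\mathcal R^*,C^*\rangle$ be an $|R|^+$-saturated elementary extension of $\mathcal M$ and, for $A\subseteq R^*$, $\operatorname{scl}_R(A)=\operatorname{dcl}(A\cup R\cup C^* )$, where $\operatorname{dcl}$ is definable closure in the real closed field $\mathcal R^*$;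 this is a pregeometry, and for nonempty $X$ definable in $\mathcal M$, $\operatorname{ldim}(X)=\max_{a\in X(R^* )}\operatorname{scl}_R\text{-}\dim(a)$, with $\operatorname{ldim}(\emptyset)=-\infty$. (Both are independent of the choice of saturated extension.) *)

(* Defs.v *)
From HB Require Import structures.
From mathcomp Require Import all_boot all_order all_algebra.
From mathcomp Require Import mpoly.
From Stdlib Require Import List.
Set Implicit Arguments. Unset Strict Implicit. Unset Printing Implicit Defensive.
Import Order.TTheory GRing.Theory Num.Theory.
Local Open Scope ring_scope.

(* ---------- First-order syntax: language {0,1,+,-,*,<,=} + derivation
   symbol Tder + unary predicate Fcst.  Variables are indexed by nat;
   parameters are supplied through the variable assignment. *)
Inductive term : Type :=
| Tvar of nat | T0 | T1 | Tadd of term & term | Topp of term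
| Tmul of term & term | Tder of term.

Inductive formula : Type :=
| Feq of term & term | Flt of term & term | Fcst of term
| Fnot of formula | Fand of formula & formula | Fex of nat & formula.

Definition upd (T : Type) (v : nat -> T) (i : nat) (x : T) : nat -> T :=
  fun j => if j == i then x else v j.

Fixpoint teval (T : realFieldType) (d : T -> T) (v : nat -> T) (t : term) : T :=
  match t with
  | Tvar i => v i | T0 => 0 | T1 => 1
  | Tadd a b => teval d v a + teval d v b
  | Topp a => - teval d v a
  | Tmul a b => teval d v a * teval d v b
  | Tder a => d (teval d v a)
  end.

Fixpoint sat (T : realFieldType) (d : T -> T) (C : T -> Prop)
    (v : nat -> T) (f : formula) : Prop :=
  match f with
  | Feq a b => teval d v a = teval d v b
  | Flt a b => teval d v a < teval d v b
  | Fcst a => C (teval d v a)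
  | Fnot g => ~ sat d C v g
  | Fand g h => sat d C v g /\ sat d C v h
  | Fex i g => exists x, sat d C (upd v i x) g
  end.

Fixpoint noder_t (t : term) : bool :=
  match t with
  | Tvar _ | T0 | T1 => true
  | Tadd a b | Tmul a b => noder_t a && noder_t b
  | Topp a => noder_t a
  | Tder _ => false
  end.

Fixpoint noder (f : formula) : bool :=
  match f with
  | Feq a b | Flt a b => noder_t a && noder_t b
  | Fcst a => noder_t a
  | Fnot g | Fex _ g => noder g
  | Fand g h => noder g && noder h
  end.

Fixpoint nocst (f : formula) : bool :=
  match f with
  | Feq _ _ | Flt _ _ => true
  | Fcst _ => false
  | Fnot g | Fex _ g => nocst g
  | Fand g h => nocst g && nocst h
  end.

Fixpoint qf (f : formula) : bool :=
  match f with
  | Feq _ _ | Flt _ _ | Fcst _ => true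
  | Fnot g => qf g
  | Fand g h => qf g && qf h
  | Fex _ _ => false
  end.

Fixpoint trC (f : formula) : formula :=
  match f with
  | Fcst a => Feq (Tder a) T0
  | Feq _ _ | Flt _ _ => f
  | Fnot g => Fnot (trC g)
  | Fand g h => Fand (trC g) (trC h)
  | Fex i g => Fex i (trC g)
  end.

Definition kerd (T : realFieldType) (d : T -> T) : T -> Prop := fun x => d x = 0.

Definition satK (T : realFieldType) (d : T -> T) (v : nat -> T) (f : formula) :=
  sat d (@kerd T d) v f.
(* satisfaction in the pair <T, C> (language L_M); d is irrelevant on
   noder formulas, we use the identity *)
Definition satM (T : realFieldType) (C : T -> Prop) (v : nat -> T) (f : formula) :=
  sat (fun x : T => x) C v f.

Definition derivation (F : nzRingType) (d : F -> F) : Prop :=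
  forall x y, d (x + y) = d x + d y /\ d (x * y) = x * d y + d x * y.

(* <R, delta> is existentially closed among ordered differential fields:
   any quantifier-free L_K formula with parameters from R having a solution
   in an ordered differential field extension already has one in R. *)
Definition CODF (R : rcfType) (delta : R -> R) : Prop :=
  derivation delta /\
  forall (L : realFieldType) (dL : L -> L) (iota : {rmorphism R -> L}),
    derivation dL ->
    (forall x y, (iota x <= iota y) = (x <= y)) ->
    (forall x, dL (iota x) = iota (delta x)) ->
    forall (phi : formula) (k : nat) (v : nat -> R),
      qf phi -> nocst phi ->
      (exists w : nat -> L, (forall j, (k <= j)%N -> w j = iota (v j)) /\
                            satK dL w phi) ->
      exists w : nat -> R, (forall j, (k <= j)%N -> w j = v j) /\
                           satK delta w phi.

Definition elemK (R : rcfType) (delta : R -> R) (T : realFieldType)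
    (dT : T -> T) (iota : R -> T) : Prop :=
  forall (phi : formula) (v : nat -> R), nocst phi ->
    (satK delta v phi <-> satK dT (iota \o v) phi).

Definition elemM (R : rcfType) (delta : R -> R) (T : realFieldType)
    (CT : T -> Prop) (iota : R -> T) : Prop :=
  forall (phi : formula) (v : nat -> R), noder phi ->
    (satM (@kerd R delta) v phi <-> satM CT (iota \o v) phi).

(* ---------- |R|^+-saturation ----------
   Every set Sigma of formulas (of language Lang) in the free variable 0 with
   parameters from a set of size <= |R| (the range of g : R -> T) which is
   finitely satisfiable in T is realized in T. *)
Definition saturated (R : rcfType) (T : realFieldType) (Lang : formula -> bool)
    (satT : (nat -> T) -> formula -> Prop) : Prop :=
  forall (g : R -> T) (Sigma : formula * (nat -> R) -> Prop),
    (forall e, Sigma e -> Lang e.1) ->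
    (forall l : list (formula * (nat -> R)),
        (forall e, In e l -> Sigma e) ->
        exists x : T, forall e, In e l -> satT (upd (g \o e.2) 0 x) e.1) ->
    exists x : T, forall e, Sigma e -> satT (upd (g \o e.2) 0 x) e.1.

Definition dcl (T : realFieldType) (S : T -> Prop) (y : T) : Prop :=
  exists (phi : formula) (w : nat -> T),
    noder phi /\ nocst phi /\ (forall j, (0 < j)%N -> S (w j)) /\
    satM (fun _ => False) (upd w 0 y) phi /\
    forall z, satM (fun _ => False) (upd w 0 z) phi -> z = y.

Definition scl (R : rcfType) (T : realFieldType) (iota : R -> T)
    (CT : T -> Prop) (A : T -> Prop) : T -> Prop :=
  dcl (fun x => A x \/ (exists r, x = iota r) \/ CT x).

Definition gen_dfield (T : realFieldType) (d : T -> T) (S : T -> Prop)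
    (y : T) : Prop :=
  forall P : T -> Prop,
    (forall x, S x -> P x) -> P 0 -> P 1 ->
    (forall x z, P x -> P z -> P (x + z)) -> (forall x, P x -> P (- x)) ->
    (forall x z, P x -> P z -> P (x * z)) -> (forall x, P x -> P x^-1) ->
    (forall x, P x -> P (d x)) -> P y.

Definition diff_alg (T : realFieldType) (d : T -> T) (F : T -> Prop)
    (y : T) : Prop :=
  exists (k : nat) (P : {mpoly T[k.+1]}),
    P != 0 /\ (forall m, F (P@_m)) /\
    P.@[fun i : 'I_k.+1 => iter i d y] = 0.

Definition cld (R : rcfType) (T : realFieldType) (iota : R -> T)
    (dT : T -> T) (A : T -> Prop) : T -> Prop :=
  diff_alg dT (gen_dfield dT (fun x => A x \/ exists r, x = iota r)).

Definition indep (T : Type) (cl : (T -> Prop) -> T -> Prop) (n : nat)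
    (a : 'I_n -> T) (I : {set 'I_n}) : Prop :=
  forall i, i \in I ->
    ~ cl (fun y => exists2 j, (j \in I) && (j != i) & y = a j) (a i).

Definition max_indep (T : Type) (cl : (T -> Prop) -> T -> Prop) (n : nat)
    (a : 'I_n -> T) (I : {set 'I_n}) : Prop :=
  indep cl a I /\ forall J : {set 'I_n}, I \proper J -> ~ indep cl a J.

Definition cl_dim (T : Type) (cl : (T -> Prop) -> T -> Prop) (n : nat)
    (a : 'I_n -> T) (d : nat) : Prop :=
  exists I, max_indep cl a I /\ #|I| = d.

Definition is_max (S : nat -> Prop) (d : nat) : Prop :=
  S d /\ forall e, S e -> (e <= d)%N.

Definition env (T : Type) (n : nat) (x : 'I_n -> T) (p : nat -> T) : nat -> T :=
  fun j => if insub j is Some i then x i else p j.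

Definition defines_M (R : rcfType) (delta : R -> R) (n : nat)
    (X : ('I_n -> R) -> Prop) (phi : formula) (p : nat -> R) : Prop :=
  noder phi /\ forall x, X x <-> satM (@kerd R delta) (env x p) phi.

Definition ldim_is (R : rcfType) (T : realFieldType) (CT : T -> Prop)
    (iota : R -> T) (n : nat) (phi : formula) (p : nat -> R) (d : nat) : Prop :=
  is_max (fun e => exists a : 'I_n -> T,
            satM CT (env a (iota \o p)) phi /\ cl_dim (scl iota CT) a e) d.

Definition ddim_is (R : rcfType) (T : realFieldType) (dT : T -> T)
    (iota : R -> T) (n : nat) (phi : formula) (p : nat -> R) (d : nat) : Prop :=
  is_max (fun e => exists a : 'I_n -> T,
            satK dT (env a (iota \o p)) (trC phi) /\ cl_dim (cld iota dT) a e) d.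

(* Main.v *)
Require Import Defs.
From HB Require Import structures.
From mathcomp Require Import all_boot all_order all_algebra.
From mathcomp Require Import ring lra zify.
From mathcomp Require Import mpoly polyrcf generic_quotient.
From mathcomp Require qe_rcf_th qe_rcf.
From Stdlib Require Import Classical ClassicalEpsilon FunctionalExtensionality.
From Stdlib Require Import PropExtensionality.
Set Implicit Arguments. Unset Strict Implicit. Unset Printing Implicit Defensive.
Import Order.TTheory GRing.Theory Num.Theory.
Local Open Scope ring_scope.

(* Write K for the saturated differential field and C for its constants. Modulo C
   and R, field-algebraic closure is a pregeometry which coincides with definable
   closure in the real closed field (quantifier elimination), and it is contained in
   differential-algebraic closure, because finitely many constants only add finite
   transcendence degree. So the large dimension is at least the differential one.
   For the converse, let a satisfy phi in <K, C> with (a_i), i in I, algebraically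
   independent over R and C. Finite tuples U and V with the same quantifier-free
   type over the empty set, each algebraically free from C over its constants at a
   fixed set of positions, satisfy the same formulas of <K, C>: this relation is a
   back-and-forth system, since C is dense. A point outside acl(U, C) can be matched
   by any point of a suitable interval, and every interval contains points that are
   differentially transcendental over V and R, so a can be moved inside phi to a
   point whose I-coordinates are differentially independent over R.

   Density of C and of differentially transcendental points comes from existential
   closedness, applied to R(t) ordered with t a positive infinitesimal and with t' =
   gamma in R: with t' = - m' the constant m + t is infinitely close to m, and with
   t' = 1 the values of y, y', ..., y^(k) at t = 0 can be prescribed for a
   polynomial y, hence made to avoid the zeros of finitely many differential
   polynomials. *)

(** * Algebraic closure as a pregeometry *)

(** Independence over R and C refers to all constants of a saturated model, a set too large for
    saturation to handle, so a point outside the closure cannot be moved by realizing a type that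
    says so. Freeness takes over: it marks finitely many coordinates but controls every set of
    constants, and any finite tuple becomes free once finitely many constants are added to it. It
    also makes constancy visible in the quantifier-free type: a constant in the field of U is
    algebraic over the marked constants, hence so is its partner. The two dimensions live in
    unrelated saturated extensions. The pair underlying the differential one is again saturated,
    tuples of the two pairs are matched by their types over R, and membership in [scl] depends on
    that type alone; the main argument can thus stay inside the differential field. That field comes
    as a mere ordered field and inherits the intermediate value property from R. Saturation concerns
    one variable, so tuples are built point by point, and joint independence is recovered from the
    symmetry of differential dependence. *)

Section Generated.
Variables (K : realFieldType) (d : K -> K).
Implicit Types (S : K -> Prop) (x y : K).

Lemma gen_incl S x : S x -> gen_dfield d S x.
Proof. by move=> Sx P HS *; apply: HS. Qed.
Lemma gen_zero S : gen_dfield d S 0. Proof. by move=> P *. Qed.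
Lemma gen_one S : gen_dfield d S 1. Proof. by move=> P *. Qed.
Lemma gen_add S x y : gen_dfield d S x -> gen_dfield d S y -> gen_dfield d S (x + y).
Proof. by move=> Hx Hy P h0 h1 h2 h3 h4 h5 h6 h7; apply: (h3); [apply: (Hx P) | apply: (Hy P)]. Qed.
Lemma gen_opp S x : gen_dfield d S x -> gen_dfield d S (- x).
Proof. by move=> Hx P h0 h1 h2 h3 h4 h5 h6 h7; apply: (h4); apply: (Hx P). Qed.
Lemma gen_mul S x y : gen_dfield d S x -> gen_dfield d S y -> gen_dfield d S (x * y).
Proof. by move=> Hx Hy P h0 h1 h2 h3 h4 h5 h6 h7; apply: (h5); [apply: (Hx P) | apply: (Hy P)]. Qed.
Lemma gen_inv S x : gen_dfield d S x -> gen_dfield d S x^-1.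
Proof. by move=> Hx P h0 h1 h2 h3 h4 h5 h6 h7; apply: (h6); apply: (Hx P). Qed.
Lemma gen_der S x : gen_dfield d S x -> gen_dfield d S (d x).
Proof. by move=> Hx P h0 h1 h2 h3 h4 h5 h6 h7; apply: (h7); apply: (Hx P). Qed.
Lemma gen_sub S x y : gen_dfield d S x -> gen_dfield d S y -> gen_dfield d S (x - y).
Proof. by move=> Hx Hy; apply: gen_add => //; apply: gen_opp. Qed.
Lemma gen_div S x y : gen_dfield d S x -> gen_dfield d S y -> gen_dfield d S (x / y).
Proof. by move=> Hx Hy; apply: gen_mul => //; apply: gen_inv. Qed.
Lemma gen_natmul S x n : gen_dfield d S x -> gen_dfield d S (x *+ n).
Proof.
move=> Hx; elim: n => [|n IH]; first by rewrite mulr0n; apply (@gen_zero S).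
by rewrite mulrS; apply: gen_add.
Qed.
Lemma gen_exp S x n : gen_dfield d S x -> gen_dfield d S (x ^+ n).
Proof.
move=> Hx; elim: n => [|n IH]; first by rewrite expr0; apply (@gen_one S).
by rewrite exprS; apply: gen_mul.
Qed.
Lemma gen_sum S (I : Type) (r : seq I) (P : pred I) F :
  (forall i, P i -> gen_dfield d S (F i)) ->
  gen_dfield d S (\sum_(i <- r | P i) F i).
Proof.
move=> HF; elim/big_rec: _ => [|i x Pi Hx]; first exact (@gen_zero S).
by apply: gen_add => //; apply: HF.
Qed.

Lemma gen_sub_gen S S' x :
  (forall y, S y -> gen_dfield d S' y) -> gen_dfield d S x -> gen_dfield d S' x.
Proof.
move=> HS Hx; apply: (Hx (gen_dfield d S')) => //.
- by move=> *; apply: gen_add.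
- by move=> *; apply: gen_opp.
- by move=> *; apply: gen_mul.
- by move=> *; apply: gen_inv.
- by move=> *; apply: gen_der.
Qed.

Lemma gen_mono S S' x :
  (forall y, S y -> S' y) -> gen_dfield d S x -> gen_dfield d S' x.
Proof. by move=> HS; apply: gen_sub_gen => y /HS; apply: gen_incl. Qed.

Lemma gen_finitary S x : gen_dfield d S x ->
  exists l : seq K, (forall y, y \in l -> S y) /\ gen_dfield d (fun y => y \in l) x.
Proof.
pose Q y := exists l : seq K,
  (forall y, y \in l -> S y) /\ gen_dfield d (fun y => y \in l) y.
have Q2 (op : K -> K -> K) :
    (forall S x y, gen_dfield d S x -> gen_dfield d S y -> gen_dfield d S (op x y)) ->
    forall x y, Q x -> Q y -> Q (op x y).
  move=> Hop a b [l [Hl Ha]] [m [Hm Hb]]; exists (l ++ m); split.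
    by move=> y; rewrite mem_cat => /orP[/Hl|/Hm].
  by apply: Hop; [apply: gen_mono Ha | apply: gen_mono Hb] => y yl;
     rewrite mem_cat yl ?orbT.
have Q1 (op : K -> K) :
    (forall S x, gen_dfield d S x -> gen_dfield d S (op x)) ->
    forall x, Q x -> Q (op x).
  by move=> Hop a [l [Hl Ha]]; exists l; split=> //; apply: Hop.
move=> Hx; apply: (Hx Q).
- move=> y Sy; exists [:: y]; split; first by move=> z; rewrite inE => /eqP->.
  by apply: gen_incl; rewrite inE.
- by exists [::]; split=> //; apply (@gen_zero _).
- by exists [::]; split=> //; apply (@gen_one _).
- exact: (Q2 _ gen_add).
- exact: (Q1 _ gen_opp).
- exact: (Q2 _ gen_mul).
- exact: (Q1 _ gen_inv).
- exact: (Q1 _ gen_der).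
Qed.
End Generated.

(** With the identity as derivation, closure under [d] is void, so the lemmas on generated
    differential fields serve for generated fields too. *)
Notation gfield := (gen_dfield (fun x => x)).

Definition acl (K : realFieldType) (S : K -> Prop) (y : K) : Prop :=
  exists p : {poly K}, [/\ p != 0, (forall i, gfield S p`_i) & root p y].

Section Subfield.
Variables (K : realFieldType) (S : K -> Prop).

(** Made boolean by excluded middle, so that the generated subfield becomes a field structure and
    the library theory of [algebraicOver] and integrality applies to it. *)
Definition gfieldb : {pred K} :=
  fun x => if excluded_middle_informative (gfield S x) then true else false.

Lemma gfieldbP x : reflect (gfield S x) (x \in gfieldb).
Proof.
by rewrite unfold_in; case: excluded_middle_informative => h; constructor.
Qed.

Fact gfieldb_closed : divring_closed gfieldb.
Proof.
split; first by apply/gfieldbP; apply: gen_one.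
  by move=> x y /gfieldbP Hx /gfieldbP Hy; apply/gfieldbP; apply: gen_sub.
by move=> x y /gfieldbP Hx /gfieldbP Hy; apply/gfieldbP; apply: gen_div.
Qed.
HB.instance Definition _ := GRing.isDivringClosed.Build K gfieldb gfieldb_closed.

Record gfield_sub := GfieldSub { gfield_val : K; _ : gfield_val \in gfieldb }.
HB.instance Definition _ := [isSub for gfield_val].
HB.instance Definition _ := [Choice of gfield_sub by <:].
HB.instance Definition _ := [SubChoice_isSubComUnitRing of gfield_sub by <:].
HB.instance Definition _ := [SubComUnitRing_isSubIntegralDomain of gfield_sub by <:].
HB.instance Definition _ := [SubIntegralDomain_isSubField of gfield_sub by <:].

Definition gfield_emb : {rmorphism gfield_sub -> K} := \val.

Lemma acl_algebraicOver y : acl S y <-> algebraicOver gfield_emb y.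
Proof.
split=> [[p [p0 pS py]] | [q q0 qy]].
- have pv i : p`_i \in gfieldb by apply/gfieldbP.
  exists (\poly_(i < size p) GfieldSub (pv i)).
    apply: contra p0 => /eqP q0; apply/eqP/polyP => i; rewrite coef0.
    have [ip|ip] := ltnP i (size p); last by rewrite nth_default.
    have := congr1 (fun q : {poly gfield_sub} => gfield_val q`_i) q0.
    by rewrite /= coef0 coef_poly ip /= => ->.
  congr (root _ y): py; apply/polyP => i.
  rewrite coef_map /= coef_poly; case: ltnP => // ip; first by rewrite nth_default.
- exists (map_poly gfield_emb q); split=> //; first by rewrite map_poly_eq0.
  by move=> i; rewrite coef_map; apply/gfieldbP/valP.
Qed.
End Subfield.

Section AlgebraicClosure.
Variable K : realFieldType.
Implicit Types (S : K -> Prop) (x y : K).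

Lemma acl_gfield S x : gfield S x -> acl S x.
Proof.
move=> Sx; exists ('X - x%:P); split; first by rewrite polyXsubC_eq0.
  move=> i; rewrite coefB coefX coefC; apply: gen_sub.
    by case: (i == 1%N); [exact: gen_one | exact: gen_zero].
  by case: (i == 0%N) => //; exact: gen_zero.
by rewrite root_XsubC.
Qed.

Lemma acl_incl S x : S x -> acl S x.
Proof. by move=> Sx; apply: acl_gfield; apply: gen_incl. Qed.

Lemma acl_mono S S' x : (forall y, S y -> S' y) -> acl S x -> acl S' x.
Proof.
move=> SS' [p [p0 pS px]]; exists p; split=> // i.
exact: gen_mono SS' (pS i).
Qed.

Lemma gfield_acl S x : gfield (acl S) x -> acl S x.
Proof.
move=> Hx; apply: (Hx (acl S)) => //.
- by apply: acl_gfield; exact: gen_zero.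
- by apply: acl_gfield; exact: gen_one.
- move=> a b /acl_algebraicOver Ha /acl_algebraicOver Hb.
  by apply/acl_algebraicOver; apply: algebraic_add.
- by move=> a /acl_algebraicOver Ha; apply/acl_algebraicOver/algebraic_opp.
- move=> a b /acl_algebraicOver Ha /acl_algebraicOver Hb.
  by apply/acl_algebraicOver; apply: algebraic_mul.
- by move=> a /acl_algebraicOver Ha; apply/acl_algebraicOver/algebraic_inv.
Qed.

(** Over a field algebraic and integral elements coincide, and a root of a nonzero polynomial with
    integral coefficients is integral by [integral_root]. *)
Lemma acl_trans S S' y : (forall x, S x -> acl S' x) -> acl S y -> acl S' y.
Proof.
move=> SS' [p [p0 pS py]]; apply/acl_algebraicOver/integral_algebraic.
apply: (integral_root p0 py) => _ /(nthP 0)[i ip <-].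
apply/integral_algebraic/acl_algebraicOver/gfield_acl.
exact: gen_mono SS' (pS i).
Qed.

Lemma acl_finitary S y : acl S y ->
  exists l : seq K, (forall x, x \in l -> S x) /\ acl (fun x => x \in l) y.
Proof.
move=> [p [p0 pS py]].
have [l [lS lp]] : exists l : seq K, (forall x, x \in l -> S x) /\
    forall i, (i < size p)%N -> gfield (fun x => x \in l) p`_i.
  elim: (size p) => [|m [l [lS IH]]]; first by exists [::].
  have [l' [lS' H']] := gen_finitary (pS m).
  exists (l ++ l'); split=> [x|i]; first by rewrite mem_cat => /orP[/lS|/lS'].
  rewrite ltnS leq_eqVlt => /orP[/eqP->|/IH H].
    by apply: gen_mono H' => x xl; rewrite mem_cat xl orbT.
  by apply: gen_mono H => x xl; rewrite mem_cat xl.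
exists l; split=> //; exists p; split=> // i.
by have [/lp//|ip] := ltnP i (size p); rewrite nth_default //; exact: gen_zero.
Qed.

Local Notation "S +' x" := (fun z => S z \/ z = x) (at level 50).

Lemma polyOver_gfield S (p : {poly K}) :
  p \is a polyOver (gfieldb S) <-> forall i, gfield S p`_i.
Proof.
by split=> [/polyOverP Hp i|Hp]; [|apply/polyOverP => i]; apply/gfieldbP.
Qed.

Lemma gfield_adjoin_frac S y z : gfield (S +' y) z ->
  exists p q : {poly K}, [/\ p \is a polyOver (gfieldb S),
    q \is a polyOver (gfieldb S), q.[y] != 0 & z = p.[y] / q.[y]].
Proof.
set O := polyOver _.
pose Q z := exists p q : {poly K}, [/\ p \is a O, q \is a O, q.[y] != 0 & z = p.[y] / q.[y]].
have n1 : (1 : {poly K}).[y] != 0 by rewrite hornerC oner_neq0.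
move=> Hz; apply: (Hz Q) => //.
- move=> x [Sx|->].
    exists x%:P, 1; split; rewrite ?rpred1 ?hornerC ?oner_neq0 ?divr1 //.
    by rewrite polyOverC; apply/gfieldbP; exact: gen_incl.
  by exists 'X, 1; split; rewrite ?rpred1 ?polyOverX ?hornerX ?hornerC ?oner_neq0 ?divr1.
- by exists 0, 1; split; rewrite ?rpred0 ?rpred1 // horner0 mul0r.
- by exists 1, 1; split; rewrite ?rpred1 // divff.
- move=> _ _ [p [q [Op Oq q0 ->]]] [p' [q' [Op' Oq' q0' ->]]].
  exists (p * q' + p' * q), (q * q').
  split; rewrite ?rpredD ?rpredM // ?hornerM ?mulf_neq0 //.
  by rewrite hornerD !hornerM addf_div.
- move=> _ [p [q [Op Oq q0 ->]]]; exists (- p), q; split; rewrite ?rpredN //.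
  by rewrite hornerN mulNr.
- move=> _ _ [p [q [Op Oq q0 ->]]] [p' [q' [Op' Oq' q0' ->]]].
  exists (p * p'), (q * q'); split; rewrite ?rpredM // ?hornerM ?mulf_neq0 //.
  by rewrite mulf_div.
- move=> _ [p [q [Op Oq q0 ->]]]; have [p0|p0] := eqVneq p.[y] 0.
    by exists 0, 1; split; rewrite ?rpred0 ?rpred1 // p0 horner0 !mul0r invr0.
  by exists q, p; split=> //; rewrite invf_div.
Qed.

(* A polynomial relation between x and y over S, read as a polynomial in x with
   coefficients in S(y), becomes one in y with coefficients in S(x). *)
Lemma acl_exchange S x y : acl (S +' y) x -> ~ acl S x -> acl (S +' x) y.
Proof.
move=> [p [p0 pS /eqP px]] nx.
have [P [Q [PS QS q0 PQ]]] : exists (P : nat -> {poly K}) (Q : {poly K}),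
    [/\ forall i, P i \is a polyOver (gfieldb S), Q \is a polyOver (gfieldb S),
        Q.[y] != 0 & forall i, (i < size p)%N -> (P i).[y] = Q.[y] * p`_i].
  elim: (size p) => [|m [P [Q [PS QS q0 PQ]]]].
    by exists (fun=> 0), 1; split=> [i||//|//]; rewrite ?rpred0 ?rpred1 // hornerC oner_neq0.
  have [u [v [uS vS v0 puv]]] := gfield_adjoin_frac (pS m).
  exists (fun i => if i == m then u * Q else v * P i), (Q * v); split=> [i|||i].
  - by case: eqP => _; rewrite rpredM.
  - by rewrite rpredM.
  - by rewrite hornerM mulf_neq0.
  - rewrite ltnS leq_eqVlt; case: eqP => [-> _|_ /= /PQ e].
      by rewrite !hornerM puv; field.
    by rewrite !hornerM e mulrCA mulrA.
pose l := (size p).-1.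
have lp : (l < size p)%N by rewrite prednK // size_poly_gt0.
have Pl0 : P l != 0.
  apply: contraNneq (mulf_neq0 q0 (_ : p`_l != 0)) => [e|].
    by rewrite -PQ // e horner0.
  by rewrite -[p`_l]/(lead_coef p) lead_coef_eq0.
pose R := \sum_(i < size p) (x ^+ i) *: P i.
have RE j : R`_j = \sum_(i < size p) x ^+ i * (P i)`_j.
  by rewrite coef_sum; apply: eq_bigr => i _; rewrite coefZ.
exists R; split.
(* Were [R] zero, its coefficient at the degree [j] of [P l] would be a relation for [x] over [S],
   nontrivial because of its own coefficient at [l]. *)
- apply/eqP => R0; apply: nx; pose j := (size (P l)).-1.
  exists (\poly_(i < size p) (P i)`_j); split.
  + apply/eqP => /(congr1 (fun r : {poly K} => r`_l)) /eqP.
    by rewrite coef_poly lp coef0 -[_`_j]/(lead_coef (P l)) lead_coef_eq0 (negPf Pl0).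
  + move=> i; rewrite coef_poly; case: ltnP => _; last exact: gen_zero.
    by move/polyOver_gfield: (PS i); apply.
  + apply/rootP; rewrite horner_poly; have := RE j; rewrite R0 coef0 => e.
    by rewrite [RHS]e; apply: eq_bigr => i _; rewrite mulrC.
- move=> j; rewrite RE; apply: gen_sum => i _; apply: gen_mul.
    by apply: gen_exp; apply: gen_incl; right.
  by apply: gen_mono; [left; eassumption | move/polyOver_gfield: (PS i); apply].
- apply/rootP; rewrite horner_sum; transitivity (Q.[y] * p.[x]); last by rewrite px mulr0.
  rewrite [p.[x]]horner_coef mulr_sumr; apply: eq_bigr => i _.
  by rewrite hornerZ PQ // mulrCA [p`_i * _]mulrC.
Qed.

(** Elements of [d] are discarded from the front while [z] stays algebraic over the rest; the first
    one that cannot be discarded exchanges with [z]. *)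
Lemma acl_swap_in (d : seq K) S z : acl (fun x => S x \/ x \in d) z -> ~ acl S z ->
  exists2 c, c \in d & acl (fun x => (S x \/ x = z) \/ x \in rem c d) c.
Proof.
elim: d => [|c d IH] Hz nz.
  by case: nz; apply: acl_mono Hz => x [].
have [Hd|Hd] := classic (acl (fun x => S x \/ x \in d) z).
  have [c' c'd Hc'] := IH Hd nz; exists c'; first by rewrite inE c'd orbT.
  apply: acl_mono Hc' => x [|xd]; [by left | right; rewrite /=].
  by case: eqP => _; [exact: mem_rem xd | rewrite inE xd orbT].
exists c; first by rewrite mem_head.
rewrite /= eqxx; apply: acl_mono (acl_exchange _ Hd).
  by move=> x [[Sx|xd]|->]; [left; left | right | left; right].
apply: acl_mono Hz => x [Sx|]; first by left; left.
by rewrite inE => /orP[/eqP->|xd]; [right | left; right].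
Qed.

(** Each [z i] that is independent of [S] and its predecessors takes the place of one element of
    [d], and [d] offers only [size d] places. *)
Lemma acl_steinitz (d : seq K) S (z : nat -> K) :
  (forall i, acl (fun x => S x \/ x \in d) (z i)) ->
  exists2 i, (i <= size d)%N &
    acl (fun x => S x \/ exists2 j, (j < i)%N & x = z j) (z i).
Proof.
have [n] := ubnP (size d); elim: n d S z => // n IH d S z; rewrite ltnS => dn Hz.
have [H0|H0] := classic (acl S (z 0%N)).
  by exists 0%N => //; apply: acl_mono H0 => x; left.
have [c cd Hc] := acl_swap_in (Hz 0%N) H0.
have rd : (size (rem c d)).+1 = size d.
  by rewrite size_rem // prednK //; case: (d) cd.
have [| i |i id Hi] := IH (rem c d) (fun x => S x \/ x = z 0%N) (fun i => z i.+1).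
- by rewrite -ltnS rd.
- apply: acl_trans (Hz i.+1) => x [Sx|xd]; first by apply: acl_incl; left; left.
  have [->|xc] := eqVneq x c; first exact: Hc.
  apply: acl_incl; right.
  by have := perm_mem (perm_to_rem cd) x; rewrite xd inE (negPf xc) /= => <-.
exists i.+1; first by rewrite -rd.
apply: acl_mono Hi => x [[Sx|->]|[j ji ->]]; [by left | by right; exists 0%N|].
by right; exists j.+1.
Qed.
End AlgebraicClosure.

(** * Differential-algebraic closure *)

Section Derivation.
Variables (K : realFieldType) (d : K -> K).
Hypothesis d_der : derivation d.
Implicit Types (A S F : K -> Prop) (x y : K).

Lemma derD x y : d (x + y) = d x + d y. Proof. by case: (d_der x y). Qed.
Lemma derM x y : d (x * y) = x * d y + d x * y. Proof. by case: (d_der x y). Qed.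
Lemma der0 : d 0 = 0.
Proof. by apply: (addrI (d 0)); rewrite -derD !addr0. Qed.
Lemma derN x : d (- x) = - d x.
Proof. by apply: (addrI (d x)); rewrite -derD !subrr der0. Qed.
Lemma der1 : d 1 = 0.
Proof. by apply: (addrI (d 1)); rewrite addr0 -{3}[1]mulr1 derM mul1r mulr1. Qed.
Lemma derV x : d x^-1 = - (d x / x ^+ 2).
Proof.
have [->|x0] := eqVneq x 0; first by rewrite invr0 der0 mul0r oppr0.
have : d (x * x^-1) = 0 by rewrite divff // der1.
rewrite derM => /eqP; rewrite addr_eq0 => /eqP e.
by apply: (mulfI x0); rewrite e; field.
Qed.

Lemma der_horner (p : {poly K}) z :
  d p.[z] = (map_poly d p).[z] + p^`().[z] * d z.
Proof.
elim/poly_ind: p => [|p c IH]; first by rewrite map_poly0 deriv0 !horner0 der0 mul0r addr0.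
have -> : map_poly d (p * 'X + c%:P) = map_poly d p * 'X + (d c)%:P.
  apply/polyP => i; rewrite coef_map_id0 ?der0 // !coefD !coefMX !coefC.
  by case: i => [|i] /=; rewrite ?add0r ?addr0 // coef_map_id0 ?der0.
rewrite derivD derivM derivX derivC addr0 mulr1 !hornerMXaddC hornerD hornerMX.
by rewrite derD derM IH; ring.
Qed.

(** In characteristic 0 the derivative of a nonconstant polynomial is nonzero of smaller size;
    differentiate as long as [z] is a multiple root. *)
Lemma acl_simple_root S z : acl S z ->
  exists p : {poly K}, [/\ forall i, gfield S p`_i, p.[z] = 0 & p^`().[z] != 0].
Proof.
move=> [p]; have [n] := ubnP (size p).
elim: n p => // n IH p; rewrite ltnS => pn [p0 pS /rootP pz].
have [pz'|pz'] := eqVneq p^`().[z] 0; last by exists p.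
have sp : (1 < size p)%N.
  rewrite ltnNge; apply/negP => /size1_polyC pC.
  by move: pz p0; rewrite pC hornerC => ->; rewrite eqxx.
apply: (IH p^`()); first exact: leq_trans (lt_size_deriv p0) pn.
split; [|by move=> i; rewrite coef_deriv; apply: gen_natmul|exact/rootP].
apply/eqP => /(congr1 (fun q : {poly K} => q`_(size p).-2)) /eqP.
rewrite coef0 coef_deriv mulrn_eq0 /=.
have -> : (size p).-2.+1 = (size p).-1 by case: (size p) sp => [|[]].
by rewrite -[_`_ _]/(lead_coef p) lead_coef_eq0 (negPf p0).
Qed.

Lemma gfield_der S : (forall x, S x -> gfield S (d x)) ->
  forall x, gfield S x -> gfield S (d x).
Proof.
move=> HS x Sx.
have [] // : gfield S x /\ gfield S (d x).
apply: (Sx (fun x => gfield S x /\ gfield S (d x))) => //.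
- by move=> y Sy; split; [exact: gen_incl | exact: HS].
- by rewrite der0; split; exact: gen_zero.
- by rewrite der1; split; [exact: gen_one | exact: gen_zero].
- move=> a b [Ha Hda] [Hb Hdb]; rewrite derD; split; exact: gen_add.
- move=> a [Ha Hda]; rewrite derN; split; exact: gen_opp.
- move=> a b [Ha Hda] [Hb Hdb]; rewrite derM; split; first exact: gen_mul.
  by apply: gen_add; apply: gen_mul.
- move=> a [Ha Hda]; rewrite derV; split; first exact: gen_inv.
  by apply: gen_opp; apply: gen_div => //; apply: gen_exp.
Qed.

(** Differentiating p(z) = 0 gives d z = - p^d(z) / p'(z), where p^d has the differentiated
    coefficients; a simple root makes the division legitimate. *)
Lemma acl_der S : (forall x, S x -> gfield S (d x)) ->
  forall z, acl S z -> acl S (d z).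
Proof.
move=> HS z Hz; have [p [pS pz pz']] := acl_simple_root Hz.
have e : d z = - ((map_poly d p).[z] / p^`().[z]).
  apply: (mulfI pz'); apply/eqP; rewrite -subr_eq0; apply/eqP.
  by rewrite -[RHS]der0 -pz der_horner; field.
have aS (q : {poly K}) : (forall i, gfield S q`_i) -> gfield (acl S) q.[z].
  move=> qS; rewrite horner_coef; apply: gen_sum => i _.
  apply: gen_mul; last by apply: gen_exp; apply: gen_incl.
  by apply: gen_mono (qS i) => x; apply: acl_incl.
rewrite e; apply: gfield_acl; apply: gen_opp; apply: gen_div; apply: aS => i.
  by rewrite coef_map_id0 ?der0 //; apply: gfield_der.
by rewrite coef_deriv; apply: gen_natmul.
Qed.

(** In the same formula constant coefficients give p^d = 0, so p'(z) d z = 0 with p'(z) nonzero. *)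
Lemma acl_const S : (forall x, S x -> d x = 0) -> forall z, acl S z -> d z = 0.
Proof.
move=> HS z /acl_simple_root[p [pS pz pz']].
have dS x : gfield S x -> d x = 0.
  move=> Hx; apply: (Hx (fun x => d x = 0)) => //.
  - exact: der0.
  - exact: der1.
  - by move=> a b da db; rewrite derD da db addr0.
  - by move=> a da; rewrite derN da oppr0.
  - by move=> a b da db; rewrite derM da db mulr0 mul0r addr0.
  - by move=> a da; rewrite derV da mul0r oppr0.
have := der_horner p z; rewrite pz der0.
have -> : map_poly d p = 0.
  by apply/polyP => i; rewrite coef_map_id0 ?der0 // coef0 dS.
rewrite horner0 add0r => /esym/eqP; rewrite mulf_eq0 (negPf pz') /=.
by move/eqP.
Qed.

Definition dorbit A : K -> Prop := fun x => exists i y, A y /\ x = iter i d y.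

(** Phrased through [acl] instead of a differential polynomial, so that exchange and Steinitz for
    [acl] apply; [diff_alg_dalg] identifies it with the notion used in the theorem. *)
Definition dalg A y : Prop := exists k,
  acl (fun x => dorbit A x \/ exists2 j, (j < k)%N & x = iter j d y) (iter k d y).

Lemma dorbit_incl A x : A x -> dorbit A x.
Proof. by exists 0%N, x. Qed.
Lemma dorbit_der A x : dorbit A x -> dorbit A (d x).
Proof. by move=> [i [y [Ay ->]]]; exists i.+1, y. Qed.
Lemma dorbit_mono A A' x : (forall y, A y -> A' y) -> dorbit A x -> dorbit A' x.
Proof. by move=> AA' [i [y [Ay ->]]]; exists i, y; split=> //; apply: AA'. Qed.

Lemma dalg_mono A A' y : (forall x, A x -> A' x) -> dalg A y -> dalg A' y.
Proof.
move=> AA' [k Hk]; exists k; apply: acl_mono Hk => x [Ax|]; [left | by right].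
exact: dorbit_mono Ax.
Qed.

(* The derivatives of y lie in a field of transcendence degree at most the number
   of constants involved. *)
Lemma dalg_acl_const A y : acl (fun x => A x \/ d x = 0) y -> dalg A y.
Proof.
move=> /acl_finitary[l [lAC Hy]].
pose l0 := [seq x <- l | d x == 0].
pose S x := dorbit A x \/ x \in l0.
have dS x : S x -> gfield S (d x).
  case=> [Ax|]; first by apply: gen_incl; left; apply: dorbit_der.
  by rewrite mem_filter => /andP[/eqP-> _]; exact: gen_zero.
have Sy : acl S y.
  apply: acl_mono Hy => x xl; have [dx|dx] := eqVneq (d x) 0.
    by right; rewrite mem_filter dx eqxx.
  by left; case: (lAC x xl) => [/dorbit_incl//|dx0]; rewrite dx0 eqxx in dx.
have Hi i : acl S (iter i d y) by elim: i => //= i IH; apply: acl_der.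
(* All derivatives of [y] are algebraic over the orbit of [A] together with the finite list [l0] of
   constants, so one of them depends on the lower ones over the orbit alone. *)
have [i _ Hyi] := acl_steinitz Hi.
by exists i.
Qed.

(** A relation for the k-th derivative of [x] uses finitely many derivatives of [y]; exchanging the
    last one that is really used with that derivative of [x] yields a relation for [y] over [F] and
    [x]. *)
Lemma dalg_sym F x y : ~ dalg F x -> ~ dalg (fun z => F z \/ z = x) y ->
  ~ dalg (fun z => F z \/ z = y) x.
Proof.
move=> nx ny [k Hk].
have [m Hm] : exists m, acl (fun z => (dorbit F z \/ exists2 j, (j < k)%N & z = iter j d x)
    \/ exists2 j, (j < m)%N & z = iter j d y) (iter k d x).
  have [l [lS Hl]] := acl_finitary Hk.
  have [m Hm] : exists m, forall z, z \in l -> (dorbit F z \/ exists2 j, (j < k)%N & z = iter j d x)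
    \/ exists2 j, (j < m)%N & z = iter j d y.
    elim: (l) lS => [|a l' IH] lS; first by exists 0%N.
    have [|m Hm] := IH; first by move=> z zl; apply: lS; rewrite inE zl orbT.
    have [[i [w [[Fw|->] e]]]|Ha] := lS a (mem_head _ _).
    - exists m => z; rewrite inE => /orP[/eqP->|/Hm //].
      by left; left; exists i, w.
    - exists (maxn m i.+1) => z; rewrite inE => /orP[/eqP->|/Hm[|[j jm ->]]].
      + by right; exists i => //; rewrite leq_max leqnn orbT.
      + by left.
      + by right; exists j => //; rewrite leq_max jm.
    - exists m => z; rewrite inE => /orP[/eqP->|/Hm //].
      by left; right.
  by exists m; apply: acl_mono Hl.
(* Descent to the least number [m] of derivatives of [y]: none at all contradicts [nx], and at the
   least [m] exchange is possible. *)
elim: m Hm => [|m IH] Hm.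
  by apply: nx; exists k; apply: acl_mono Hm => z [//|[]].
set T := fun z => (dorbit F z \/ exists2 j, (j < k)%N & z = iter j d x)
    \/ exists2 j, (j < m)%N & z = iter j d y in IH.
have [/IH//|nT] := classic (acl T (iter k d x)).
have/acl_exchange/(_ nT) Hy : acl (fun z => T z \/ z = iter m d y) (iter k d x).
  apply: acl_mono Hm => z [Fz|[j]]; first by left; left.
  rewrite ltnS leq_eqVlt => /orP[/eqP->|jm] ->; first by right.
  by left; right; exists j.
apply: ny; exists m; apply: acl_mono Hy => z [[[Fz|[j jk ->]]|[j jm ->]]|->].
- by left; apply: dorbit_mono Fz; left.
- by left; exists j, x; split=> //; right.
- by right; exists j.
- by left; exists k, x; split=> //; right.
Qed.

Lemma gen_dfield_orbit A x : gen_dfield d A x <-> gfield (dorbit A) x.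
Proof.
split=> Hx.
  apply: (Hx (gfield (dorbit A))) => //.
  - by move=> y Ay; apply: gen_incl; apply: dorbit_incl.
  - by move=> a b; apply: gen_add.
  - by move=> a; apply: gen_opp.
  - by move=> a b; apply: gen_mul.
  - by move=> a; apply: gen_inv.
  - by apply: gfield_der => z /dorbit_der; apply: gen_incl.
apply: (Hx (gen_dfield d A)) => //.
- move=> _ [i [y [Ay ->]]]; elim: i => [|i IH]; first exact: gen_incl.
  exact: gen_der.
- by move=> a b; apply: gen_add.
- by move=> a; apply: gen_opp.
- by move=> a b; apply: gen_mul.
- by move=> a; apply: gen_inv.
Qed.
End Derivation.

(** * Polynomial relations in several variables and algebraic dependence *)

Section MultivariatePolynomials.
Variables (K : realFieldType) (D : K -> Prop).
Implicit Types (y : nat -> K).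

Lemma mcoeff_muni n (P : {mpoly K[n.+1]}) i (m : 'X_{1..n}) :
  ((muni P)`_i)@_m = P@_[multinom of rcons m i].
Proof.
rewrite muniE coef_sum raddf_sum [in RHS](mpolyE P) (raddf_sum (mcoeff _)) /=.
apply: eq_bigr => M _; rewrite coefZ coefXn mcoeffZ mcoeffX.
have -> : (M == [multinom of rcons m i]) =
    ([multinom (M (widen_ord (leqnSn n) j)) | j < n]%MM == m) && (i == M ord_max).
  apply/eqP/andP => [->|[/eqP e1 /eqP e2]]; last first.
    apply/mnmP => j; rewrite [RHS](mnm_nth 0%N) /= nth_rcons size_tuple.
    case: ltnP => jn.
      rewrite -(mnm_nth 0%N m (Ordinal jn)) -e1 mnmE; congr (M _); exact: val_inj.
    have jn' : val j = n by apply/eqP; rewrite eqn_leq jn -ltnS ltn_ord.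
    by rewrite jn' eqxx e2; congr (M _); apply: val_inj.
  split; apply/eqP; last by rewrite (mnm_nth 0%N) /= nth_rcons size_tuple ltnn eqxx.
  apply/mnmP => j; rewrite mnmE [LHS](mnm_nth 0%N) /= nth_rcons size_tuple ltn_ord.
  by rewrite (mnm_nth 0%N).
case: (i == _); last by rewrite mulr0 mcoeff0 andbF mulr0.
by rewrite mulr1 andbT mcoeffZ mcoeffX.
Qed.

Lemma meval_muni n (P : {mpoly K[n.+1]}) y :
  P.@[fun i : 'I_n.+1 => y i] =
  (map_poly (meval (fun i : 'I_n => y i)) (muni P)).[y n].
Proof.
rewrite mevalE muniE raddf_sum horner_sum /=; apply: eq_bigr => M _.
rewrite map_polyZ map_polyXn hornerZ hornerXn /= mevalZ mevalX -mulrA; congr (_ * _).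
rewrite big_ord_recr /=; congr (_ * _); apply: eq_bigr => j _.
by rewrite mnmE.
Qed.

Lemma muni_neq0 n (P : {mpoly K[n.+1]}) : P != 0 -> muni P != 0.
Proof.
apply: contra => /eqP P0; apply/eqP/mpolyP => M; rewrite mcoeff0.
have [N NE] : exists N : 'X_{1..n}, forall j, N j = M (widen_ord (leqnSn n) j).
  by exists [multinom (M (widen_ord (leqnSn n) j)) | j < n]%MM => j; rewrite mnmE.
have -> : M = [multinom of rcons N (M ord_max)].
  apply/mnmP => j; rewrite [RHS](mnm_nth 0%N) /= nth_rcons size_tuple.
  case: ltnP => jn.
    by rewrite -(mnm_nth 0%N N (Ordinal jn)) NE; congr (M _); apply: val_inj.
  have jn' : val j = n by apply/eqP; rewrite eqn_leq jn -ltnS ltn_ord.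
  by rewrite jn' eqxx; congr (M _); apply: val_inj.
by rewrite -mcoeff_muni P0 coef0 mcoeff0.
Qed.

Definition below y k : K -> Prop := fun x => D x \/ exists2 j, (j < k)%N & x = y j.

Lemma gfield_meval n (P : {mpoly K[n]}) y : (forall m, gfield D P@_m) ->
  gfield (below y n) P.@[fun i : 'I_n => y i].
Proof.
move=> PD; rewrite mevalE; apply: gen_sum => M _; apply: gen_mul.
  by apply: gen_mono (PD M) => x; left.
elim/big_rec: _ => [|i x _ Hx]; first exact: gen_one.
by apply: gen_mul => //; apply: gen_exp; apply: gen_incl; right; exists i.
Qed.

(** Read as a polynomial in the last variable, [P] has a leading coefficient that by induction does
    not vanish at the first values; a zero would make the last value algebraic over them. *)
Lemma meval_indep_neq0 n (P : {mpoly K[n]}) y :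
  (forall k, (k < n)%N -> ~ acl (below y k) (y k)) ->
  P != 0 -> (forall m, gfield D P@_m) -> P.@[fun i : 'I_n => y i] != 0.
Proof.
elim: n P => [|n IH] P Hy P0 PD.
  apply: contra P0 => /eqP; rewrite mevalE => e; apply/eqP.
  rewrite (mpolyE P); move: e; under eq_bigr do rewrite big_ord0 mulr1.
  move=> e; rewrite -[RHS](mpolyC0 0) -e; rewrite raddf_sum; apply: eq_bigr => M _ /=.
  have -> : M = 0%MM by apply/mnmP => -[].
  by rewrite mpolyX0 -mul_mpolyC mulr1.
have P0' := muni_neq0 P0.
apply/negP; rewrite meval_muni => /eqP e; apply: (Hy n) => //.
exists (map_poly (meval (fun i : 'I_n => y i)) (muni P)); split; last exact/rootP.
- apply/eqP => /(congr1 (fun q : {poly K} => q`_(size (muni P)).-1)) /eqP.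
  rewrite coef_map coef0 /=; apply/negP; apply: IH.
  + by move=> k kn; apply: Hy; apply: ltnW.
  + by rewrite -[_`_ _]/(lead_coef _) lead_coef_eq0.
  + by move=> m; rewrite mcoeff_muni.
- by move=> i; rewrite coef_map /=; apply: gfield_meval => m; rewrite mcoeff_muni.
Qed.

Lemma gfield_below_frac k y z : gfield (below y k) z ->
  exists P Q : {mpoly K[k]}, [/\ P \is a mpolyOver _ (gfieldb D),
    Q \is a mpolyOver _ (gfieldb D), Q.@[fun i : 'I_k => y i] != 0 &
    z = P.@[fun i : 'I_k => y i] / Q.@[fun i : 'I_k => y i]].
Proof.
set O := mpolyOver _ _; set ev := meval _.
pose R z := exists P Q : {mpoly K[k]}, [/\ P \is a O, Q \is a O, ev Q != 0 & z = ev P / ev Q].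
have ev1 : ev 1 = 1 by rewrite /ev meval1.
move=> Hz; apply: (Hz R) => //.
- move=> x [Dx|[j jk ->]].
    exists x%:MP, 1; split; rewrite ?rpred1 ?ev1 ?oner_neq0 ?divr1 //.
      by rewrite mpolyOverC; apply/gfieldbP; exact: gen_incl.
    by rewrite /ev mevalC.
  exists 'X_(Ordinal jk), 1; split; rewrite ?rpred1 ?ev1 ?oner_neq0 ?divr1 //.
    exact: mpolyOverX.
  by rewrite /ev mevalXU.
- by exists 0, 1; split; rewrite ?rpred0 ?rpred1 ?ev1 ?oner_neq0 // /ev meval0 mul0r.
- by exists 1, 1; split; rewrite ?rpred1 ?ev1 ?oner_neq0 // divff ?oner_neq0.
- move=> _ _ [p [q [Op Oq q0 ->]]] [p' [q' [Op' Oq' q0' ->]]].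
  exists (p * q' + p' * q), (q * q').
  split; rewrite ?rpredD ?rpredM // /ev ?mevalD ?mevalM ?mulf_neq0 //.
  by rewrite addf_div.
- move=> _ [p [q [Op Oq q0 ->]]]; exists (- p), q; split; rewrite ?rpredN //.
  by rewrite /ev mevalN mulNr.
- move=> _ _ [p [q [Op Oq q0 ->]]] [p' [q' [Op' Oq' q0' ->]]].
  exists (p * p'), (q * q'); split; rewrite ?rpredM // /ev ?mevalM ?mulf_neq0 //.
  by rewrite mulf_div.
- move=> _ [p [q [Op Oq q0 ->]]]; have [p0|p0] := eqVneq (ev p) 0.
    exists 0, 1; split; rewrite ?rpred0 ?rpred1 ?ev1 ?oner_neq0 //.
    by rewrite p0 /ev meval0 !mul0r invr0.
  by exists q, p; split=> //; rewrite invf_div.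
Qed.

(** Clearing the denominators of the coefficients turns the polynomial over the field generated by
    the lower values into one in all variables over [D]. *)
Lemma acl_below_mpoly k y : acl (below y k) (y k) ->
  exists P : {mpoly K[k.+1]}, [/\ P != 0, P \is a mpolyOver _ (gfieldb D) &
    P.@[fun i : 'I_k.+1 => y i] = 0].
Proof.
move=> [p [p0 pS /eqP py]].
set O := mpolyOver _ _; pose ev := meval (fun i : 'I_k => y i).
have [P [Q [PO QO Q0 PQ]]] : exists (P : nat -> {mpoly K[k]}) (Q : {mpoly K[k]}),
    [/\ forall i, P i \is a mpolyOver _ (gfieldb D), Q \is a mpolyOver _ (gfieldb D),
        ev Q != 0 & forall i, (i < size p)%N -> ev (P i) = ev Q * p`_i].
  elim: (size p) => [|m [P [Q [PS QS q0 PQ]]]].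
    by exists (fun=> 0), 1; split=> [i||//|//]; rewrite ?rpred0 ?rpred1 // /ev meval1 oner_neq0.
  have [u [v [uS vS v0 puv]]] := gfield_below_frac (pS m).
  exists (fun i => if i == m then u * Q else v * P i), (Q * v); split=> [i|||i].
  - by case: eqP => _; rewrite rpredM.
  - by rewrite rpredM.
  - by rewrite /ev mevalM mulf_neq0.
  - rewrite ltnS leq_eqVlt; case: eqP => [-> _|_ /= /PQ e].
      by rewrite /ev !mevalM puv -/ev; field.
    by rewrite /ev !mevalM -/ev e mulrCA mulrA.
pose M : {mpoly K[k.+1]} := \sum_(i < size p) mwiden (P i) * 'X_ord_max ^+ i.
have MO : M \is a mpolyOver _ (gfieldb D).
  rewrite rpred_sum // => i _; rewrite rpredM ?rpredX //; last exact: mpolyOverX.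
  rewrite /mwiden /mmap rpred_sum // => m _; rewrite rpredM //.
    by rewrite mpolyOverC; move/mpolyOverP: (PO i); apply.
  by rewrite /mmap1 rpred_prod // => j _; rewrite rpredX //; apply: mpolyOverX.
have widenE (v : 'I_k.+1 -> K) (N : {mpoly K[k]}) :
    (mwiden N).@[v] = N.@[fun j => v (widen_ord (leqnSn k) j)].
  rewrite /mwiden /mmap raddf_sum mevalE; apply: eq_bigr => m _ /=.
  rewrite mevalM mevalC rmorph_prod /=; congr (_ * _); apply: eq_bigr => j _.
  by rewrite rmorphXn /= mevalXU.
have ME t : M.@[fun i : 'I_k.+1 => if (i < k)%N then y i else t] = ev Q * p.[t].
  rewrite raddf_sum /= [p.[t]]horner_coef mulr_sumr; apply: eq_bigr => i _.
  rewrite mevalM rmorphXn /= mevalXU ltnn mulrA -PQ // widenE; congr (_ * _).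
  by apply: meval_eq => j /=; rewrite ltn_ord.
exists M; split=> //; last first.
  transitivity (ev Q * p.[y k]); last by rewrite py mulr0.
  rewrite -ME; apply: meval_eq => j /=; case: ltnP => // kj.
  by congr y; apply/eqP; rewrite eqn_leq kj -ltnS ltn_ord.
(* If [M] were zero, [p] would vanish at [size p] distinct natural numbers, by [ME]. *)
apply/eqP => M0; case/eqP: p0; apply: (@roots_geq_poly_eq0 _ _ [seq i%:R | i <- iota 0 (size p)]).
- apply/allP => t _; apply/rootP; apply: (mulfI Q0).
  by rewrite -ME M0 meval0 mulr0.
- by rewrite map_inj_uniq ?iota_uniq // => a b /eqP; rewrite eqr_nat => /eqP.
- by rewrite size_map size_iota.
Qed.
End MultivariatePolynomials.

Lemma diff_alg_dalg (K : realFieldType) (d : K -> K) (d_der : derivation d)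
    (A : K -> Prop) y :
  diff_alg d (gen_dfield d A) y <-> dalg d A y.
Proof.
have orbit x : gen_dfield d A x = gfield (dorbit d A) x.
  by apply: PropExtensionality.propositional_extensionality; exact: gen_dfield_orbit.
split=> [[k [P [P0 [PA Py]]]]|[k Hk]]; last first.
  have [P [P0 PA Py]] := @acl_below_mpoly K (dorbit d A) k (fun i => iter i d y) Hk.
  exists k, P; split=> //; split=> // m; rewrite orbit.
  by apply/gfieldbP; move/mpolyOverP: PA; apply.
apply: NNPP => ny.
have/negP[] : P.@[fun i : 'I_k.+1 => iter i d y] != 0; last by rewrite Py.
apply: (@meval_indep_neq0 K (dorbit d A) k.+1 P (fun i => iter i d y)) => //.
  by move=> j _ Hj; apply: ny; exists j.
by move=> m; rewrite -orbit.
Qed.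

(** * Formulas and saturation *)

Section Formulas.

Fixpoint term_bound (t : term) : nat :=
  match t with
  | Tvar i => i.+1
  | T0 | T1 => 0
  | Tadd a b | Tmul a b => maxn (term_bound a) (term_bound b)
  | Topp a | Tder a => term_bound a
  end.

Fixpoint formula_bound (f : formula) : nat :=
  match f with
  | Feq a b | Flt a b => maxn (term_bound a) (term_bound b)
  | Fcst a => term_bound a
  | Fnot g => formula_bound g
  | Fand g h => maxn (formula_bound g) (formula_bound h)
  | Fex i g => maxn i.+1 (formula_bound g)
  end.

Definition Ftrue := Feq T0 T0.
Definition Fands (l : list formula) := List.fold_right Fand Ftrue l.
Definition Fimp f g := Fnot (Fand f (Fnot g)).

Fixpoint Fexs (n : nat) (f : formula) : formula :=
  if n is m.+1 then Fexs m (Fex m f) else f.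

Variables (T : realFieldType) (d : T -> T).
Implicit Types (C : T -> Prop) (v w : nat -> T).

Lemma teval_agree v w t : (forall j, (j < term_bound t)%N -> v j = w j) ->
  teval d v t = teval d w t.
Proof.
elim: t => //= [i|a IHa b IHb|a IH|a IHa b IHb|a IH] H.
- exact: H.
- by rewrite IHa ?IHb // => j jl; apply: H; rewrite leq_max jl ?orbT.
- by rewrite IH.
- by rewrite IHa ?IHb // => j jl; apply: H; rewrite leq_max jl ?orbT.
- by rewrite IH.
Qed.

Lemma sat_agree C v w f : (forall j, (j < formula_bound f)%N -> v j = w j) ->
  sat d C v f <-> sat d C w f.
Proof.
elim: f v w => [a b|a b|a|g IH|g IHg h IHh|i g IH] v w /= H.
- by rewrite (@teval_agree v w a) ?(@teval_agree v w b) // => j jl; apply: H; rewrite leq_max jl ?orbT.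
- by rewrite (@teval_agree v w a) ?(@teval_agree v w b) // => j jl; apply: H; rewrite leq_max jl ?orbT.
- by rewrite (@teval_agree v w a).
- by have := IH v w H; tauto.
- have := IHg v w; have := IHh v w.
  case; [by move=> j jl; apply: H; rewrite leq_max jl orbT|].
  move=> h1 h2; case; [by move=> j jl; apply: H; rewrite leq_max jl|].
  by tauto.
- have E x : sat d C (upd v i x) g <-> sat d C (upd w i x) g.
    apply: IH => j jl; rewrite /upd; case: eqP => // _.
    by apply: H; rewrite leq_max jl orbT.
  by split=> -[x] /E; exists x.
Qed.

Lemma sat_Fands C v l :
  sat d C v (Fands l) <-> forall f, List.In f l -> sat d C v f.
Proof.
elim: l => [|g l IH] /=; first by split.
split=> [[Hg /IH Hl] f [<-//|/Hl//]|H]; split; first by apply: H; left.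
by apply/IH => f fl; apply: H; right.
Qed.

Lemma sat_Fimp C v f g : sat d C v (Fimp f g) <-> (sat d C v f -> sat d C v g).
Proof. by rewrite /=; case: (classic (sat d C v g)); tauto. Qed.

Lemma sat_Fexs C v n f : sat d C v (Fexs n f) <->
  exists w, (forall j, (n <= j)%N -> w j = v j) /\ sat d C w f.
Proof.
elim: n f => [|n IH] f /=.
  split=> [Hv|[w [wv Hw]]]; first by exists v.
  by apply/(@sat_agree C v w) => // j _; rewrite wv.
rewrite IH; split=> [[w [wv /= [x Hx]]]|[w [wv Hw]]].
  exists (upd w n x); split=> // j nj; rewrite /upd gtn_eqF // wv //.
  exact: ltnW.
exists (upd w n (v n)); split=> [j|/=].
  by rewrite /upd; case: eqP => [->|/eqP jn] // nj; rewrite wv // ltn_neqAle eq_sym jn.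
exists (w n); apply/(@sat_agree C w) => // j _.
by rewrite /upd; case: eqP => // ->.
Qed.

Lemma sat_nocst C C' v f : nocst f -> sat d C v f <-> sat d C' v f.
Proof.
elim: f v => //= [g IH|g IHg h IHh|i g IH] v.
- by move=> ng; have := IH v ng; tauto.
- by move=> /andP[ng nh]; have := IHg v ng; have := IHh v nh; tauto.
- by move=> ng; have E x := IH (upd v i x) ng; split=> -[x] /E; exists x.
Qed.

Lemma teval_noder v t : noder_t t -> teval d v t = teval (fun x => x) v t.
Proof.
by elim: t => //= [a IHa b IHb /andP[/IHa-> /IHb->]|a IH /IH->|a IHa b IHb /andP[/IHa-> /IHb->]].
Qed.

Lemma sat_noder C v f : noder f -> sat d C v f <-> satM C v f.
Proof.
rewrite /satM; elim: f v => //= [a b|a b|a|g IH|g IHg h IHh|i g IH] v.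
- by move=> /andP[/teval_noder-> /teval_noder->].
- by move=> /andP[/teval_noder-> /teval_noder->].
- by move=> /teval_noder->.
- by move=> ng; have := IH v ng; tauto.
- by move=> /andP[ng nh]; have := IHg v ng; have := IHh v nh; tauto.
- by move=> ng; have E x := IH (upd v i x) ng; split=> -[x] /E; exists x.
Qed.

Lemma nocst_trC f : nocst (trC f).
Proof. by elim: f => //= g -> h ->. Qed.

Lemma satK_trC v f : noder f -> satK d v (trC f) <-> satM (kerd d) v f.
Proof.
move=> nf; rewrite -sat_noder // /satK; elim: f v nf => //= [g IH|g IHg h IHh|i g IH] v.
- by move=> ng; have := IH v ng; tauto.
- by move=> /andP[ng nh]; have := IHg v ng; have := IHh v nh; tauto.
- by move=> ng; have E x := IH (upd v i x) ng; split=> -[x] /E; exists x.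
Qed.

End Formulas.

Lemma upd_same (T : Type) (v : nat -> T) i x : upd v i x i = x.
Proof. by rewrite /upd eqxx. Qed.

(** Elementarity only speaks of assignments with values in the image of [h]. The variables of the
    formula are therefore quantified away before it is applied. *)
Lemma sat_transfer_forall (T1 T2 : realFieldType) (d1 : T1 -> T1) (d2 : T2 -> T2)
    (C1 : T1 -> Prop) (C2 : T2 -> Prop) (h : T1 -> T2) (Lang : formula -> bool) :
  (forall f, Lang f -> Lang (Fnot f)) -> (forall i f, Lang f -> Lang (Fex i f)) ->
  (forall f v, Lang f -> sat d1 C1 v f <-> sat d2 C2 (h \o v) f) ->
  forall f, Lang f -> (forall v, sat d1 C1 v f) -> forall w, sat d2 C2 w f.
Proof.
move=> Ln Le H f Lf H1 w; apply: NNPP => nw.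
have Ls n g : Lang g -> Lang (Fexs n g).
  by elim: n g => //= n IH g Lg; apply/IH/Le.
set n := formula_bound f; pose v := fun _ : nat => (0 : T1).
have : sat d2 C2 (h \o v) (Fexs n (Fnot f)).
  apply/sat_Fexs; exists (fun j => if (j < n)%N then w j else h 0); split.
    by move=> j nj; rewrite ltnNge nj.
  move=> Hw; apply: nw; move: Hw; apply: (iffLR (sat_agree d2 C2 _)) => j jn.
  by rewrite jn.
rewrite -H; last by apply/Ls/Ln.
by rewrite sat_Fexs => -[w1 [_ /=]]; apply.
Qed.

Section Saturation.
Variables (R : rcfType) (T : realFieldType) (iota : R -> T).

(* Shifting the copy of the natural numbers in R makes room for l. *)
Lemma small_params (l : seq T) : exists g : R -> T,
  (forall x, x \in l -> exists r, g r = x) /\ (forall r, exists r', g r' = iota r).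
Proof.
pose dec (r : R) := excluded_middle_informative (exists n, r = n%:R).
pose g r := match dec r with
  | left h => let n := proj1_sig (constructive_indefinite_description _ h) in
      if (n < size l)%N then nth 0 l n else iota (n - size l)%:R
  | right _ => iota r end.
have gn n : g n%:R = if (n < size l)%N then nth 0 l n else iota (n - size l)%:R.
  rewrite /g; case: (dec _) => [h|[]]; last by exists n.
  case: constructive_indefinite_description => m /= /eqP.
  by rewrite eqr_nat => /eqP->.
exists g; split=> [x xl|r].
  by exists (index x l)%:R; rewrite gn index_mem xl nth_index.
have [[n ->]|nr] := classic (exists n, r = n%:R).
  by exists (n + size l)%:R; rewrite gn ltnNge leq_addl /= addnK.
by exists r; rewrite /g; case: (dec r).
Qed.

(** [saturated] takes its parameters from the range of one map defined on R; by [small_params] a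
    finite list and the image of [iota] fit together into such a range. *)
Lemma saturated_small (d : T -> T) (C : T -> Prop) (Lang : formula -> bool)
    (l : seq T) (Sigma : formula -> (nat -> T) -> Prop) :
  saturated R Lang (sat d C) ->
  (forall f e, Sigma f e -> Lang f /\ forall j, e j \in l \/ exists r, e j = iota r) ->
  (forall s : list (formula * (nat -> T)),
     (forall q, List.In q s -> Sigma q.1 q.2) ->
     exists x, forall q, List.In q s -> sat d C (upd q.2 0 x) q.1) ->
  exists x, forall f e, Sigma f e -> sat d C (upd e 0 x) f.
Proof.
move=> Hsat HS Hfin; have [g [gl gR]] := small_params l.
have ge f e : Sigma f e -> exists e', e = g \o e'.
  move=> /HS[_ He].
  have /(_ _)/constructive_indefinite_description W j : exists r, g r = e j.
    by case: (He j) => [/gl//|[r ->]].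
  exists (fun j => proj1_sig (W j)); apply: functional_extensionality => j /=.
  by case: (W j).
have [| |x Hx] := Hsat g (fun q => Sigma q.1 (g \o q.2)).
- by move=> q /HS[].
- move=> s Hs.
  have [|x Hx] := Hfin (List.map (fun q => (q.1, g \o q.2)) s).
    by move=> q /List.in_map_iff[q' [<- /Hs]].
  exists x => q qs; apply: (Hx (q.1, g \o q.2)).
  by apply/List.in_map_iff; exists q.
- exists x => f e Sfe; have [e' ee'] := ge f e Sfe.
  by move: Sfe; rewrite ee' => Sfe; apply: (Hx (f, e')).
Qed.
End Saturation.

Notation termval U t := (teval (fun x => x) (nth 0 U) t).

(** Positivity of all terms decides equations as well: a term is zero exactly when neither it nor
    its opposite is positive. *)
Definition qftp (K : realFieldType) (U V : seq K) : Prop :=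
  forall t, noder_t t -> (0 < termval U t) = (0 < termval V t).

(** * Quantifier elimination and quantifier-free types *)

Section QuantifierFreeType.
Variables (K : realFieldType) (U V : seq K).
Hypothesis UV : qftp U V.

Lemma qftp_eq0 t : noder_t t -> (termval U t == 0) = (termval V t == 0).
Proof.
move=> nt; have := UV nt; have := UV (nt : noder_t (Topp t)) => /=.
by rewrite !oppr_gt0; case: (ltgtP (termval U t)) (ltgtP (termval V t)) => // _ [].
Qed.

Lemma qftp_lt s t : noder_t s -> noder_t t -> (termval U s < termval U t) = (termval V s < termval V t).
Proof.
move=> ns nt; have := UV (_ : noder_t (Tadd t (Topp s))).
by rewrite /= nt ns !subr_gt0; apply.
Qed.

Lemma qftp_eq s t : noder_t s -> noder_t t -> (termval U s == termval U t) = (termval V s == termval V t).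
Proof.
move=> ns nt; have := qftp_eq0 (_ : noder_t (Tadd s (Topp t))).
by rewrite /= nt ns !subr_eq0; apply.
Qed.

Fixpoint Tnat n := if n is m.+1 then Tadd T1 (Tnat m) else T0.
Lemma teval_nat (d : K -> K) v n : teval d v (Tnat n) = n%:R.
Proof. by elim: n => //= n ->; rewrite -natr1 addrC. Qed.
Lemma noder_nat n : noder_t (Tnat n). Proof. by elim: n. Qed.

(* sim x y : the isomorphism Q(U) -> Q(V) matches x with y (up to the denominators
   that are needed here). *)
Definition sim (x y : K) : Prop := exists n t, [/\ noder_t t,
  n.+1%:R * x = termval U t & n.+1%:R * y = termval V t].

Lemma sim_lt x y : sim x y -> (0 < x) = (0 < y).
Proof.
move=> [n [t [nt e1 e2]]].
by rewrite -(pmulr_rgt0 x (ltr0Sn _ n)) -(pmulr_rgt0 y (ltr0Sn _ n)) e1 e2; apply: UV.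
Qed.

Lemma simD x y x' y' : sim x y -> sim x' y' -> sim (x + x') (y + y').
Proof.
move=> [n [t [nt e1 e2]]] [m [s [ns f1 f2]]].
exists (n.+1 * m.+1).-1, (Tadd (Tmul (Tnat m.+1) t) (Tmul (Tnat n.+1) s)).
split; first by rewrite /= !noder_nat nt ns.
- by rewrite prednK // natrM [RHS]/= -e1 -f1 !teval_nat -!natr1; ring.
- by rewrite prednK // natrM [RHS]/= -e2 -f2 !teval_nat -!natr1; ring.
Qed.

Lemma simM x y x' y' : sim x y -> sim x' y' -> sim (x * x') (y * y').
Proof.
move=> [n [t [nt e1 e2]]] [m [s [ns f1 f2]]].
exists (n.+1 * m.+1).-1, (Tmul t s).
split; first by rewrite /= nt ns.
- by rewrite prednK // natrM /= -e1 -f1; ring.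
- by rewrite prednK // natrM /= -e2 -f2; ring.
Qed.

Lemma simN x y : sim x y -> sim (- x) (- y).
Proof.
move=> [n [t [nt e1 e2]]]; exists n, (Topp t); split=> //.
- by rewrite /= -e1 mulrN.
- by rewrite /= -e2 mulrN.
Qed.

Lemma sim_termval t : noder_t t -> sim (termval U t) (termval V t).
Proof. by move=> nt; exists 0%N, t; split=> //; rewrite mul1r. Qed.

Lemma sim_nat n : sim n%:R n%:R.
Proof. by have := sim_termval (noder_nat n); rewrite !teval_nat. Qed.

Lemma sim0 : sim 0 0. Proof. exact: (sim_nat 0). Qed.

Lemma sim_int (z : int) : sim z%:~R z%:~R.
Proof.
by case: z => n; [exact: sim_nat | rewrite NegzE rmorphN /=; apply/simN/sim_nat].
Qed.

(** The elimination procedure uses coefficients of an inverted integer matrix, hence rational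
    constants; these account for the denominator [n.+1] in [sim]. *)
Lemma sim_ratr (q : rat) : sim (ratr q) (ratr q).
Proof.
have [n [t [nt e1 e2]]] := sim_int (numq q).
have E : ratr q = (numq q)%:~R / (denq q)%:~R :> K by rewrite -{1}(divq_num_den q) fmorph_div /= !ratr_int.
have [m dm] : exists m : nat, denq q = m.+1%:Z.
  by case: (denq q) (denq_gt0 q) => [[|m]|m] // _; exists m.
exists (n.+1 * m.+1).-1, t; rewrite E dm prednK //; split=> //.
- by rewrite -e1 natrM -mulrA; congr (_ * _); rewrite mulrCA mulfV ?mulr1 ?pnatr_eq0.
- by rewrite -e2 natrM -mulrA; congr (_ * _); rewrite mulrCA mulfV ?mulr1 ?pnatr_eq0.
Qed.

Lemma simX x y n : sim x y -> sim (x ^+ n) (y ^+ n).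
Proof.
move=> H; elim: n => [|n IH]; first by rewrite !expr0; apply: (sim_nat 1).
by rewrite !exprS; apply: simM.
Qed.

End QuantifierFreeType.

Module Q := qe_rcf.

(** * The elimination procedure introduces rational constants only *)

Section EliminationInvariance.
Variables (K : rcfType) (U V : seq K).
Hypothesis UV : qftp U V.
Notation tF := (Q.term K).
Notation fF := (Q.formula K).
Notation pF := (seq tF).
Notation sim := (sim U V).

(** The elimination programs are in continuation-passing style and build formulas that may contain
    constants of K. Each lemma below follows one program and shows that it turns invariant terms and
    continuations into a formula with the same truth value at [U] and at [V]. *)
Definition inv_f (f : fF) := Q.qf_eval U f = Q.qf_eval V f.
Definition inv_t (t : tF) := sim (Q.eval U t) (Q.eval V t).
Fixpoint inv_p (p : pF) := if p is c :: q then inv_t c /\ inv_p q else True.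
Fixpoint inv_ps (ps : seq pF) := if ps is p :: qs then inv_p p /\ inv_ps qs else True.

Lemma inv_const c : sim c c -> inv_t (Q.Const c). Proof. by []. Qed.
Lemma inv_nat n : inv_t (Q.NatConst _ n). Proof. exact: sim_nat. Qed.
Lemma inv_add a b : inv_t a -> inv_t b -> inv_t (Q.Add a b).
Proof. exact: simD. Qed.
Lemma inv_mul a b : inv_t a -> inv_t b -> inv_t (Q.Mul a b).
Proof. exact: simM. Qed.
Lemma inv_opp a : inv_t a -> inv_t (Q.Opp a).
Proof. exact: simN. Qed.
Lemma inv_exp a n : inv_t a -> inv_t (Q.Exp a n).
Proof. exact: simX. Qed.

Lemma inv_Lt a : inv_t a -> inv_f (Q.Lt (Q.NatConst _ 0) a).
Proof. exact: sim_lt. Qed.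
Lemma inv_Lt0 a : inv_t a -> inv_f (Q.Lt a (Q.NatConst _ 0)).
Proof. by move/simN/(sim_lt UV); rewrite /inv_f /= !oppr_gt0. Qed.
Lemma inv_Eq0 a : inv_t a -> inv_f (Q.Equal a (Q.NatConst _ 0)).
Proof.
move=> Ha; have := inv_Lt Ha; have := inv_Lt0 Ha; rewrite /inv_f /=.
by case: (ltgtP (Q.eval U a)) (ltgtP (Q.eval V a)) => // _ [].
Qed.
Lemma inv_If c f g : inv_f c -> inv_f f -> inv_f g -> inv_f (Q.If c f g).
Proof. by rewrite /inv_f /= => -> -> ->. Qed.

Lemma inv_Or f g : inv_f f -> inv_f g -> inv_f (Q.Or f g).
Proof. by rewrite /inv_f /= => -> ->. Qed.
Lemma inv_And f g : inv_f f -> inv_f g -> inv_f (Q.And f g).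
Proof. by rewrite /inv_f /= => -> ->. Qed.

Lemma inv_Size p k : inv_p p -> (forall n, inv_f (k n)) -> inv_f (Q.Size p k).
Proof.
elim: p k => [|c p IH] k /=; first by move=> _; apply.
move=> [Hc Hp] Hk; apply: IH => // -[|n]; last exact: Hk.
by apply: inv_If; rewrite ?Hk //; apply: inv_Eq0.
Qed.

Lemma inv_Isnull p k : inv_p p -> (forall b, inv_f (k b)) -> inv_f (Q.Isnull p k).
Proof. by move=> Hp Hk; apply: inv_Size. Qed.

Lemma inv_LtSize p q k : inv_p p -> inv_p q -> (forall b, inv_f (k b)) ->
  inv_f (Q.LtSize p q k).
Proof. by move=> Hp Hq Hk; apply: inv_Size => // n; apply: inv_Size. Qed.

Lemma inv_LeadCoef p k : inv_p p -> (forall l, inv_t l -> inv_f (k l)) ->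
  inv_f (Q.LeadCoef p k).
Proof.
elim: p k => [|c p IH] k /=; first by move=> _; apply; exact: sim0.
move=> [Hc Hp] Hk; apply: IH => // l Hl.
by apply: inv_If; [apply: inv_Eq0 | apply: Hk | apply: Hk].
Qed.

Lemma inv_AmulXn a n : inv_t a -> inv_p (Q.AmulXn a n).
Proof. by move=> Ha; elim: n => //= n IH; split=> //; exact: sim0. Qed.

Lemma inv_AddPoly p q : inv_p p -> inv_p q -> inv_p (Q.AddPoly p q).
Proof.
elim: p q => //= a p IH [|b q] //= [Ha Hp] [Hb Hq].
by split; [apply: inv_add | apply: IH].
Qed.

Lemma inv_ScalPoly c p : inv_t c -> inv_p p -> inv_p (Q.ScalPoly c p).
Proof. by move=> Hc; elim: p => //= a p IH [Ha /IH]; split=> //; apply: inv_mul. Qed.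

Lemma inv_MulPoly p q : inv_p p -> inv_p q -> inv_p (Q.MulPoly p q).
Proof.
elim: p => //= a p IH [Ha Hp] Hq; apply: inv_AddPoly.
  exact: inv_ScalPoly.
by split; [exact: inv_nat | exact: IH].
Qed.

Lemma inv_ExpPoly p n : inv_p p -> inv_p (Q.ExpPoly p n).
Proof.
move=> Hp; case: n => [|n]; first by split=> //; exact: inv_nat.
by rewrite /Q.ExpPoly iteropS; elim: n => //= n IH; apply: inv_MulPoly.
Qed.

Lemma inv_OppPoly p : inv_p p -> inv_p (Q.OppPoly p).
Proof. by apply: inv_ScalPoly; apply: (sim_int U V (-1)). Qed.

Lemma inv_Deriv p : inv_p p -> inv_p (Q.Deriv p).
Proof.
elim: p => //= a p IH [Ha Hp]; apply: inv_AddPoly => //.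
by split; [exact: inv_nat | exact: IH].
Qed.

Lemma inv_Rediv_rec_loop q sq cq c qq r n k :
  inv_p q -> inv_t cq -> inv_p qq -> inv_p r ->
  (forall c qq r, inv_p qq -> inv_p r -> inv_f (k (c, qq, r))) ->
  inv_f (Q.Rediv_rec_loop q sq cq c qq r n k).
Proof.
move=> Hq Hcq; elim: n c qq r => [|n IH] c qq r Hqq Hr Hk /=;
  apply: inv_Size => // sr; case: ifP => _; try exact: Hk;
  apply: inv_LeadCoef => // l Hl.
- apply: Hk.
    by apply: inv_AddPoly; [apply: inv_MulPoly | apply: inv_AmulXn].
  apply: inv_AddPoly; first by apply: inv_MulPoly.
  by apply: inv_OppPoly; apply: inv_MulPoly => //; apply: inv_AmulXn.
- apply: IH => //.
    by apply: inv_AddPoly; [apply: inv_MulPoly | apply: inv_AmulXn].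
  apply: inv_AddPoly; first by apply: inv_MulPoly.
  by apply: inv_OppPoly; apply: inv_MulPoly => //; apply: inv_AmulXn.
Qed.

Lemma inv_Rediv p q k : inv_p p -> inv_p q ->
  (forall c qq r, inv_p qq -> inv_p r -> inv_f (k (c, qq, r))) ->
  inv_f (Q.Rediv p q k).
Proof.
have H0 : inv_p [:: Q.Const 0] by split=> //; exact: sim0.
move=> Hp Hq Hk; apply: inv_Isnull => // -[]; first exact: Hk.
apply: inv_Size => // sq; apply: inv_Size => // sp.
by apply: inv_LeadCoef => // l Hl; apply: inv_Rediv_rec_loop.
Qed.

Lemma inv_Rmod p q k : inv_p p -> inv_p q -> (forall r, inv_p r -> inv_f (k r)) ->
  inv_f (Q.Rmod p q k).
Proof. by move=> Hp Hq Hk; apply: inv_Rediv => // c qq r _; apply: Hk. Qed.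

Lemma inv_Rscal p q k : inv_p p -> inv_p q -> (forall n, inv_f (k n)) ->
  inv_f (Q.Rscal p q k).
Proof. by move=> Hp Hq Hk; apply: inv_Rediv => // c qq r _ _; apply: Hk. Qed.

Lemma inv_Rgcd_loop n p q k : inv_p p -> inv_p q -> (forall r, inv_p r -> inv_f (k r)) ->
  inv_f (Q.Rgcd_loop n p q k).
Proof.
elim: n p q => [|n IH] p q Hp Hq Hk /=; apply: inv_Rmod => // r Hr;
  apply: inv_Isnull => // -[]; try exact: Hk.
exact: IH.
Qed.

Lemma inv_Rgcd p q k : inv_p p -> inv_p q -> (forall r, inv_p r -> inv_f (k r)) ->
  inv_f (Q.Rgcd p q k).
Proof.
move=> Hp Hq Hk; apply: inv_LtSize => // -[]; apply: inv_Isnull => // -[];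
  try exact: Hk; apply: inv_Size => // n; exact: inv_Rgcd_loop.
Qed.

Lemma inv_BigRgcd ps k : inv_ps ps -> (forall r, inv_p r -> inv_f (k r)) ->
  inv_f (Q.BigRgcd ps k).
Proof.
elim: ps k => [|p ps IH] k /=.
  by move=> _; apply; split=> //; exact: sim0.
by move=> [Hp Hps] Hk; apply: IH => // r Hr; apply: inv_Rgcd.
Qed.

Lemma inv_Changes s k : inv_p s -> (forall n, inv_f (k n)) -> inv_f (Q.Changes s k).
Proof.
elim: s k => [|a s IH] k /=; first by move=> _; apply.
move=> [Ha Hs] Hk; apply: IH => // n; apply: inv_If => //.
apply: inv_Lt0; apply: inv_mul => //; case: (s) Hs => [|b s'] /=; last by case.
by move=> _; apply: inv_nat.
Qed.

Lemma inv_SeqPInfty ps k : inv_ps ps -> (forall s, inv_p s -> inv_f (k s)) ->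
  inv_f (Q.SeqPInfty ps k).
Proof.
elim: ps k => [|p ps IH] k /=; first by move=> _; apply.
move=> [Hp Hps] Hk; apply: inv_LeadCoef => // l Hl; apply: IH => // s Hs.
by apply: Hk.
Qed.

Lemma inv_SeqMInfty ps k : inv_ps ps -> (forall s, inv_p s -> inv_f (k s)) ->
  inv_f (Q.SeqMInfty ps k).
Proof.
elim: ps k => [|p ps IH] k /=; first by move=> _; apply.
move=> [Hp Hps] Hk; apply: inv_LeadCoef => // l Hl; apply: inv_Size => // n.
apply: IH => // s Hs; apply: Hk; split=> //; apply: inv_mul => //.
by apply: inv_exp; apply: (sim_int U V (-1)).
Qed.

Lemma inv_ChangesPoly ps k : inv_ps ps -> (forall z, inv_f (k z)) ->
  inv_f (Q.ChangesPoly ps k).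
Proof.
move=> Hps Hk; apply: inv_SeqMInfty => // s Hs; apply: inv_SeqPInfty => // s' Hs'.
by apply: inv_Changes => // n; apply: inv_Changes.
Qed.

Lemma inv_NextMod p q k : inv_p p -> inv_p q -> (forall r, inv_p r -> inv_f (k r)) ->
  inv_f (Q.NextMod p q k).
Proof.
move=> Hp Hq Hk; apply: inv_LeadCoef => // l Hl; apply: inv_Rscal => // n.
apply: inv_Rmod => // r Hr; apply: Hk; apply: inv_ScalPoly => //.
by apply: inv_opp; apply: inv_exp.
Qed.

Lemma inv_ModsAux p q n k : inv_p p -> inv_p q -> (forall ps, inv_ps ps -> inv_f (k ps)) ->
  inv_f (Q.ModsAux p q n k).
Proof.
elim: n p q k => [|n IH] p q k Hp Hq Hk /=; first exact: Hk.
apply: inv_Isnull => // -[]; first exact: Hk.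
by apply: inv_NextMod => // r Hr; apply: IH => // ps Hps; apply: Hk.
Qed.

Lemma inv_TaqR p q k : inv_p p -> inv_p q -> (forall z, inv_f (k z)) ->
  inv_f (Q.TaqR p q k).
Proof.
move=> Hp Hq Hk.
have Hpq : inv_p (Q.MulPoly (Q.Deriv p) q) by apply: inv_MulPoly => //; apply: inv_Deriv.
apply: inv_Size => // n; apply: inv_Size => // m; apply: inv_ModsAux => // ps Hps.
exact: inv_ChangesPoly.
Qed.

Lemma inv_nth ps i : inv_ps ps -> inv_p (nth [::] ps i).
Proof. by elim: ps i => [|p ps IH] [|i] //= [Hp Hps]; [|apply: IH]. Qed.

Lemma inv_bigmul (I : Type) (s : seq I) (F : I -> pF) : (forall i, inv_p (F i)) ->
  inv_p (reducebig [:: Q.NatConst _ 1] s (fun i => BigBody i (@Q.MulPoly K) true (F i))).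
Proof.
move=> HF; rewrite /reducebig; elim: s => [|i s IH] /=.
  by split=> //; apply: inv_nat.
exact: inv_MulPoly.
Qed.

Lemma inv_Pcq ps i : inv_ps ps -> inv_p (Q.Pcq ps i).
Proof.
move=> Hps; rewrite /Q.Pcq; apply: inv_nth; elim: (qe_rcf_th.sg_tab _) => //= sc s IH.
split=> //; apply: inv_bigmul => j; apply: inv_ExpPoly; exact: inv_nth.
Qed.

(** These are entries of the inverse of the integer matrix [ctmat], so they are images of rationals;
    for [n] below 2 the procedure lists them explicitly. *)
Lemma inv_Coefs n i : inv_t (Q.Coefs K n i).
Proof.
apply: inv_const; case: n => [|[|n]].
- by case: (i == 0%N); [apply: (sim_nat U V 1) | exact: sim0].
- have H2 : sim 2^-1 2^-1 by have := sim_ratr U V 2%:R^-1; rewrite fmorphV /= ratr_nat.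
  have H0 := sim_nat U V 0.
  by case: i => [|[|[|i]]] //=; rewrite nth_nil.
rewrite /qe_rcf_th.coefs; set m := n.+2.
have [ilt|ige] := ltnP i (size (enum 'I_(3 ^ m))); last first.
  rewrite nth_default; first exact: sim0.
  by rewrite size_map.
have i0 : 'I_(3 ^ m) by exists i; rewrite size_enum_ord in ilt.
rewrite (nth_map i0) //.
rewrite castmxE.
have -> : map_mx (intmul 1 : int -> K) (qe_rcf_th.ctmat m) =
    map_mx (@ratr K) (map_mx (intmul 1 : int -> rat) (qe_rcf_th.ctmat m)).
  by apply/matrixP => a b; rewrite !mxE ratr_int.
by rewrite -map_invmx mxE; apply: sim_ratr.
Qed.

Lemma inv_CcountWeak p sq k : inv_p p -> inv_ps sq ->
  (forall t, inv_t t -> inv_f (k t)) -> inv_f (Q.CcountWeak p sq k).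
Proof.
move=> Hp Hsq; rewrite /Q.CcountWeak.
have : inv_t (Q.NatConst K 0) by apply: inv_nat.
elim: (3 ^ _)%N k (Q.NatConst K 0) => [|n IH] k s Hs Hk /=; first exact: Hk.
apply: inv_TaqR => //; first exact: inv_Pcq.
move=> z; apply: IH => //; apply: inv_add => //; apply: inv_mul; last exact: inv_Coefs.
exact: sim_int.
Qed.

Lemma inv_CcountGt0 sp sq : inv_ps sp -> inv_ps sq -> inv_f (Q.CcountGt0 sp sq).
Proof.
move=> Hsp Hsq; apply: inv_BigRgcd => // p Hp; apply: inv_Isnull => // -[] /=; last first.
  by apply: inv_CcountWeak => // t Ht; apply: inv_Lt.
apply: inv_CcountWeak => //.
  apply: inv_Deriv; rewrite /reducebig; elim: (sq) Hsq => [|q s IH] /=.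
    by move=> _; split=> //; apply: inv_nat.
  by move=> [Hq /IH]; apply: inv_MulPoly.
move=> t Ht; apply: inv_Or.
  rewrite /reducebig; elim: (sq) Hsq => [|q s IH] //= [Hq /IH Hs].
  by apply: inv_And => //; apply: inv_LeadCoef => // l Hl; apply: inv_Lt.
apply: inv_Or; last exact: inv_Lt.
rewrite /reducebig; elim: (sq) Hsq => [|q s IH] //= [Hq /IH Hs].
apply: inv_And => //; apply: inv_Size => // n; apply: inv_LeadCoef => // l Hl.
apply: inv_Lt; apply: inv_mul => //; apply: inv_exp; apply: inv_opp; exact: inv_nat.
Qed.
End EliminationInvariance.

Section QuantifierFreeTypeExtension.
Variable K : rcfType.
Implicit Types (U V : seq K).

Fixpoint qterm (t : term) : Q.term K :=
  match t with
  | Tvar i => Q.Var K i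
  | T0 => Q.NatConst K 0
  | T1 => Q.NatConst K 1
  | Tadd a b => Q.Add (qterm a) (qterm b)
  | Topp a => Q.Opp (qterm a)
  | Tmul a b => Q.Mul (qterm a) (qterm b)
  | Tder a => qterm a
  end.

Lemma eval_qterm U t : Q.eval U (qterm t) = termval U t.
Proof. by elim: t => //= [a -> b ->|a ->|a -> b ->]. Qed.

Lemma inv_abstrX U V i t : inv_p U V (Q.abstrX i (qterm t)).
Proof.
elim: t => /= [j|||a IHa b IHb|a IH|a IHa b IHb|//].
- case: eqP => _; first by split; [exact: sim0 | split=> //; exact: (sim_nat U V 1)].
  by split=> //; exact: (@sim_termval _ U V (Tvar j)).
- by split=> //; exact: sim0.
- by split=> //; exact: (sim_nat U V 1).
- exact: inv_AddPoly.
- exact: inv_OppPoly.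
- exact: inv_MulPoly.
Qed.

Lemma termval_rcons U x t : termval (set_nth 0 U (size U) x) t = termval (rcons U x) t.
Proof.
congr teval; apply: functional_extensionality => j; congr (nth _ _ _).
apply: (@eq_from_nth _ 0); first by rewrite size_set_nth size_rcons (maxn_idPl _).
move=> i _; rewrite nth_set_nth /= nth_rcons; case: ltngtP => // iU.
by rewrite nth_default // ltnW.
Qed.

(* This is where quantifier elimination for real closed fields enters. *)
Lemma qftp_exists U V (sp sq : seq term) : qftp U V -> size U = size V ->
  (exists x, all (fun t => termval (rcons U x) t == 0) sp &&
             all (fun t => 0 < termval (rcons U x) t) sq) ->
  exists y, all (fun t => termval (rcons V y) t == 0) sp &&
            all (fun t => 0 < termval (rcons V y) t) sq.
Proof.
move=> UV sUV.
pose ab := fun t => Q.abstrX (size U) (qterm t).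
have E W x : size W = size U -> forall t,
    (Q.eval_poly W (ab t)).[x] = termval (rcons W x) t.
  by move=> sW t; rewrite Q.abstrXP eval_qterm -sW termval_rcons.
have inv_ab s : inv_ps U V (map ab s).
  by elim: s => //= t s IH; split=> //; apply: inv_abstrX.
have := inv_CcountGt0 UV (inv_ab sp) (inv_ab sq).
rewrite /inv_f !Q.eval_CcountGt0 => H [x Hx].
have : qe_rcf_th.ccount_gt0 (map (Q.eval_poly U) (map ab sp)) (map (Q.eval_poly U) (map ab sq)).
  apply/qe_rcf_th.ccount_gt0P; exists x; rewrite !big_all !all_map.
  move: Hx => /andP[H1 H2]; apply/andP; split.
    by apply: sub_all H1 => t /=; rewrite E.
  by apply: sub_all H2 => t /=; rewrite E.
rewrite H => /qe_rcf_th.ccount_gt0P[y]; rewrite !big_all !all_map => /andP[H1 H2].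
exists y; apply/andP; split.
  by apply: sub_all H1 => t /=; rewrite E.
by apply: sub_all H2 => t /=; rewrite E.
Qed.

Fixpoint tpoly U (n : nat) (t : term) : {poly K} :=
  match t with
  | Tvar i => if i == n then 'X else (nth 0 U i)%:P
  | T0 => 0
  | T1 => 1
  | Tadd a b => tpoly U n a + tpoly U n b
  | Topp a => - tpoly U n a
  | Tmul a b => tpoly U n a * tpoly U n b
  | Tder a => tpoly U n a
  end.

Lemma horner_tpoly U x t : (tpoly U (size U) t).[x] = termval (rcons U x) t.
Proof.
elim: t => /= [i|||a <- b <-|a <-|a <- b <-|//]; rewrite ?hornerE //.
rewrite nth_rcons; case: ltngtP => iU; rewrite ?hornerE //.
by rewrite nth_default // ltnW.
Qed.

Lemma tpoly_gfield U n t i : gfield (fun x => x \in U) (tpoly U n t)`_i.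
Proof.
move: i; apply/polyOver_gfield; elim: t => /= [i|||a Ha b Hb|a Ha|a Ha b Hb|//].
- case: eqP => _; first exact: polyOverX.
  rewrite polyOverC; apply/gfieldbP.
  have [iU|iU] := ltnP i (size U); last by rewrite nth_default //; exact: gen_zero.
  by apply: gen_incl; apply: mem_nth.
- exact: rpred0.
- exact: rpred1.
- exact: rpredD.
- by rewrite rpredN.
- exact: rpredM.
Qed.

Lemma termval_open V y (sq : seq term) : all (fun t => 0 < termval (rcons V y) t) sq ->
  exists2 e, 0 < e & forall z, y - e < z -> z < y + e ->
    all (fun t => 0 < termval (rcons V z) t) sq.
Proof.
elim: sq => [|t sq IH] /=; first by exists 1.
move=> /andP[Ht /IH[e e0 He]].
rewrite -horner_tpoly in Ht; have [e' e0' He'] := poly_cont y (tpoly V (size V) t) Ht.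
exists (Num.min e e'); first by rewrite lt_min e0.
move=> z z1 z2; have [m1 m2] : Num.min e e' <= e /\ Num.min e e' <= e'.
  by rewrite !ge_min !lexx orbT.
rewrite He ?andbT; [|lra|lra].
have : `|z - y| < e' by rewrite ltr_norml; apply/andP; split; lra.
by move=> /He'; rewrite ltr_norml horner_tpoly => /andP[h _]; move: h Ht; rewrite !horner_tpoly; lra.
Qed.
End QuantifierFreeTypeExtension.

(** * Realizing quantifier-free types by saturation *)

Section Realization.
Variables (R : rcfType) (K : rcfType) (d : K -> K) (iota : R -> K).
Hypothesis iota0 : iota 0 = 0.
Hypothesis Ksat : saturated R nocst (sat d (kerd d)).
Implicit Types (U V l : seq K).

Fixpoint tren (s : nat -> nat) (t : term) : term :=
  match t with
  | Tvar i => Tvar (s i)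
  | T0 => T0 | T1 => T1
  | Tadd a b => Tadd (tren s a) (tren s b)
  | Topp a => Topp (tren s a)
  | Tmul a b => Tmul (tren s a) (tren s b)
  | Tder a => Tder (tren s a)
  end.

Lemma teval_tren (T : realFieldType) (d' : T -> T) s v t :
  teval d' v (tren s t) = teval d' (v \o s) t.
Proof. by elim: t => //= [a -> b ->|a ->|a -> b ->|a ->]. Qed.

Lemma noder_tren s t : noder_t (tren s t) = noder_t t.
Proof. by elim: t => //= [a -> b ->|a -> b ->]. Qed.

Definition params l (f : formula) (e : nat -> K) :=
  nocst f /\ forall j, e j \in l \/ exists r, e j = iota r.

(** The type to realize consists of the equations and inequalities of [x] over [U], read over [V],
    together with [Sigma0]; the second hypothesis is its finite satisfiability, sorted by these
    three kinds. *)
Lemma qftp_realize U V x l (Sigma0 : formula -> (nat -> K) -> Prop) :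
  (forall f e, Sigma0 f e -> params l f e) ->
  (forall sp sq : seq term,
     (forall t, List.In t sp -> noder_t t /\ termval (rcons U x) t = 0) ->
     (forall t, List.In t sq -> noder_t t /\ 0 < termval (rcons U x) t) ->
     forall s : list (formula * (nat -> K)), (forall q, List.In q s -> Sigma0 q.1 q.2) ->
     exists y, [/\ forall t, List.In t sp -> termval (rcons V y) t = 0,
       forall t, List.In t sq -> 0 < termval (rcons V y) t &
       forall q, List.In q s -> sat d (kerd d) (upd q.2 0 y) q.1]) ->
  exists y, qftp (rcons U x) (rcons V y) /\
    forall f e, Sigma0 f e -> sat d (kerd d) (upd e 0 y) f.
Proof.
move=> HS Hfin.
(* Saturation fixes the unknown as variable 0, while the new point sits at position [n]; [sh] sends
   [n] to 0 and raises all other indices by one. *)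
pose n := size V; pose sh i := if i == n then 0%N else i.+1.
pose eV := fun j : nat => nth 0 V j.-1.
have evalV y t : noder_t t -> teval d (upd eV 0 y) (tren sh t) = termval (rcons V y) t.
  move=> nt; rewrite teval_tren (teval_noder _ _ nt); congr teval.
  apply: functional_extensionality => i /=; rewrite /sh /upd nth_rcons.
  by case: ltngtP => //= iV; rewrite /eV nth_default // ltnW.
pose Sigma f e := Sigma0 f e \/ e = eV /\ exists t, noder_t t /\
  ((f = Feq (tren sh t) T0 /\ termval (rcons U x) t = 0) \/
   (f = Flt T0 (tren sh t) /\ 0 < termval (rcons U x) t)).
have [||y Hy] := @saturated_small R K iota d (kerd d) nocst (l ++ V) Sigma Ksat.
- move=> f e [/HS[nf He]|[-> [t [nt ft]]]].
    by split=> // j; rewrite mem_cat; case: (He j) => [->|[r ->]]; [left | right; exists r].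
  split; first by case: ft => -[-> _].
  move=> j; rewrite mem_cat /eV; have [jV|jV] := ltnP j.-1 n.
    by left; rewrite mem_nth ?orbT.
  by right; exists 0; rewrite nth_default.
- move=> s Hs.
  suff [sp [sq [s0 [Hsp Hsq Hs0 H]]]] : exists (sp sq : seq term) s0,
    [/\ forall t, List.In t sp -> noder_t t /\ termval (rcons U x) t = 0,
        forall t, List.In t sq -> noder_t t /\ 0 < termval (rcons U x) t,
        forall q, List.In q s0 -> Sigma0 q.1 q.2 &
        forall y, (forall t, List.In t sp -> termval (rcons V y) t = 0) ->
          (forall t, List.In t sq -> 0 < termval (rcons V y) t) ->
          (forall q, List.In q s0 -> sat d (kerd d) (upd q.2 0 y) q.1) ->
          forall q, List.In q s -> sat d (kerd d) (upd q.2 0 y) q.1].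
    have [y [H1 H2 H3]] := Hfin sp sq Hsp Hsq s0 Hs0.
    by exists y; apply: H.
  elim: s Hs => [|[f e] s IH] Hs; first by exists nil, nil, nil; split.
  have [|sp [sq [s0 [Hsp Hsq Hs0 H]]]] := IH; first by move=> q qs; apply: Hs; right.
  have := Hs (f, e) (or_introl erefl); rewrite /Sigma /=.
  case=> [Hf|[-> [t [nt [[-> Ht]|[-> Ht]]]]]].
  + exists sp, sq, ((f, e) :: s0); split=> //.
      by move=> q [<-|/Hs0].
    move=> y H1 H2 H3 q [<-|qs]; first by apply: (H3 (f, e)); left.
    by apply: H qs => // q' q's; apply: H3; right.
  + exists (t :: sp), sq, s0; split=> //.
      by move=> t' [<-|/Hsp].
    move=> y H1 H2 H3 q [<-|qs]; last by apply: H qs => // t' t's; apply: H1; right.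
    by rewrite /= evalV // H1 //; left.
  + exists sp, (t :: sq), s0; split=> //.
      by move=> t' [<-|/Hsq].
    move=> y H1 H2 H3 q [<-|qs]; last by apply: H qs => // t' t's; apply: H2; right.
    by rewrite /= evalV // H2 //; left.
exists y; split; last by move=> f e Hf; apply: Hy; left.
have P0 t : noder_t t -> termval (rcons U x) t = 0 -> termval (rcons V y) t = 0.
  move=> nt Ht; have := Hy (Feq (tren sh t) T0) eV; rewrite /= evalV //; apply.
  by right; split=> //; exists t; split=> //; left.
have P1 t : noder_t t -> 0 < termval (rcons U x) t -> 0 < termval (rcons V y) t.
  move=> nt Ht; have := Hy (Flt T0 (tren sh t)) eV; rewrite /= evalV //; apply.
  by right; split=> //; exists t; split=> //; right.
move=> t nt; case: (ltgtP 0 (termval (rcons U x) t)) => Ht.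
- by rewrite P1.
- have := P1 (Topp t) nt; rewrite /= !oppr_gt0 => /(_ Ht) H.
  by apply/esym/negbTE; rewrite -leNgt ltW.
- by rewrite P0 ?ltxx.
Qed.

Lemma all_In (T : Type) (P : pred T) s : all P s <-> forall t, List.In t s -> P t.
Proof.
elim: s => //= a s IH; split=> [/andP[Pa /IH Ps] t [<-|/Ps]|H] //.
by rewrite H; [apply/IH => t ts; apply: H; right | left].
Qed.

Lemma qftp_ext U V x : qftp U V -> size U = size V ->
  exists y, qftp (rcons U x) (rcons V y).
Proof.
move=> UV sUV; have [//||y []] := @qftp_realize U V x [::] (fun _ _ => False); last by exists y.
move=> sp sq Hsp Hsq s Hs.
have [|y /andP[/all_In H1 /all_In H2]] := @qftp_exists K U V sp sq UV sUV.
  exists x; apply/andP; split; apply/all_In => t; first by move/Hsp => [_ ->].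
  by move/Hsq => [].
exists y; split=> [t /H1/eqP|t /H2|q /Hs] //.
Qed.

(** A point transcendental over [U] satisfies only trivial equations, so its type is given by strict
    inequalities. Finitely many of these hold on an interval around some point over [V], where
    [Sigma0] is finitely satisfiable. *)
Lemma qftp_ext_generic U V x l (Sigma0 : formula -> (nat -> K) -> Prop) :
  qftp U V -> size U = size V -> ~ acl (fun z => z \in U) x ->
  (forall f e, Sigma0 f e -> params l f e) ->
  (forall a b, a < b -> forall s : list (formula * (nat -> K)),
     (forall q, List.In q s -> Sigma0 q.1 q.2) ->
     exists y, [/\ a < y, y < b &
       forall q, List.In q s -> sat d (kerd d) (upd q.2 0 y) q.1]) ->
  exists y, qftp (rcons U x) (rcons V y) /\
    forall f e, Sigma0 f e -> sat d (kerd d) (upd e 0 y) f.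
Proof.
move=> UV sUV nx HS Hd; apply: (qftp_realize HS) => sp sq Hsp Hsq s Hs.
have [|y0 /andP[_ Hy0]] := @qftp_exists K U V [::] sq UV sUV.
  by exists x; apply/all_In => t /Hsq[].
have [e e0 He] := termval_open Hy0.
have ab : y0 - e < y0 + e by lra.
have [//|y [y1 y2 Hy]] := Hd _ _ ab s.
exists y; split=> //; last by apply/all_In/He.
move=> t /Hsp[nt Ht]; apply: NNPP => /eqP nz.
(* If [t] did not vanish at [y], elimination from [V] back to [U] would give a point where it does
   not vanish over [U]; yet [t] is identically zero there, as [x] is transcendental. The square
   expresses being nonzero as a strict inequality. *)
have [|||z /andP[_]] := @qftp_exists K V U [::] [:: Tmul t t].
- by move=> t' nt'; rewrite UV.
- by rewrite sUV.
- by exists y; rewrite /= andbT -expr2 exprn_even_gt0.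
rewrite /= andbT -!horner_tpoly.
have -> : tpoly U (size U) t = 0; last by rewrite horner0 mulr0 ltxx.
apply/eqP; apply: contra_notT nx => tx; exists (tpoly U (size U) t); split=> //.
  by move=> i; apply: tpoly_gfield.
by apply/rootP; rewrite horner_tpoly.
Qed.
End Realization.

(** * Back and forth *)

Section BackAndForth.
Variables (K : realFieldType) (C : K -> Prop) (Rel : seq K -> seq K -> Prop).
Hypothesis Rel_qftp : forall U V, Rel U V -> size U = size V /\ qftp U V.
Hypothesis Rel_sym : forall U V, Rel U V -> Rel V U.
Hypothesis Rel_C : forall U V t, Rel U V -> noder_t t -> C (termval U t) -> C (termval V t).
Hypothesis Rel_ext : forall U V x, Rel U V -> exists s s' i,
  [/\ Rel (U ++ s) (V ++ s'), (i < size (U ++ s))%N & nth 0 (U ++ s) i = x].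

(** One step may append several points, since a point algebraic over constants is matched only after
    these constants. Tuples only grow, and the map [s] from variables to positions records which
    entry a variable currently denotes. *)
Lemma back_and_forth f : noder f -> forall U V (s : nat -> nat), Rel U V ->
  (forall j, (s j < size U)%N) ->
  satM C (nth 0 U \o s) f -> satM C (nth 0 V \o s) f.
Proof.
have ren (W : seq K) (s : nat -> nat) t : teval (fun x => x) (nth 0 W \o s) t = termval W (tren s t).
  by rewrite teval_tren.
rewrite /satM; elim: f => [a b|a b|a|g IH|g IHg h IHh|i g IH] /= nf U V s UV sU.
- have [_ q] := Rel_qftp UV; move: nf => /andP[na nb].
  by rewrite (ren U s a) (ren U s b) (ren V s a) (ren V s b) => /eqP; rewrite (qftp_eq q) ?noder_tren // => /eqP.
- have [_ q] := Rel_qftp UV; move: nf => /andP[na nb].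
  by rewrite (ren U s a) (ren U s b) (ren V s a) (ren V s b) (qftp_lt q) ?noder_tren.
- by rewrite (ren U s a) (ren V s a); apply: Rel_C => //; rewrite noder_tren.
- move=> nU HV; apply: nU; apply: (IH nf V U) HV; first exact: Rel_sym.
  by have [<- _] := Rel_qftp UV.
- by move: nf => /andP[ng nh] [Hg Hh]; split; [exact: IHg Hg | exact: IHh Hh].
- move=> [x Hx]; have [u [v [k [UV' ku kx]]]] := Rel_ext x UV.
  have [sUV _] := Rel_qftp UV.
  pose s' := upd s i k.
  have E W w : size W = size U ->
      nth 0 (W ++ w) \o s' = upd (nth 0 W \o s) i (nth 0 (W ++ w) k).
    move=> sW; apply: functional_extensionality => j; rewrite /s' /upd /=.
    by case: eqP => // _; rewrite nth_cat sW sU.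
  exists (nth 0 (V ++ v) k); rewrite -E //; apply: (IH nf _ _ _ UV').
    move=> j; rewrite /s' /upd; case: eqP => // _.
    by rewrite size_cat ltn_addr.
  by rewrite E // kx.
Qed.
End BackAndForth.

Section DefinableClosure.
Variables (R : rcfType) (K : rcfType) (d : K -> K) (iota : R -> K).
Hypothesis iota0 : iota 0 = 0.
Hypothesis Ksat : saturated R nocst (sat d (kerd d)).

Lemma rcf_transfer f (U V : seq K) (s : nat -> nat) : noder f -> qftp U V -> size U = size V ->
  (forall j, (s j < size U)%N) ->
  satM (fun _ : K => False) (nth 0 U \o s) f -> satM (fun _ : K => False) (nth 0 V \o s) f.
Proof.
move=> nf UV sUV sU.
apply: (@back_and_forth K (fun _ : K => False) (fun U V => size U = size V /\ qftp U V)) => //.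
- by move=> A B [e q]; split=> // t nt; rewrite q.
- move=> A B x [e q]; have [y Hy] := qftp_ext iota0 Ksat x q e.
  exists [:: x], [:: y], (size A); rewrite !cats1 !size_rcons e; split=> //.
  by rewrite nth_rcons -e ltnn eqxx.
Qed.

(** Were [y] transcendental over the finitely many parameters of [f], some other point would have
    the same quantifier-free type over them and hence also satisfy [f], against uniqueness. *)
Lemma dcl_acl (S : K -> Prop) y : dcl S y -> acl S y.
Proof.
move=> [f [w [nf [cf [wS [Hy Huniq]]]]]]; apply: NNPP => ny.
pose N := formula_bound f.
have [U [sU UE]] : exists U : seq K, size U = N.+1 /\
    forall i, (i < N.+1)%N -> nth 0 U i = w i.+1.
  by exists (mkseq (fun j => w j.+1) N.+1); split=> [|i iN]; rewrite ?size_mkseq // nth_mkseq.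
have [||y'|||z [Hz1 Hz2]] := @qftp_ext_generic R K d iota iota0 Ksat U U y [:: y]
  (fun g e => g = Fnot (Feq (Tvar 0) (Tvar 1)) /\ e = fun=> y).
- by [].
- by [].
- apply: ny; apply: acl_mono y' => z /(nthP 0)[i]; rewrite sU => iN <-.
  by rewrite UE //; apply: wS.
- by move=> g e [-> ->]; split=> // j; left; rewrite mem_head.
- move=> a b ab s Hs.
  (* The midpoint, or the point at two thirds if the midpoint happens to be [y]. *)
  have [c [ca cb cy]] : exists c, [/\ a < c, c < b & c <> y].
    have [e|/eqP ne] := eqVneq ((a + b) / 2) y; last by exists ((a + b) / 2); split=> //; lra.
    by exists ((a + 2 * b) / 3); split; lra.
  by exists c; split=> // q /Hs[-> ->] /=; rewrite /upd.
have zy : z <> y by have := Hz2 _ _ (conj erefl erefl); rewrite /= /upd.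
apply: zy; apply: Huniq.
pose s j := if j == 0%N then N.+1 else if (j <= N)%N then j.-1 else 0%N.
have E x : satM (fun _ : K => False) (upd w 0 x) f <->
    satM (fun _ : K => False) (nth 0 (rcons U x) \o s) f.
  apply: sat_agree => j jN; rewrite /upd /s /= nth_rcons sU.
  case: eqP => [_|/eqP j0]; first by rewrite ltnn eqxx.
  have jN' : (j <= N)%N by apply: ltnW.
  rewrite jN' (leq_ltn_trans (leq_pred j)) // UE ?prednK ?lt0n //.
  exact: ltnW.
apply/E; apply: (@rcf_transfer f (rcons U y) (rcons U z)) => //.
- by rewrite !size_rcons.
- move=> j; rewrite size_rcons sU /s; case: eqP => // _; case: ifP => // jN.
  by rewrite (leq_ltn_trans (leq_pred j)) // ltnS (leq_trans jN).
- exact/E.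
Qed.
End DefinableClosure.

(** * Algebraic dependence is determined by the quantifier-free type *)

Section TypesAndAlgebraicity.
Variable K : realFieldType.
Implicit Types (U V : seq K).

Fixpoint tsub (s : nat -> term) (t : term) : term :=
  match t with
  | Tvar i => s i
  | T0 => T0 | T1 => T1
  | Tadd a b => Tadd (tsub s a) (tsub s b)
  | Topp a => Topp (tsub s a)
  | Tmul a b => Tmul (tsub s a) (tsub s b)
  | Tder a => Tder (tsub s a)
  end.

Lemma termval_tsub U (ts : seq term) t :
  termval U (tsub (nth T0 ts) t) = termval (map (fun t => termval U t) ts) t.
Proof.
elim: t => //= [i|a -> b ->|a ->|a -> b ->] //.
have [its|its] := ltnP i (size ts); first by rewrite (nth_map T0).
by rewrite !nth_default ?size_map.
Qed.

Lemma noder_tsub_all (s : nat -> term) t : (forall i, noder_t (s i)) -> noder_t t ->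
  noder_t (tsub s t).
Proof.
move=> ns.
by elim: t => //= [a IHa b IHb /andP[/IHa-> /IHb->]|a IHa b IHb /andP[/IHa-> /IHb->]].
Qed.

Lemma noder_tsub (ts : seq term) t : all noder_t ts -> noder_t t ->
  noder_t (tsub (nth T0 ts) t).
Proof.
move=> nts; apply: noder_tsub_all => i.
by elim: ts nts i => [|t' ts IH] /= => [_ []//|/andP[nt nts] [|i] //]; apply: IH.
Qed.

Lemma qftp_terms U V (ts : seq term) : qftp U V -> all noder_t ts ->
  qftp (map (fun t => termval U t) ts) (map (fun t => termval V t) ts).
Proof. by move=> UV nts t nt; rewrite -!termval_tsub UV // noder_tsub. Qed.

Lemma gfield_terms U x : gfield (fun z => z \in U) x ->
  exists a b, [/\ noder_t a, noder_t b, termval U b != 0 & x = termval U a / termval U b].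
Proof.
pose Q x := exists a b, [/\ noder_t a, noder_t b, termval U b != 0 & x = termval U a / termval U b].
move=> Hx; apply: (Hx Q) => //.
- move=> y /(nthP 0)[i _ <-]; exists (Tvar i), T1; split=> //=; last by rewrite divr1.
  exact: oner_neq0.
- by exists T0, T1; split=> //=; rewrite ?oner_neq0 ?mul0r.
- by exists T1, T1; split=> //=; rewrite ?oner_neq0 ?divr1.
- move=> _ _ [a [b [na nb b0 ->]]] [a' [b' [na' nb' b0' ->]]].
  exists (Tadd (Tmul a b') (Tmul a' b)), (Tmul b b').
  by split; rewrite /= ?na ?nb ?na' ?nb' ?mulf_neq0 // addf_div.
- move=> _ [a [b [na nb b0 ->]]]; exists (Topp a), b.
  by split=> //=; rewrite mulNr.
- move=> _ _ [a [b [na nb b0 ->]]] [a' [b' [na' nb' b0' ->]]].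
  exists (Tmul a a'), (Tmul b b').
  by split; rewrite /= ?na ?nb ?na' ?nb' ?mulf_neq0 // mulf_div.
- move=> _ [a [b [na nb b0 ->]]]; have [a0|a0] := eqVneq (termval U a) 0.
    by exists T0, T1; split=> //=; rewrite ?oner_neq0 // a0 mul0r mul0r invr0.
  by exists b, a; split=> //; rewrite invf_div.
Qed.

Lemma termval_gfield U t : gfield (fun z => z \in U) (termval U t).
Proof.
elim: t => /= [i|||a Ha b Hb|a Ha|a Ha b Hb|//].
- have [iU|iU] := ltnP i (size U); last by rewrite nth_default //; exact: gen_zero.
  by apply: gen_incl; apply: mem_nth.
- exact: gen_zero.
- exact: gen_one.
- exact: gen_add.
- exact: gen_opp.
- exact: gen_mul.
Qed.

(** With denominators cleared, the coefficients of an algebraic relation are values of terms, so the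
    relation itself is a term that quantifier-free types can compare. *)
Lemma acl_terms U x : acl (fun z => z \in U) x ->
  exists n (c : nat -> term), [/\ forall i, noder_t (c i), termval U (c n) != 0 &
    \sum_(i < n.+1) termval U (c i) * x ^+ i = 0].
Proof.
move=> [p [p0 pU px]].
have [c [b [nc nb b0 cp]]] : exists (c : nat -> term) b, [/\ forall i, noder_t (c i),
    noder_t b, termval U b != 0 & forall i, (i < size p)%N ->
    termval U (c i) = termval U b * p`_i].
  elim: (size p) => [|m [c [b [nc nb b0 cp]]]].
    by exists (fun=> T0), T1; split=> //=; rewrite oner_neq0.
  have [u [v [nu nv v0 puv]]] := gfield_terms (pU m).
  exists (fun i => if i == m then Tmul u b else Tmul v (c i)), (Tmul b v); split=> [i|||i].
  - by case: eqP => _ /=; rewrite ?nu ?nv ?nb ?nc.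
  - by rewrite /= nb nv.
  - by rewrite mulf_neq0.
  - rewrite ltnS leq_eqVlt; case: eqP => [-> _|_ /= /cp e] /=.
      by rewrite puv; field.
    by rewrite e mulrCA mulrA.
have sp : (size p).-1.+1 = size p by rewrite prednK // size_poly_gt0.
exists (size p).-1, c; rewrite sp; split=> //.
  rewrite cp ?sp // mulf_neq0 // -[_`_ _]/(lead_coef p) lead_coef_eq0 //.
transitivity (termval U b * p.[x]); last by rewrite (rootP px) mulr0.
by rewrite horner_coef mulr_sumr; apply: eq_bigr => i _; rewrite cp // mulrA.
Qed.

Lemma teval_tsub (v : nat -> K) (s : nat -> term) t :
  teval (fun x => x) v (tsub s t) = teval (fun x => x) (fun j => teval (fun x => x) v (s j)) t.
Proof. by elim: t => //= [a -> b ->|a ->|a -> b ->]. Qed.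

Definition Trel (c sh : nat -> term) (k n : nat) : term :=
  foldr (fun i t => Tadd (Tmul (tsub sh (c i)) (iter i (Tmul (Tvar k)) T1)) t) T0 (iota 0 n).

Lemma noder_Trel c sh k n : (forall i, noder_t (c i)) -> (forall i, noder_t (sh i)) ->
  noder_t (Trel c sh k n).
Proof.
move=> nc nsh; rewrite /Trel; elim: (iota _ _) => //= i s ->; rewrite andbT.
by rewrite noder_tsub_all //=; elim: i => //= i ->.
Qed.

Lemma teval_Trel (v : nat -> K) c sh k n : teval (fun x => x) v (Trel c sh k n) =
  \sum_(i < n) teval (fun x => x) (fun j => teval (fun x => x) v (sh j)) (c i) * v k ^+ i.
Proof.
rewrite -(big_mkord xpredT (fun i => teval (fun x => x) _ (c i) * v k ^+ i)).
rewrite /Trel /index_iota subn0; elim: (iota _ _) => [|i s IH]; first by rewrite big_nil.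
rewrite big_cons /= IH teval_tsub; congr (_ * _ + _); elim: i {IH} => //= i ->.
by rewrite exprS.
Qed.

Lemma qftp_acl U V x y : qftp (rcons U x) (rcons V y) -> size U = size V ->
  acl (fun z => z \in U) x -> acl (fun z => z \in V) y.
Proof.
move=> UV sUV /acl_terms[m [c [nc cm e]]].
(* The terms [c i] read every position outside [U] as 0, but in [rcons U x] position [n] holds [x];
   the substitution [sh] restores the value 0. *)
pose n := size U; pose sh i := if (i < n)%N then Tvar i else T0.
have nsh i : noder_t (sh i) by rewrite /sh; case: ifP.
have shE W z : size W = n -> (fun j => termval (rcons W z) (sh j)) = nth 0 W.
  move=> sW; apply: functional_extensionality => i; rewrite /sh.
  by case: (ltnP i n) => iW /=; rewrite ?nth_rcons ?sW ?iW // nth_default ?sW.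
have last_nth W z : size W = n -> nth 0 (rcons W z) n = z.
  by move=> sW; rewrite nth_rcons sW ltnn eqxx.
have := qftp_eq0 UV (noder_Trel n m.+1 nc nsh).
rewrite !teval_Trel !shE // !last_nth // e eqxx => /esym/eqP e'.
exists (\poly_(i < m.+1) termval V (c i)); split.
- apply/eqP => /(congr1 (fun q : {poly K} => q`_m)) /eqP.
  have := qftp_eq0 UV (noder_tsub_all nsh (nc m)).
  by rewrite coef_poly ltnSn coef0 !teval_tsub !shE // (negPf cm) => <-.
- move=> i; rewrite coef_poly; case: ltnP => _; last exact: gen_zero.
  exact: termval_gfield.
- by apply/rootP; rewrite horner_poly e'.
Qed.

Lemma qftp_acl_terms U V (ts : seq term) t : qftp U V -> all noder_t ts -> noder_t t ->
  acl (fun z => z \in map (fun t => termval U t) ts) (termval U t) ->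
  acl (fun z => z \in map (fun t => termval V t) ts) (termval V t).
Proof.
move=> UV nts nt; apply: qftp_acl; last by rewrite !size_map.
by rewrite -!map_rcons; apply: qftp_terms => //; rewrite all_rcons nt.
Qed.

End TypesAndAlgebraicity.

(** * Freeness from the constants *)

Section FreeOverConstants.
Variables (K : realFieldType) (d : K -> K).
Hypothesis d_der : derivation d.
Implicit Types (l m : seq K).

(* l is free from the field of constants over m. *)
Definition free_over l m : Prop := (forall x, x \in m -> d x = 0) /\
  forall D : K -> Prop, (forall x, D x -> d x = 0) -> forall z, d z = 0 ->
  acl (fun x => x \in l \/ D x) z -> acl (fun x => x \in m \/ D x) z.

Lemma free_nil : free_over [::] [::].
Proof. by split. Qed.

(** [free_over] quantifies over every set [D] of constants, so the new constant can be absorbed into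
    [D] and handed back to [m] afterwards. *)
Lemma free_const l m c : free_over l m -> d c = 0 -> free_over (rcons l c) (rcons m c).
Proof.
move=> [mC lm] dc; split=> [x|D DC z dz Hz].
  by rewrite mem_rcons inE => /orP[/eqP->|/mC].
have := lm (fun x => D x \/ x = c) _ z dz; case.
- by move=> x [/DC|->].
- apply: acl_mono Hz => x [|Dx]; last by right; left.
  by rewrite mem_rcons inE => /orP[/eqP->|xl]; [right; right | left].
- move=> p Hp; exists p; case: Hp => p0 Hp pz; split=> // i.
  apply: gen_mono (Hp i) => x [xm|[Dx|->]]; [left | by right | left].
    by rewrite mem_rcons inE xm orbT.
  by rewrite mem_rcons mem_head.
Qed.

(** If some constant [z] became algebraic only with the help of [x], exchange would make [x]
    algebraic over [l], [D] and [z], that is, over [l] and constants. *)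
Lemma free_indep l m x : free_over l m -> ~ acl (fun z => z \in l \/ d z = 0) x ->
  free_over (rcons l x) m.
Proof.
move=> [mC lm] nx; split=> // D DC z dz Hz.
have [Hl|Hl] := classic (acl (fun w => w \in l \/ D w) z); first exact: lm.
case: nx; have/acl_exchange/(_ Hl) : acl (fun w => (w \in l \/ D w) \/ w = x) z.
  apply: acl_mono Hz => w [|Dw]; last by left; right.
  by rewrite mem_rcons inE => /orP[/eqP->|wl]; [right | left; left].
by apply: acl_mono => w [[wl|/DC]|->]; [left | right | right].
Qed.

Lemma free_alg l m x : free_over l m -> acl (fun z => z \in l) x -> free_over (rcons l x) m.
Proof.
move=> [mC lm] Hx; split=> // D DC z dz Hz; apply: lm => //.
apply: acl_trans Hz => w [|Dw]; last by apply: acl_incl; right.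
rewrite mem_rcons inE => /orP[/eqP->|wl]; last by apply: acl_incl; left.
by apply: acl_mono Hx => v; left.
Qed.

Lemma free_consts l m s : free_over l m -> (forall c, c \in s -> d c = 0) ->
  free_over (l ++ s) (m ++ s).
Proof.
elim: s l m => [|c s IH] l m lm sC; first by rewrite !cats0.
rewrite -!cat_rcons; apply: IH => [|x xs]; last by apply: sC; rewrite inE xs orbT.
by apply: free_const => //; apply: sC; rewrite mem_head.
Qed.

Lemma acl_const_split l x : acl (fun z => z \in l \/ d z = 0) x ->
  exists s, (forall c, c \in s -> d c = 0) /\ acl (fun z => z \in l ++ s) x.
Proof.
move=> /acl_finitary[l' [Hl' Hx]]; exists [seq c <- l' | d c == 0]; split.
  by move=> c; rewrite mem_filter => /andP[/eqP].
apply: acl_mono Hx => z zl'; rewrite mem_cat mem_filter zl' andbT.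
by case: (Hl' z zl') => [->//|->]; rewrite eqxx orbT.
Qed.

(** Entries are added one by one. An entry algebraic over the list and the constants is preceded by
    the finitely many constants involved, and is then algebraic over the list; any other entry is
    independent. *)
Lemma free_params (P : seq K) : exists l m, [/\ free_over l m, {subset m <= l},
  {subset P <= l} & forall x, x \in l -> x \in P \/ d x = 0].
Proof.
elim: P => [|x P [l [m [lm ml Pl lP]]]].
  by exists [::], [::]; split=> //; exact: free_nil.
have [/acl_const_split[s [sC Hx]]|nx] := classic (acl (fun z => z \in l \/ d z = 0) x).
  exists (rcons (l ++ s) x), (m ++ s); split.
  - by apply: free_alg => //; apply: free_consts.
  - move=> z; rewrite mem_rcons !inE !mem_cat => /orP[/ml->|->]; by rewrite ?orbT.
  - move=> z; rewrite mem_rcons !inE mem_cat => /orP[->//|/Pl->]; by rewrite ?orbT.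
  - move=> z; rewrite mem_rcons !inE mem_cat => /orP[->|/orP[/lP[->|]|/sC]]; auto.
    by rewrite orbT; left.
exists (rcons l x), m; split.
- exact: free_indep.
- by move=> z /ml; rewrite mem_rcons inE => ->; rewrite orbT.
- by move=> z; rewrite mem_rcons !inE => /orP[->//|/Pl->]; rewrite orbT.
- move=> z; rewrite mem_rcons !inE => /orP[->|/lP[->|]]; auto.
  by rewrite orbT; left.
Qed.
End FreeOverConstants.

(** * The back-and-forth system and generic copies of tuples *)

Section Model.
Variables (R : rcfType) (K : rcfType) (d : K -> K) (iota : R -> K).
Hypothesis d_der : derivation d.
Hypothesis iota0 : iota 0 = 0.
Hypothesis Ksat : saturated R nocst (sat d (kerd d)).
Hypothesis const_dense : forall a b, a < b -> exists c, [/\ d c = 0, a < c & c < b].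
Hypothesis generic_dense : forall l : seq K, exists Sigma0 : formula -> (nat -> K) -> Prop,
  [/\ forall f e, Sigma0 f e -> params iota l f e,
    forall a b, a < b -> forall s : list (formula * (nat -> K)),
      (forall q, List.In q s -> Sigma0 q.1 q.2) ->
      exists y, [/\ a < y, y < b &
        forall q, List.In q s -> sat d (kerd d) (upd q.2 0 y) q.1] &
    forall y, (forall f e, Sigma0 f e -> sat d (kerd d) (upd e 0 y) f) ->
      ~ dalg d (fun z => z \in l \/ exists r, z = iota r) y].
Implicit Types (U V : seq K) (I : seq nat).

Definition sub U I := map (nth 0 U) I.

Definition good U V I : Prop :=
  [/\ size U = size V, qftp U V, all (fun i => i < size U)%N I,
      free_over d U (sub U I) & free_over d V (sub V I)].

Lemma good_sym U V I : good U V I -> good V U I.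
Proof.
by move=> [sUV UV IU fU fV]; split=> // [t nt|]; [rewrite UV | rewrite -sUV].
Qed.

Lemma sub_rcons U I x : all (fun i => i < size U)%N I -> sub (rcons U x) I = sub U I.
Proof. by move=> /allP IU; apply/eq_in_map => i /IU iU; rewrite nth_rcons iU. Qed.

Lemma all_ltn_rcons U I x : all (fun i => i < size U)%N I ->
  all (fun i => i < size (rcons U x))%N I.
Proof. by apply: sub_all => i; rewrite size_rcons ltnS => /ltnW. Qed.

Lemma qftp_acl_sub U V I t : qftp U V -> noder_t t ->
  acl (fun z => z \in sub U I) (termval U t) -> acl (fun z => z \in sub V I) (termval V t).
Proof.
move=> UV nt; have E W : sub W I = map (fun t => termval W t) (map Tvar I).
  by rewrite -map_comp.
by rewrite !E; apply: qftp_acl_terms => //; elim: I {E}.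
Qed.

Lemma qftp_acl_sub_rcons U V I x y : qftp (rcons U x) (rcons V y) -> size U = size V ->
  all (fun i => i < size U)%N I ->
  acl (fun z => z \in sub U I) x -> acl (fun z => z \in sub V I) y.
Proof.
move=> UV sUV IU Hx; have IV : all (fun i => i < size V)%N I by rewrite -sUV.
have := @qftp_acl_sub _ _ I (Tvar (size U)) UV isT.
by rewrite /= !sub_rcons // !nth_rcons -sUV ltnn eqxx; apply.
Qed.

Lemma free_acl U I z : free_over d U (sub U I) -> d z = 0 ->
  acl (fun w => w \in U) z -> acl (fun w => w \in sub U I) z.
Proof.
move=> [_ fU] dz Hz.
have Hz' : acl (fun w => w \in U \/ False) z by apply: acl_mono Hz => w; left.
by apply: acl_mono (fU (fun _ => False) _ z dz Hz') => // w [].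
Qed.

(** By freeness a constant in the field of [U] is algebraic over the marked constants of [U]. The
    quantifier-free type carries this relation to [V], and elements algebraic over constants are
    constants. *)
Lemma good_der0 U V I t : good U V I -> noder_t t ->
  d (termval U t) = 0 -> d (termval V t) = 0.
Proof.
move=> [sUV UV IU fU fV] nt dt.
have Ht : acl (fun z => z \in sub U I) (termval U t).
  by apply: free_acl => //; apply: acl_gfield; apply: termval_gfield.
apply: (acl_const d_der _ (qftp_acl_sub UV nt Ht)).
by case: fV.
Qed.

Lemma good_alg U V I x : good U V I -> acl (fun z => z \in U) x ->
  exists y, good (rcons U x) (rcons V y) I.
Proof.
move=> [sUV UV IU fU fV] Hx; have [y Hy] := qftp_ext iota0 Ksat x UV sUV.
have IV : all (fun i => i < size V)%N I by rewrite -sUV.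
exists y; split=> //; first by rewrite !size_rcons sUV.
- exact: all_ltn_rcons.
- by rewrite sub_rcons //; apply: free_alg.
- by rewrite sub_rcons //; apply: free_alg => //; apply: qftp_acl Hx.
Qed.

(** If [c] is algebraic over [U], it is algebraic over the marked constants and any partner is
    forced to be constant; otherwise density of the constants provides a constant partner. In both
    cases the new position is marked. *)
Lemma good_const U V I c : good U V I -> d c = 0 ->
  exists c', d c' = 0 /\ good (rcons U c) (rcons V c') (rcons I (size U)).
Proof.
move=> G dc; have [sUV UV IU fU fV] := G.
have [c' [dc' Hc']] : exists c', d c' = 0 /\ qftp (rcons U c) (rcons V c').
  have [Hc|nc] := classic (acl (fun z => z \in U) c).
    have [y Hy] := qftp_ext iota0 Ksat c UV sUV; exists y; split=> //.
    have Hc' := free_acl fU dc Hc.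
    apply: (acl_const d_der _ (qftp_acl_sub_rcons Hy sUV IU Hc')).
    by case: fV.
  have [||y [Hy Hd]] := @qftp_ext_generic R K d iota iota0 Ksat U V c [:: 0]
    (fun f e => f = Feq (Tder (Tvar 0)) T0 /\ e = fun=> 0) UV sUV nc.
  - by move=> f e [-> ->]; split=> // j; left; rewrite mem_head.
  - move=> a b ab s Hs; have [y [dy ay yb]] := const_dense ab.
    by exists y; split=> // q /Hs[-> ->].
  - by exists y; split=> //; have := Hd _ _ (conj erefl erefl).
exists c'; split=> //.
have E W x n : size W = n -> all (fun i => i < n)%N I ->
    sub (rcons W x) (rcons I n) = rcons (sub W I) x.
  move=> sW In; rewrite /sub map_rcons nth_rcons sW ltnn eqxx; congr rcons.
  by apply: sub_rcons; rewrite sW.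
have IV : all (fun i => i < size U)%N I by [].
split=> //; first by rewrite !size_rcons sUV.
- by rewrite all_rcons size_rcons ltnSn /=; apply: sub_all IU => i; rewrite ltnS => /ltnW.
- by rewrite E //; apply: free_const.
- by rewrite E //; apply: free_const.
Qed.

Lemma good_consts U V I s : good U V I -> (forall c, c \in s -> d c = 0) ->
  exists s' J, size s' = size s /\ good (U ++ s) (V ++ s') J.
Proof.
elim: s U V I => [|c s IH] U V I G sC; first by exists [::], I; rewrite !cats0.
have [|c' [dc' G']] := good_const (c := c) G; first by apply: sC; rewrite mem_head.
have [|s' [J [ss' GJ]]] := IH _ _ _ G'; first by move=> x xs; apply: sC; rewrite inE xs orbT.
by exists (c' :: s'), J; rewrite /= ss' -!cat_rcons.
Qed.

(** The partner is taken differentially transcendental over [V] and R. By [dalg_acl_const] this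
    implies that it is not algebraic over [V] and the constants, which keeps the new pair free; the
    stronger property is what raises the differential dimension later. *)
Lemma good_indep U V I x : good U V I -> ~ acl (fun z => z \in U \/ d z = 0) x ->
  exists y, good (rcons U x) (rcons V y) I /\
    ~ dalg d (fun z => z \in V \/ exists r, z = iota r) y.
Proof.
move=> [sUV UV IU fU fV] nx; have [Sigma0 [S1 S2 S3]] := generic_dense V.
have nx' : ~ acl (fun z => z \in U) x.
  by move=> Hx; apply: nx; apply: acl_mono Hx => z; left.
have [y [Hy /S3 ny]] := qftp_ext_generic iota0 Ksat UV sUV nx' S1 S2.
have IV : all (fun i => i < size V)%N I by rewrite -sUV.
exists y; split=> //; split=> //; first by rewrite !size_rcons sUV.
- exact: all_ltn_rcons.
- by rewrite sub_rcons //; apply: free_indep.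
- rewrite sub_rcons //; apply: free_indep => // Hy'; apply: ny; apply: dalg_mono (dalg_acl_const d_der Hy').
  by move=> z; left.
Qed.

Lemma good_ext U V I x : good U V I -> exists s s' J i,
  [/\ good (U ++ s) (V ++ s') J, (i < size (U ++ s))%N & nth 0 (U ++ s) i = x].
Proof.
move=> G; have [/acl_const_split[s [sC Hx]]|nx] := classic (acl (fun z => z \in U \/ d z = 0) x).
  have [s' [J [ss' G']]] := good_consts G sC.
  have [y G''] := good_alg G' Hx.
  exists (rcons s x), (rcons s' y), J, (size (U ++ s)).
  by rewrite -!rcons_cat size_rcons ltnSn nth_rcons ltnn eqxx.
have [y [G' _]] := good_indep G nx.
exists [:: x], [:: y], I, (size U).
by rewrite !cats1 size_rcons ltnSn nth_rcons ltnn eqxx.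
Qed.

Lemma good_sat U V I f (s : nat -> nat) : noder f -> good U V I ->
  (forall j, (s j < size U)%N) ->
  satM (kerd d) (nth 0 U \o s) f -> satM (kerd d) (nth 0 V \o s) f.
Proof.
move=> nf G; apply: (@back_and_forth K (kerd d) (fun U V => exists I, good U V I)) => //.
- by move=> A B [J []].
- by move=> A B [J /good_sym]; exists J.
- by move=> A B t [J GJ]; apply: good_der0 GJ.
- move=> A B x [J /(good_ext x)[u [v [J' [i [G' iu ix]]]]]].
  by exists u, v, i; split=> //; exists J'.
- by exists I.
Qed.

Definition others n (a : 'I_n -> K) (L : pred 'I_n) (i : 'I_n) : K -> Prop :=
  fun y => exists2 j, L j && (j != i) & y = a j.

(** The new entry is independent of the earlier ones; [dalg_sym] converts this into independence of
    each earlier entry from the others including the new one. *)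
Lemma seq_independent n (a : 'I_n -> K) (L : seq 'I_n) i A :
  (forall j, j \in L -> ~ dalg d (fun y => others a (mem L) j y \/ A y) (a j)) ->
  i \notin L -> ~ dalg d (fun y => (exists2 j, j \in L & y = a j) \/ A y) (a i) ->
  forall j, j \in rcons L i -> ~ dalg d (fun y => others a (mem (rcons L i)) j y \/ A y) (a j).
Proof.
move=> HL iL Hi j; rewrite mem_rcons inE => /orP[/eqP->|jL] Hj.
  apply: Hi; apply: dalg_mono Hj => y [[k /andP[]]|]; last by right.
  by rewrite /= mem_rcons inE => /orP[->//|kL] _ ->; left; exists k.
have ij : i != j by apply: contraNneq iL => ->.
apply: (dalg_sym (HL j jL) _ (_ : dalg d (fun z => (others a (mem L) j z \/ A z) \/ z = a i) (a j))).
  move=> Hy; apply: Hi; apply: dalg_mono Hy => y [[[k /andP[kL _] ->]|Ay]|->].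
  - by left; exists k.
  - by right.
  - by left; exists j.
apply: dalg_mono Hj => y [[k /andP[]]|]; last by left; right.
rewrite /= mem_rcons inE => /orP[/eqP->|kL] kj ->; first by right.
by left; left; exists k => //; apply/andP.
Qed.

(** Each entry is replaced by a point differentially transcendental over [l], R and the replacements
    made so far. *)
Lemma generic_independent n (a : 'I_n -> K) l (L : seq 'I_n) J :
  good l l J -> uniq L ->
  (forall i, i \in L -> ~ acl (fun y => (others a (mem L) i y \/ y \in l) \/ d y = 0) (a i)) ->
  exists b : 'I_n -> K, good (l ++ map a L) (l ++ map b L) J /\
    forall i, i \in L -> ~ dalg d (fun y => others b (mem L) i y \/ exists r, y = iota r) (b i).
Proof.
move=> G; elim/last_ind: L => [|L i IH]; first by exists a; rewrite !cats0.
rewrite rcons_uniq => /andP[iL uL] HL.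
have [//|j jL|b [Gb Hb]] := IH.
  have jLi : j \in rcons L i by rewrite mem_rcons inE jL orbT.
  move=> Hj; apply: (HL j jLi); apply: acl_mono Hj => y [[[k /andP[kL kj] ->]|yl]|].
  - by left; left; exists k => //; apply/andP; rewrite /= mem_rcons inE (kL : k \in L) orbT.
  - by left; right.
  - by right.
have nx : ~ acl (fun z => z \in l ++ map a L \/ d z = 0) (a i).
  have iLi : i \in rcons L i by rewrite mem_rcons mem_head.
  move=> Hi; apply: (HL i iLi); apply: acl_mono Hi => y [|]; last by right.
  rewrite mem_cat => /orP[yl|/mapP[k kL ->]]; first by left; right.
  left; left; exists k => //; apply/andP; split; first by rewrite /= mem_rcons inE kL orbT.
  by apply: contraNneq iL => <-.
have [y [Gy ny]] := good_indep Gb nx.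
pose b' j := if j == i then y else b j.
have b'L : map b' L = map b L.
  by apply/eq_in_map => j jL; rewrite /b'; case: eqP => // ji; rewrite -ji jL in iL.
have b'i : b' i = y by rewrite /b' eqxx.
exists b'; rewrite !map_rcons b'L b'i -!rcons_cat; split=> //.
apply: seq_independent => //.
- move=> j jL; have -> : b' j = b j.
    by rewrite /b'; case: eqP => // ji; rewrite -ji jL in iL.
  move=> Hj; apply: (Hb j jL); apply: dalg_mono Hj => z [[k /andP[kL kj] ->]|]; last by right.
  left; exists k; first exact/andP.
  by rewrite /b'; case: eqP => // ki; move: kL; rewrite ki -[mem L i]/(i \in L) (negPf iL).
- rewrite b'i => Hy; apply: ny; apply: dalg_mono Hy => z [[j jL ->]|]; last by right.
  left; rewrite mem_cat; apply/orP; right.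
  by rewrite -b'L; apply: map_f.
Qed.

(** The coordinates outside [I] are brought along by [good_ext]; since that places points at
    unforeseen positions, [k] keeps track of where each coordinate sits. *)
Lemma good_ext_family n (a b : 'I_n -> K) U V J (I : {set 'I_n}) (k0 : 'I_n -> nat) (M : seq 'I_n) :
  good U V J ->
  (forall i, i \in I -> [/\ (k0 i < size U)%N, nth 0 U (k0 i) = a i & nth 0 V (k0 i) = b i]) ->
  exists s s' J' (k : 'I_n -> nat), good (U ++ s) (V ++ s') J' /\
    forall i, i \in M -> [/\ (k i < size (U ++ s))%N, nth 0 (U ++ s) (k i) = a i &
      i \in I -> nth 0 (V ++ s') (k i) = b i].
Proof.
move=> G HI; elim: M => [|i M [s [s' [J' [k [Gs Hk]]]]]].
  by exists [::], [::], J, (fun=> 0%N); rewrite !cats0.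
have [iI|iI] := boolP (i \in I).
  exists s, s', J', (fun j => if j == i then k0 i else k j); split=> // j.
  have [sUV _ _ _ _] := G.
  have [h1 h2 h3] := HI i iI.
  rewrite inE; case: eqP => [-> _|_ /Hk //].
  by rewrite size_cat !nth_cat -sUV h1; split=> //; rewrite ltn_addr.
have [u [v [J1 [h [G1 hu hx]]]]] := good_ext (a i) Gs.
have [sUV _ _ _ _] := Gs.
exists (s ++ u), (s' ++ v), J1, (fun j => if j == i then h else k j); rewrite !catA; split=> // j.
rewrite inE; case: eqP => [-> _|_ /= /Hk[h1 h2 h3]]; first by split=> //; rewrite (negPf iI).
rewrite [nth 0 ((U ++ s) ++ u) _]nth_cat [nth 0 ((V ++ s') ++ v) _]nth_cat -sUV h1.
by split=> //; rewrite [size _]size_cat ltn_addr.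
Qed.

(** The parameters are enlarged to a free list [l] by adding constants only, so the coordinates in
    [I] remain independent of [l] and the constants. They are moved to generic points over [l], the
    other coordinates follow, and back-and-forth preserves the formula. *)
Lemma generic_copy n (a : 'I_n -> K) (I : {set 'I_n}) (p : nat -> K) f : noder f ->
  (forall j, exists r, p j = iota r) -> satM (kerd d) (env a p) f ->
  (forall i, i \in I ->
     ~ acl (fun y => (others a (mem I) i y \/ exists r, y = iota r) \/ d y = 0) (a i)) ->
  exists b : 'I_n -> K, satM (kerd d) (env b p) f /\
    forall i, i \in I ->
      ~ dalg d (fun y => others b (mem I) i y \/ exists r, y = iota r) (b i).
Proof.
move=> nf pR Ha HI; pose N := formula_bound f.
(* [N.+1] values of [p] rather than [N]: then [l] is nonempty even for [N] = 0, and position 0 can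
   serve as the default of [sg]. *)
have [l [m [lm ml Pl lP]]] := free_params d (mkseq p N.+1).
have pl j : (j <= N)%N -> p j \in l.
  move=> jN; apply: Pl; rewrite -(nth_mkseq 0 p (_ : j < N.+1)%N) //.
  by apply: mem_nth; rewrite size_mkseq.
have l0 : (0 < size l)%N by case: (l) (pl 0%N isT).
have subl : sub l (map (index^~ l) m) = m.
  rewrite /sub -map_comp -[RHS]map_id; apply/eq_in_map => x /ml xl /=.
  by rewrite nth_index.
(* The list is paired with itself, so that the parameters stay fixed. *)
have G : good l l (map (index^~ l) m).
  split; rewrite ?subl //; rewrite all_map; apply/allP => x /ml xl /=.
  by rewrite index_mem.
have [||b [Gb Hb]] := @generic_independent n a l (enum I) _ G.
- exact: enum_uniq.
- move=> i; rewrite mem_enum => iI Hi; apply: (HI i iI).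
  apply: acl_mono Hi => y [[[j /andP[jI ji] ->]|/lP[]]|]; last by right.
  + left; left; exists j => //; apply/andP; split=> //.
    by have : j \in enum I := jI; rewrite mem_enum.
  + move=> /(nthP 0)[j]; rewrite size_mkseq => jN <-; rewrite nth_mkseq //.
    by left; right.
  + by right.
pose k0 i := (size l + index i (enum I))%N.
have [|s [s' [J' [k [Gs Hk]]]]] := @good_ext_family n a b _ _ _ I k0 (enum 'I_n) Gb.
  move=> i iI; have iE : i \in enum I by rewrite mem_enum.
  rewrite /k0 size_cat size_map ltn_add2l index_mem iE; split=> //.
    rewrite nth_cat ltnNge leq_addr /= addKn (nth_map i) ?index_mem //.
    by rewrite nth_index.
  rewrite nth_cat ltnNge leq_addr /= addKn (nth_map i) ?index_mem //.
  by rewrite nth_index.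
set U := _ ++ s in Gs Hk; set V := _ ++ s' in Gs Hk.
have lU j : (j < size l)%N -> [/\ (j < size U)%N, nth 0 U j = nth 0 l j & nth 0 V j = nth 0 l j].
  by move=> jl; rewrite /U /V !nth_cat !size_cat jl !ltn_addr.
pose b' i := nth 0 V (k i).
pose sg j := if insub j is Some i then k (i : 'I_n)
  else if (j <= N)%N then index (p j) l else 0%N.
have sgU j : (sg j < size U)%N.
  rewrite /sg; case: insubP => [i _ _|_].
    by have [] := Hk i; rewrite ?mem_enum.
  case: ifP => jN; last by have [] := lU _ l0.
  by have [] := lU (index (p j) l); rewrite // index_mem pl.
exists b'; split.
  have E W c : (forall i : 'I_n, nth 0 W (k i) = c i) ->
      (forall j, (j < size l)%N -> nth 0 W j = nth 0 l j) ->
      satM (kerd d) (env c p) f <-> satM (kerd d) (nth 0 W \o sg) f.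
    move=> Wc Wl; apply: sat_agree => j jN; rewrite /env /sg /=.
    case: insubP => [i _ _|_]; first by rewrite Wc.
    by rewrite (ltnW jN) Wl ?index_mem ?nth_index ?pl // ltnW.
  apply/(E V b') => // [j /lU[] //|].
  apply: (good_sat nf Gs sgU); apply/(E U a) => // [i|j /lU[] //].
  by have [] := Hk i; rewrite ?mem_enum.
move=> i iI; have b'I j : j \in I -> b' j = b j.
  by move=> jI; have [_ _] := Hk j (mem_enum _ _); apply.
rewrite b'I // => Hi; apply: (Hb i); rewrite ?mem_enum //.
apply: dalg_mono Hi => y [[j /andP[jI ji] ->]|]; last by right.
left; exists j; last exact: b'I.
by apply/andP; rewrite /= mem_enum.
Qed.
End Model.

(** * Rational functions as an ordered differential field *)

Section PositiveNearZero.
Variable R : rcfType.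
Implicit Types p q : {poly R}.

Definition pos_near0 p := exists2 e, 0 < e & forall t, 0 < t -> t < e -> 0 < p.[t].

Lemma pos_near0D p q : pos_near0 p -> pos_near0 q -> pos_near0 (p + q).
Proof.
move=> [e e0 He] [e' e0' He']; exists (Num.min e e'); first by rewrite lt_min e0.
by move=> t t0; rewrite lt_min => /andP[te te']; rewrite hornerD addr_gt0 ?He ?He'.
Qed.

Lemma pos_near0M p q : pos_near0 p -> pos_near0 q -> pos_near0 (p * q).
Proof.
move=> [e e0 He] [e' e0' He']; exists (Num.min e e'); first by rewrite lt_min e0.
by move=> t t0; rewrite lt_min => /andP[te te']; rewrite hornerM mulr_gt0 ?He ?He'.
Qed.

Lemma pos_near0N p : pos_near0 p -> ~ pos_near0 (- p).
Proof.
move=> [e e0 He] [e' e0' He'].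
have [m1 m2] : Num.min e e' <= e /\ Num.min e e' <= e' by rewrite !ge_min !lexx orbT.
have m0 : 0 < Num.min e e' by rewrite lt_min e0.
have h1 : 0 < p.[Num.min e e' / 2] by apply: He; lra.
have h2 : 0 < (- p).[Num.min e e' / 2] by apply: He'; lra.
by rewrite hornerN in h2; lra.
Qed.

Lemma pos_near0_horner p : 0 < p.[0] -> pos_near0 p.
Proof.
move=> p0; have [e e0 He] := poly_cont 0 p p0; exists e => // t t0 te.
have /He : `|t - 0| < e by rewrite subr0 gtr0_norm.
by rewrite ltr_norml => /andP[h _]; lra.
Qed.

Lemma pos_near0X n : pos_near0 ('X^n).
Proof. by exists 1 => // t t0 _; rewrite hornerXn exprn_gt0. Qed.

Lemma pos_near0_neq0 p : pos_near0 p -> p != 0.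
Proof.
move=> pp; apply/eqP => p0; have := pos_near0N pp.
by rewrite {}p0 oppr0 in pp *; apply.
Qed.

(** Write p = q X^m with q(0) nonzero; the sign of q(0) is the sign of p just to the right of 0. *)
Lemma pos_near0_total p : p != 0 -> pos_near0 p \/ pos_near0 (- p).
Proof.
move=> p0; have [m [q /implyP/(_ p0) q0 pE]] := multiplicity_XsubC p 0.
rewrite polyC0 subr0 in pE.
have : q.[0] != 0 by [].
rewrite pE -mulNr neq_lt => /orP[q0'|q0']; [right | left];
  apply: pos_near0M (pos_near0X m); apply: pos_near0_horner => //.
by rewrite hornerN oppr_gt0.
Qed.
End PositiveNearZero.

Lemma opp_div_eq (F : fieldType) (a b a' b' : F) : b != 0 -> b' != 0 ->
  - (a / b) = a' / b' -> - a * b' = a' * b.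
Proof. by move=> b0 b0' /eqP; rewrite -mulNr eqr_div // => /eqP. Qed.

Section RationalFunctions.
Variable R : rcfType.

(** A separate name for the fraction field R(t), which will carry the order making t a positive
    infinitesimal. *)
Definition ratfun := {fraction {poly R}}.
HB.instance Definition _ := GRing.Field.on ratfun.
Implicit Types x y : ratfun.

Definition rat_of_poly (p : {poly R}) : ratfun := FracField.tofrac p.
Fact rat_of_poly_zmod_morphism : zmod_morphism rat_of_poly.
Proof. exact: tofrac_is_zmod_morphism. Qed.
Fact rat_of_poly_monoid_morphism : monoid_morphism rat_of_poly.
Proof. exact: tofrac_is_monoid_morphism. Qed.
HB.instance Definition _ :=
  GRing.isZmodMorphism.Build {poly R} ratfun rat_of_poly rat_of_poly_zmod_morphism.
HB.instance Definition _ :=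
  GRing.isMonoidMorphism.Build {poly R} ratfun rat_of_poly rat_of_poly_monoid_morphism.

Local Notation "p %:F" := (rat_of_poly p).

Lemma rat_of_poly_eq (p q : {poly R}) : (p%:F == q%:F) = (p == q).
Proof. exact: tofrac_eq. Qed.

Lemma ratfun_frac x : exists p q : {poly R}, q != 0 /\ x = p%:F / q%:F.
Proof.
pose r : {ratio {poly R}} := repr (x : {fraction {poly R}}).
have d0 : \d_r != 0 by apply: denom_ratioP.
exists \n_r, \d_r; split=> //; apply: (canRL (mulfK _)); first by rewrite -(rmorph0 rat_of_poly) rat_of_poly_eq.
rewrite -[x in x * _](@reprK _ {fraction {poly R}}) -/r.
rewrite /rat_of_poly; unlock FracField.tofrac; rewrite -[LHS]FracField.pi_mul /FracField.mulf.
apply/eqmodP; rewrite /= FracField.equivfE.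
have n1 := oner_neq0 {poly R}.
by rewrite !(numer_Ratio _ n1) !(denom_Ratio _ n1) !mulr1 (numer_Ratio _ d0)
   (denom_Ratio _ d0) ?mulr1 mulrC.
Qed.

Definition ratfun_pos x := exists p q, [/\ pos_near0 p, pos_near0 q & x = p%:F / q%:F].
Definition ratfun_lt x y : bool :=
  if excluded_middle_informative (ratfun_pos (y - x)) then true else false.
Definition ratfun_le x y : bool := (x == y) || ratfun_lt x y.

Lemma ratfun_ltP x y : reflect (ratfun_pos (y - x)) (ratfun_lt x y).
Proof. by rewrite /ratfun_lt; case: excluded_middle_informative => h; constructor. Qed.

Lemma rat_of_poly_neq0 (p : {poly R}) : p != 0 -> p%:F != 0.
Proof. by rewrite -(rmorph0 rat_of_poly) rat_of_poly_eq. Qed.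

Fact ratfun_lt0_add x y : ratfun_lt 0 x -> ratfun_lt 0 y -> ratfun_lt 0 (x + y).
Proof.
move=> /ratfun_ltP; rewrite subr0 => -[p [q [pp qp ->]]].
move=> /ratfun_ltP; rewrite subr0 => -[p' [q' [pp' qp' ->]]].
apply/ratfun_ltP; rewrite subr0; exists (p * q' + p' * q), (q * q'); split.
- by apply: pos_near0D; apply: pos_near0M.
- exact: pos_near0M.
- by rewrite rmorphD !rmorphM /= addf_div // rat_of_poly_neq0 // pos_near0_neq0.
Qed.

Fact ratfun_lt0_mul x y : ratfun_lt 0 x -> ratfun_lt 0 y -> ratfun_lt 0 (x * y).
Proof.
move=> /ratfun_ltP; rewrite subr0 => -[p [q [pp qp ->]]].
move=> /ratfun_ltP; rewrite subr0 => -[p' [q' [pp' qp' ->]]].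
apply/ratfun_ltP; rewrite subr0; exists (p * p'), (q * q'); split.
- exact: pos_near0M.
- exact: pos_near0M.
- by rewrite !rmorphM /= mulf_div.
Qed.

Fact ratfun_lt0_ngt0 x : ratfun_lt 0 x -> ~~ ratfun_lt x 0.
Proof.
move=> /ratfun_ltP; rewrite subr0 => -[p [q [pp qp ->]]].
apply/ratfun_ltP; rewrite sub0r => -[p' [q' [pp' qp']]].
have q0 := rat_of_poly_neq0 (pos_near0_neq0 qp).
have q0' := rat_of_poly_neq0 (pos_near0_neq0 qp').
move=> /(opp_div_eq q0 q0') e.
have e2 : (- p * q')%:F = (p' * q)%:F.
  by rewrite (rmorphM rat_of_poly) (rmorphN rat_of_poly) /= e (rmorphM rat_of_poly).
move/eqP: e2; rewrite rat_of_poly_eq => /eqP e2.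
by apply: (pos_near0N (pos_near0M pp qp')); rewrite -mulNr e2; exact: pos_near0M.
Qed.

Fact ratfun_sub_gt0 x y : ratfun_lt 0 (y - x) = ratfun_lt x y.
Proof. by rewrite /ratfun_lt subr0. Qed.

Fact ratfun_lt0_total x : x != 0 -> ratfun_lt 0 x || ratfun_lt x 0.
Proof.
have [p [q [q0 ->]]] := ratfun_frac x; rewrite mulf_eq0 negb_or -(rmorph0 rat_of_poly) rat_of_poly_eq => /andP[p0 _].
suff [H|H] : ratfun_pos (p%:F / q%:F) \/ ratfun_pos (- (p%:F / q%:F)).
- by apply/orP; left; apply/ratfun_ltP; rewrite subr0.
- by apply/orP; right; apply/ratfun_ltP; rewrite sub0r.
have [pp|pp] := pos_near0_total p0; have [qp|qp] := pos_near0_total q0.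
- by left; exists p, q.
- by right; exists p, (- q); split=> //; rewrite rmorphN invrN mulrN.
- by right; exists (- p), q; split=> //; rewrite rmorphN mulNr.
- by left; exists (- p), (- q); split=> //; rewrite !rmorphN invrN mulrNN.
Qed.

Definition ratfun_norm x := if ratfun_le 0 x then x else - x.

Fact ratfun_normN x : ratfun_norm (- x) = ratfun_norm x.
Proof.
rewrite /ratfun_norm /ratfun_le eq_sym oppr_eq0 eq_sym.
have [<- | x0] := eqVneq 0 x; first by rewrite oppr0.
have lN : ratfun_lt 0 (- x) = ratfun_lt x 0 by rewrite -(ratfun_sub_gt0 x 0) sub0r.
rewrite /= lN; rewrite eq_sym in x0; have := ratfun_lt0_total x0.
case h1: (ratfun_lt 0 x); case h2: (ratfun_lt x 0); rewrite ?opprK //.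
by have := ratfun_lt0_ngt0 h1; rewrite h2.
Qed.

Fact ratfun_ge0_norm x : ratfun_le 0 x -> ratfun_norm x = x.
Proof. by rewrite /ratfun_norm => ->. Qed.

Fact ratfun_le_def x y : ratfun_le x y = (x == y) || ratfun_lt x y.
Proof. by []. Qed.

HB.instance Definition _ := Num.IntegralDomain_isLtReal.Build ratfun ratfun_lt0_add
  ratfun_lt0_mul ratfun_lt0_ngt0 ratfun_sub_gt0 ratfun_lt0_total ratfun_normN
  ratfun_ge0_norm ratfun_le_def.


Lemma rat_of_poly_gt0 (p : {poly R}) : 0 < p.[0] -> 0 < p%:F :> ratfun.
Proof.
move=> p0; apply/ratfun_ltP; rewrite subr0; exists p, 1; split.
- exact: pos_near0_horner.
- by apply: pos_near0_horner; rewrite hornerC.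
- by rewrite (rmorph1 rat_of_poly) divr1.
Qed.
End RationalFunctions.

(** Independence of the quotient rule from the representative: the last hypothesis is the derivative
    of the one before it. Derivatives are plain variables here, so the identity can be settled by
    [field]. *)
Lemma quotient_rule_eq (F : fieldType) (p q p0 q0 dp dq dp0 dq0 : F) :
  q != 0 -> q0 != 0 -> p * q0 = p0 * q -> p * dq0 + dp * q0 = p0 * dq + dp0 * q ->
  (dp * q - p * dq) / q ^+ 2 = (dp0 * q0 - p0 * dq0) / q0 ^+ 2.
Proof.
move=> nq nq0 e e'.
have -> : p0 = p * q0 / q by rewrite e mulfK.
have -> : dp0 = (p * dq0 + dp * q0 - p * q0 / q * dq) / q.
  by apply: (canRL (mulfK nq)); rewrite e' e mulfK // addrC addKr.
by field; rewrite nq nq0.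
Qed.

Lemma quotient_ruleD (F : fieldType) (p q p' q' dp dq dp' dq' : F) :
  q != 0 -> q' != 0 ->
  ((p * dq' + dp * q' + (p' * dq + dp' * q)) * (q * q') -
     (p * q' + p' * q) * (q * dq' + dq * q')) / (q * q') ^+ 2 =
  (dp * q - p * dq) / q ^+ 2 + (dp' * q' - p' * dq') / q' ^+ 2.
Proof. by move=> n1 n2; field; rewrite n1 n2. Qed.

Lemma quotient_ruleM (F : fieldType) (p q p' q' dp dq dp' dq' : F) :
  q != 0 -> q' != 0 ->
  ((p * dp' + dp * p') * (q * q') - (p * p') * (q * dq' + dq * q')) / (q * q') ^+ 2 =
  p / q * ((dp' * q' - p' * dq') / q' ^+ 2) + (dp * q - p * dq) / q ^+ 2 * (p' / q').
Proof. by move=> n1 n2; field; rewrite n1 n2. Qed.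

Section RationalDerivation.
Variables (R : rcfType) (delta : R -> R) (gamma : R).
Hypothesis delta_der : derivation delta.
Implicit Types p q : {poly R}.

(* The derivation of R[t] extending delta with t' = gamma. *)
Definition pder p : {poly R} := map_poly delta p + gamma *: p^`().

Lemma der_sum (I : Type) (r : seq I) (F : I -> R) :
  delta (\sum_(i <- r) F i) = \sum_(i <- r) delta (F i).
Proof.
elim: r => [|i r IH]; first by rewrite !big_nil (der0 delta_der).
by rewrite !big_cons (derD delta_der) IH.
Qed.

Lemma map_derD p q : map_poly delta (p + q) = map_poly delta p + map_poly delta q.
Proof.
by apply/polyP => i; rewrite coefD !coef_map_id0 ?der0 // coefD derD.
Qed.

Lemma map_derM p q :
  map_poly delta (p * q) = p * map_poly delta q + map_poly delta p * q.
Proof.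
apply/polyP => i; rewrite coefD !coefM coef_map_id0 ?der0 // coefM der_sum -big_split /=.
by apply: eq_bigr => j _; rewrite !coef_map_id0 ?der0 // derM.
Qed.

Lemma pderD p q : pder (p + q) = pder p + pder q.
Proof. by rewrite /pder map_derD derivD scalerDr addrACA. Qed.

Lemma pderM p q : pder (p * q) = p * pder q + pder p * q.
Proof.
rewrite /pder map_derM derivM scalerDr mulrDr mulrDl -scalerAl -scalerAr.
by rewrite [gamma *: _ + _]addrC addrACA.
Qed.

Lemma pderC c : pder c%:P = (delta c)%:P.
Proof.
rewrite /pder derivC scaler0 addr0; apply/polyP => i.
by rewrite coef_map_id0 ?der0 // !coefC; case: (i == 0%N); rewrite ?der0.
Qed.

Variables (L : realFieldType) (f : {rmorphism {poly R} -> L}).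
Hypothesis f_neq0 : forall p, p != 0 -> f p != 0.
Hypothesis f_frac : forall x, exists p q, q != 0 /\ x = f p / f q.
Hypothesis f_gt0 : forall p, 0 < p.[0] -> 0 < f p.
Local Notation "p %:F" := (f p).

(** The quotient rule applied to a chosen representative; [ratfun_der_frac] shows that any
    representative gives the same value. *)
Definition ratfun_der (x : L)  : L :=
  let (p, H) := constructive_indefinite_description _ (f_frac x) in
  let (q, _) := constructive_indefinite_description _ H in
  ((pder p)%:F * q%:F - p%:F * (pder q)%:F) / q%:F ^+ 2.

Lemma ratfun_der_frac p q : q != 0 ->
  ratfun_der (p%:F / q%:F) = ((pder p)%:F * q%:F - p%:F * (pder q)%:F) / q%:F ^+ 2.
Proof.
move=> nq; rewrite /ratfun_der.
case: constructive_indefinite_description => p0 H.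
case: constructive_indefinite_description => q0 [nq0 E].
have {}E : p%:F * q0%:F = p0%:F * q%:F.
  by apply/eqP; rewrite -eqr_div ?f_neq0 // E.
have E' : p * q0 = p0 * q.
  apply/eqP; rewrite -subr_eq0; apply: contraT => /f_neq0.
  by rewrite rmorphB !rmorphM E subrr eqxx.
apply/esym/quotient_rule_eq; rewrite ?f_neq0 //.
have := congr1 (fun r => (pder r)%:F) E'.
rewrite !pderM; move: (pder p) (pder q) (pder p0) (pder q0) => dp dq dp0 dq0.
by rewrite !(rmorphD f) !(rmorphM f).
Qed.

Lemma ratfun_der_poly p : ratfun_der p%:F = (pder p)%:F.
Proof.
have p1 : pder 1 = 0 by rewrite pderC der1.
have := ratfun_der_frac p (oner_neq0 _); rewrite p1.
by rewrite (rmorph1 f) (rmorph0 f) mulr0 subr0 expr1n !divr1 mulr1.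
Qed.

Lemma ratfun_derD x y : ratfun_der (x + y) = ratfun_der x + ratfun_der y.
Proof.
have [p [q [nq ->]]] := f_frac x; have [p' [q' [nq' ->]]] := f_frac y.
have n1 := f_neq0 nq; have n2 := f_neq0 nq'.
have nqq : q * q' != 0 by rewrite mulf_neq0.
have -> : p%:F / q%:F + p'%:F / q'%:F = (p * q' + p' * q)%:F / (q * q')%:F.
  rewrite (addf_div _ _ n1 n2) [in RHS](rmorphD f).
  by rewrite (rmorphM f p) (rmorphM f p' q) (rmorphM f q q').
rewrite (ratfun_der_frac _ nqq) (ratfun_der_frac _ nq) (ratfun_der_frac _ nq') pderD !pderM.
move: (pder p) (pder q) (pder p') (pder q') => dp dq dp' dq'.
rewrite !(rmorphD f) !(rmorphM f).
exact: quotient_ruleD.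
Qed.

Lemma ratfun_derM x y : ratfun_der (x * y) = x * ratfun_der y + ratfun_der x * y.
Proof.
have [p [q [nq ->]]] := f_frac x; have [p' [q' [nq' ->]]] := f_frac y.
have n1 := f_neq0 nq; have n2 := f_neq0 nq'.
have nqq : q * q' != 0 by rewrite mulf_neq0.
have -> : p%:F / q%:F * (p'%:F / q'%:F) = (p * p')%:F / (q * q')%:F.
  by rewrite mulf_div (rmorphM f p) (rmorphM f q q').
rewrite (ratfun_der_frac _ nqq) (ratfun_der_frac _ nq) (ratfun_der_frac _ nq') !pderM.
move: (pder p) (pder q) (pder p') (pder q') => dp dq dp' dq'.
rewrite !(rmorphD f) !(rmorphM f).
exact: quotient_ruleM.
Qed.

Lemma ratfun_der_derivation : derivation ratfun_der.
Proof. by move=> x y; split; [exact: ratfun_derD | exact: ratfun_derM]. Qed.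

Definition ratfun_const : {rmorphism R -> L} := f \o polyC.

Lemma ratfun_const_le x y : (ratfun_const x <= ratfun_const y) = (x <= y).
Proof.
have H a b : a < b -> ratfun_const a < ratfun_const b.
  move=> ab; rewrite -subr_gt0 -rmorphB /=; apply: f_gt0.
  by rewrite hornerC subr_gt0.
case: (ltgtP x y) => [/H/ltW //|/H|->]; last by rewrite lexx.
by rewrite ltNge => /negbTE.
Qed.

End RationalDerivation.

Lemma rational_extension (R : rcfType) (delta : R -> R) (gamma : R) : derivation delta ->
  exists (L : realFieldType) (dL : L -> L) (f : {rmorphism {poly R} -> L}),
  [/\ derivation dL, forall p, p != 0 -> f p != 0, forall p, 0 < p.[0] -> 0 < f p,
      forall p, dL (f p) = f (pder delta gamma p) &
      forall x y, (f x%:P <= f y%:P) = (x <= y)].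
Proof.
move=> delta_der; pose f : {rmorphism {poly R} -> ratfun R} := @rat_of_poly R.
have f0 : forall p, p != 0 -> f p != 0 by exact: rat_of_poly_neq0.
have f1 : forall p, 0 < p.[0] -> 0 < f p by exact: rat_of_poly_gt0.
exists (ratfun R), (@ratfun_der R delta gamma (ratfun R) f (@ratfun_frac R)), f.
split=> //.
- exact: ratfun_der_derivation.
- by move=> p; apply: ratfun_der_poly.
- exact: ratfun_const_le.
Qed.

(** One application to q t^(n+1) leaves a multiple of t^n whose cofactor has value (n+1) q(0) at 0;
    iteration accumulates the factorial. *)
Lemma iter_pder_low (R : rcfType) (delta : R -> R) (delta_der : derivation delta) n :
  forall (q : {poly R}), (forall l, (l < n)%N -> (iter l (pder delta 1) (q * 'X^n)).[0] = 0) /\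
    (iter n (pder delta 1) (q * 'X^n)).[0] = n`!%:R * q.[0].
Proof.
have DX m : pder delta 1 'X^(m.+1) = m.+1%:R *: 'X^m.
  rewrite /pder derivXn scale1r; have -> : map_poly delta 'X^(m.+1) = 0.
    apply/polyP => i; rewrite coef_map_id0 ?der0 // coefXn coef0.
    by case: (i == _); rewrite ?der1 ?der0.
  by rewrite add0r scaler_nat.
elim: n => [|n IH] q; first by split=> //=; rewrite mulr1 fact0 mul1r.
have E : pder delta 1 (q * 'X^(n.+1)) = (pder delta 1 q * 'X + n.+1%:R *: q) * 'X^n.
  rewrite pderM // DX; move: (pder delta 1 q) => dq.
  by rewrite exprS mulrDl -scalerAl -scalerAr mulrA addrC.
have [H1 H2] := IH (pder delta 1 q * 'X + n.+1%:R *: q).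
split=> [[|l] ln|].
- by rewrite /= hornerM hornerXn expr0n mulr0.
- by rewrite iterSr E H1.
- rewrite iterSr E H2 hornerD hornerMX mulr0 add0r hornerZ factS natrM.
  by rewrite mulrA [n`!%:R * _]mulrC.
Qed.

(** A correction c t^k adjusts the value of order k and, by [iter_pder_low], leaves the lower ones
    alone. *)
Lemma poly_with_derivatives (R : rcfType) (delta : R -> R) (delta_der : derivation delta)
    (r : nat -> R) k : exists y : {poly R},
  forall l, (l < k)%N -> (iter l (pder delta 1) y).[0] = r l.
Proof.
elim: k => [|k [y Hy]]; first by exists 0.
pose c := (r k - (iter k (pder delta 1) y).[0]) / k`!%:R.
have iterD l p q : iter l (pder delta 1) (p + q) = iter l (pder delta 1) p + iter l (pder delta 1) q.
  by elim: l => //= l ->; rewrite pderD.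
have [H1 H2] := iter_pder_low delta_der k c%:P.
exists (y + c%:P * 'X^k) => l; rewrite ltnS leq_eqVlt iterD hornerD => /orP[/eqP->|lk].
  rewrite H2 hornerC mulrC divfK ?pnatr_eq0 -?lt0n ?fact_gt0 //.
  by rewrite addrC subrK.
by rewrite H1 // Hy // addr0.
Qed.

(** * Differential polynomials as terms, and points where they do not vanish *)

Section DifferentialMonomials.
Implicit Types m : seq nat.

Definition Tders i := iter i Tder (Tvar 0).

(** [m] lists the exponents of the derivatives of orders k, k+1, ... of variable 0. *)
Fixpoint Tmono k m : term :=
  if m is a :: m' then Tmul (iter a (Tmul (Tders k)) T1) (Tmono k.+1 m') else T1.

Fixpoint monov (T : nzRingType) (z : nat -> T) k m : T :=
  if m is a :: m' then z k ^+ a * monov z k.+1 m' else 1.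

Lemma teval_Tmono (T : realFieldType) (d : T -> T) v k m :
  teval d v (Tmono k m) = monov (fun i => iter i d (v 0%N)) k m.
Proof.
elim: m k => //= a m IH k; rewrite IH; congr (_ * _).
have -> : iter k d (v 0%N) = teval d v (Tders k) by elim: k {IH} => //= k ->.
by elim: a => //= a ->; rewrite exprS.
Qed.

Definition Tpol (P : seq (seq nat * term)) : term :=
  foldr (fun q t => Tadd (Tmul q.2 (Tmono 0 q.1)) t) T0 P.

Lemma teval_Tpol (T : realFieldType) (d : T -> T) v P : teval d v (Tpol P) =
  \sum_(q <- P) teval d v q.2 * monov (fun i => iter i d (v 0%N)) 0 q.1.
Proof. by elim: P => [|q P IH]; rewrite ?big_nil // big_cons /= IH teval_Tmono. Qed.

Lemma monov_agree (T : nzRingType) (z z' : nat -> T) k m :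
  (forall i, (i < k + size m)%N -> z i = z' i) -> monov z k m = monov z' k m.
Proof.
elim: m k => //= a m IH k H; rewrite H ?addnS ?ltnS ?leq_addr // IH // => i ik.
by apply: H; rewrite addnS -addSn.
Qed.

Lemma monov_morph (T T' : nzRingType) (f : {rmorphism T -> T'}) (z : nat -> T) k m :
  monov (fun i => f (z i)) k m = f (monov z k m).
Proof. by elim: m k => [|a m IH] k /=; rewrite ?rmorph1 // rmorphM rmorphXn IH. Qed.

(** The integer with base-N digits [m], lowest digit first. *)
Definition kcode N m := foldr (fun a c => a + N * c)%N 0%N m.

Lemma kcode_inj N m m' : all (fun a => a < N)%N m -> all (fun a => a < N)%N m' ->
  size m = size m' -> kcode N m = kcode N m' -> m = m'.
Proof.
elim: m m' => [|a m IH] [|a' m'] //= /andP[aN mN] /andP[aN' mN'] [sm] e.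
have N0 : (0 < N)%N by apply: leq_ltn_trans aN.
have ea : a = a'.
  have := congr1 (modn^~ N) e.
  by rewrite !(addnC _ (N * _)%N) ![(N * _)%N]mulnC !modnMDl !modn_small.
by rewrite ea; congr (_ :: _); apply: IH => //; move/eqP: e;
   rewrite ea eqn_add2l eqn_pmul2l // => /eqP.
Qed.

Lemma monov_kcode (T : comNzRingType) (x : T) N k m :
  monov (fun i => x ^+ (N ^ i)) k m = x ^+ (N ^ k * kcode N m).
Proof.
elim: m k => [|a m IH] k /=; first by rewrite muln0.
by rewrite IH -exprM -exprD mulnDr expnS mulnA [(N * N ^ k)%N]mulnC.
Qed.

(** Exponent lists of one common length that are pairwise distinct denote distinct monomials, so a
    single nonzero coefficient makes the polynomial nonzero. *)
Definition well_formed (A : Type) (P : seq (seq nat * A)) : Prop :=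
  uniq (map fst P) /\ exists n, all (fun q => size q.1 == n) P.

Lemma uniq_map_inj (T1 T2 : eqType) (f : T1 -> T2) s :
  uniq (map f s) -> {in s &, injective f}.
Proof.
elim: s => //= a s IH /andP[fa us] x y; rewrite !inE.
move=> /orP[/eqP->|xs] /orP[/eqP->|ys] // e; last exact: IH.
  by rewrite e map_f in fa.
by rewrite -e map_f in fa.
Qed.

Lemma nonroot_between (F : realFieldType) (a b : F) (p : {poly F}) : a < b -> p != 0 ->
  exists x, [/\ a < x, x < b & p.[x] != 0].
Proof.
move=> ab p0; apply: NNPP => H.
(* The denominators start at 2 to keep every point strictly below [b]. *)
pose rs := [seq a + (b - a) / i.+2%:R | i <- iota 0 (size p)].
have pos i : 0 < (b - a) / i.+2%:R by rewrite divr_gt0 ?ltr0n // subr_gt0.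
have : p == 0; last by rewrite (negPf p0).
apply/eqP; apply: (@roots_geq_poly_eq0 _ _ rs); last by rewrite size_map size_iota.
- apply/allP => _ /mapP[i _ ->]; apply: contra_notT H => nr.
  exists (a + (b - a) / i.+2%:R); split=> //; first by rewrite ltrDl.
  rewrite -ltrBrDl ltr_pdivrMr ?ltr0n // -subr_gt0.
  by rewrite -{2}[b - a]mulr1 -mulrBr mulr_gt0 ?subr_gt0 // ltr1n.
- rewrite map_inj_uniq ?iota_uniq // => i j /addrI /mulfI e.
  have /e /invr_inj /eqP : b - a != 0 by rewrite subr_eq0 gt_eqF.
  by rewrite eqr_nat => /eqP[].
Qed.

(* Kronecker substitution: z_i = x^(N^i) separates monomials with exponents below N. *)
Lemma kronecker_point (F : realFieldType) (a b : F) (Ps : list (seq (seq nat * F))) :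
  a < b -> (forall P, List.In P Ps -> well_formed P /\ exists2 q, q \in P & q.2 != 0) ->
  exists z : nat -> F, [/\ a < z 0%N, z 0%N < b &
    forall P, List.In P Ps -> \sum_(q <- P) q.2 * monov z 0 q.1 != 0].
Proof.
move=> ab HP.
have [N HN] : exists N, forall P, List.In P Ps ->
    all (fun q : seq nat * F => all (fun a => a < N)%N q.1) P.
  elim: (Ps) => [|P Qs [N HN]]; first by exists 0%N.
  pose B (P : seq (seq nat * F)) := (\max_(q <- P) \max_(a <- q.1) a).+1.
  exists (maxn N (B P)) => Q [<-|/HN]; last first.
    by apply: sub_all => q; apply: sub_all => c cN; rewrite leq_max cN.
  apply/allP => q qP; apply/allP => c cq; rewrite leq_max; apply/orP; right.
  rewrite /B ltnS (leq_trans _ (leq_bigmax_seq _ qP _)) //.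
  by rewrite (leq_trans _ (leq_bigmax_seq _ cq _)).
pose K (P : seq (seq nat * F)) : {poly F} := \sum_(q <- P) q.2 *: 'X^(kcode N q.1).
have K0 P : List.In P Ps -> K P != 0.
  move=> PPs; have [[uP [n sP]] [q0 q0P q00]] := HP P PPs.
  apply/eqP => /(congr1 (fun p : {poly F} => p`_(kcode N q0.1))).
  rewrite coef0 coef_sum (bigD1_seq q0) //=; last exact: map_uniq uP.
  rewrite coefZ coefXn eqxx mulr1 big_seq_cond big1 ?addr0 => [e|q /andP[qP nq]].
    by rewrite e eqxx in q00.
  rewrite coefZ coefXn; case: eqP => [e|_]; last by rewrite mulr0.
  case/eqP: nq; apply: (uniq_map_inj uP) => //; apply: (@kcode_inj N) => //.
  - by move/allP: (HN P PPs); apply.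
  - by move/allP: (HN P PPs); apply.
  - by rewrite (eqP (allP sP q qP)) (eqP (allP sP q0 q0P)).
have [p p0 Hp] : exists2 p : {poly F}, p != 0 &
    forall x, p.[x] != 0 -> forall P, List.In P Ps -> (K P).[x] != 0.
  elim: (Ps) K0 => [|P Qs IH] K0; first by exists 1; rewrite ?oner_neq0.
  have [|p p0 Hp] := IH; first by move=> Q HQ; apply: K0; right.
  exists (K P * p); first by rewrite mulf_neq0 // K0 //; left.
  move=> x; rewrite hornerM mulf_eq0 negb_or => /andP[h1 h2] Q [<-//|].
  exact: Hp.
have [x [ax xb px]] := nonroot_between ab p0.
(* As N^0 = 1, the coordinate z_0 is [x] itself and so lies in the interval. *)
exists (fun i => x ^+ (N ^ i)); rewrite expn0 expr1; split=> // P PPs.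
have := Hp x px P PPs; rewrite /K horner_sum; congr (_ != 0).
by apply: eq_bigr => q _; rewrite hornerZ hornerXn monov_kcode expn0 mul1n.
Qed.
End DifferentialMonomials.

(** * Consequences of existential closedness *)

Section ExistentiallyClosed.
Variables (R : rcfType) (delta : R -> R).
Hypothesis hK : CODF delta.

Let delta_der : derivation delta := proj1 hK.

Definition Fbetween f := Fand (Flt (Tvar 1) (Tvar 0)) (Fand (Flt (Tvar 0) (Tvar 2)) f).
(** Coefficients are named by indices raised by one, which leaves variable 0 to the unknown. *)
Definition coefs_pol (P : seq (seq nat * nat)) := Tpol [seq (q.1, Tvar q.2.+1) | q <- P].
Definition Fnonroots (Ps : list (seq (seq nat * nat))) :=
  Fands (List.map (fun P => Fnot (Feq (coefs_pol P) T0)) Ps).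

(** Existential closedness with [k] = 1, where variable 0 is the only unknown and its solution in
    R(t) is a polynomial [y]. *)
Lemma codf_one_point (v : nat -> R) f gamma (y : {poly R}) : qf f -> nocst f ->
  (forall (L : realFieldType) (dL : L -> L) (h : {rmorphism {poly R} -> L}),
     (forall p, p != 0 -> h p != 0) -> (forall p, 0 < p.[0] -> 0 < h p) ->
     (forall p, dL (h p) = h (pder delta gamma p)) ->
     satK dL (upd (fun j => h (v j)%:P) 0 (h y)) f) ->
  exists x, satK delta (upd v 0 x) f.
Proof.
move=> qff cf Hf; have [L [dL [h [dLd h0 h1 hd hle]]]] := rational_extension gamma delta_der.
have [_ H] := hK.
have [|||w [wv Hw]] := H L dL (h \o polyC) dLd _ _ f 1%N v qff cf.
- exact: hle.
- by move=> x /=; rewrite hd pderC.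
- exists (upd (fun j => h (v j)%:P) 0 (h y)); split; last exact: Hf h0 h1 hd.
  by case.
exists (w 0%N); congr (satK delta _ f): Hw.
apply: functional_extensionality => -[|j] //.
by rewrite /upd /= wv.
Qed.

Lemma codf_const_dense (v : nat -> R) : v 1%N < v 2%N ->
  exists x, satK delta (upd v 0 x) (Fbetween (Feq (Tder (Tvar 0)) T0)).
Proof.
move=> ab; pose m := (v 1%N + v 2%N) / 2.
apply: (@codf_one_point v _ (- delta m) (m%:P + 'X)) => // L dL h h0 h1 hd.
rewrite /satK /= /upd /= hd; split; last split.
- by rewrite -subr_gt0 -rmorphB; apply: h1; rewrite !hornerE /m; lra.
- by rewrite -subr_gt0 -rmorphB; apply: h1; rewrite !hornerE /m; lra.
- rewrite pderD // pderC // /pder derivX.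
  have -> : map_poly delta 'X = 0.
    by apply/polyP => i; rewrite coef_map_id0 ?der0 // coefX coef0; case: eqP; rewrite ?der1 ?der0.
  by rewrite add0r -mul_polyC mulr1 -polyCD subrr polyC0 rmorph0.
Qed.

(** A Kronecker point [z] supplies the values to prescribe: z_0 lies between the endpoints and no
    polynomial of the list vanishes at [z]. A polynomial whose successive derivatives take these
    values at t = 0 solves the formula in R(t). *)
Lemma codf_generic_dense (v : nat -> R) (Ps : list (seq (seq nat * nat))) :
  v 1%N < v 2%N ->
  (forall P, List.In P Ps -> well_formed P /\ exists2 q, q \in P & v q.2.+1 != 0) ->
  exists x, satK delta (upd v 0 x) (Fbetween (Fnonroots Ps)).
Proof.
move=> ab HP.
have nocst_Fnonroots : nocst (Fnonroots Ps) by rewrite /Fnonroots; elim: (Ps).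
have qf_Fnonroots : qf (Fnonroots Ps) by rewrite /Fnonroots; elim: (Ps).
pose Qs := List.map (fun P : seq (seq nat * nat) => [seq (q.1, v q.2.+1) | q <- P]) Ps.
have [|z [z1 z2 Hz]] := @kronecker_point R _ _ Qs ab.
  move=> Q /List.in_map_iff[P [<- /HP[[uP [n sP]] [q qP q0]]]]; split.
    split; first by rewrite -map_comp.
    by exists n; rewrite all_map.
  by exists (q.1, v q.2.+1) => //; apply: map_f.
have [k Hk] : exists k, forall P, List.In P Ps -> all (fun q => size q.1 <= k)%N P.
  elim: (Ps) HP => [|P Ps' IH] HP; first by exists 0%N.
  have [|k Hk] := IH; first by move=> P' HP'; apply: HP; right.
  have [[_ [n sP]] _] := HP P (or_introl erefl).
  exists (maxn k n) => P' [<-|/Hk].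
    by apply: sub_all sP => q /eqP->; rewrite leq_maxr.
  by apply: sub_all => q qk; rewrite leq_max qk.
have [y Hy] := poly_with_derivatives delta_der z k.+1.
apply: (@codf_one_point v _ 1 y) => // L dL h h0 h1 hd.
have hiter i : iter i dL (h y) = h (iter i (pder delta 1) y) by elim: i => //= i ->.
have y0 := Hy 0%N isT; rewrite /= in y0.
rewrite /satK /= /upd /=; split; last split.
- by rewrite -subr_gt0 -rmorphB; apply: h1; rewrite !hornerE y0; lra.
- by rewrite -subr_gt0 -rmorphB; apply: h1; rewrite !hornerE y0; lra.
apply/sat_Fands => _ /List.in_map_iff[P [<- PPs]] /=.
rewrite teval_Tpol big_map /=.
pose T := \sum_(q <- P) (v q.2.+1)%:P * monov (fun i => iter i (pder delta 1) y) 0 q.1.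
have -> : \sum_(q <- P) h (v q.2.+1)%:P * monov (fun i => iter i dL (h y)) 0 q.1 = h T.
  rewrite rmorph_sum; apply: eq_bigr => q _; rewrite rmorphM -monov_morph.
  by congr (_ * _); apply: monov_agree => i _; rewrite hiter.
(* [T] is a nonzero element of R[t] because its value at t = 0 is the value of [P] at [z]. *)
apply/eqP/h0; apply/eqP => /(congr1 (fun p : {poly R} => p.[0])); rewrite horner0 => /eqP.
apply/negP; have := Hz _ (List.in_map _ _ _ PPs); rewrite big_map /T horner_sum.
congr (_ != 0); rewrite big_seq [RHS]big_seq; apply: eq_bigr => q qP /=.
rewrite hornerM hornerC; congr (_ * _).
have -> : (monov (fun i => iter i (pder delta 1) y) 0 q.1).[0] =
    monov (fun i => (iter i (pder delta 1) y).[0]) 0 q.1.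
  by rewrite -[LHS]/(horner_eval 0 _) -monov_morph.
apply: monov_agree => i; rewrite add0n => iq; rewrite Hy //.
by apply: leq_trans iq _; rewrite ltnW // ltnS; move/allP: (Hk P PPs); apply.
Qed.
End ExistentiallyClosed.

(** * Transfer to the elementary extension of the differential field *)

Section Transfer.
Variables (R : rcfType) (delta : R -> R) (hK : CODF delta).
Variables (K : realFieldType) (dK : K -> K) (iota : R -> K).
Hypothesis hKel : elemK delta dK iota.

Lemma elemK_forall f : nocst f -> (forall v, satK delta v f) -> forall w, satK dK w f.
Proof.
by move=> cf Hv; apply: (@sat_transfer_forall R K delta dK (kerd delta) (kerd dK) iota nocst).
Qed.

Lemma elemK_iota0 : iota 0 = 0.
Proof. by have [H _] := hKel (fun=> 0) (isT : nocst (Feq (Tvar 0) T0)); apply: H. Qed.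

Lemma elemK_derivation : derivation dK.
Proof.
have [dd _] := hK; move=> x y; split.
- have := @elemK_forall (Feq (Tder (Tadd (Tvar 0) (Tvar 1)))
    (Tadd (Tder (Tvar 0)) (Tder (Tvar 1)))) isT.
  move=> /(_ _ (fun j => if j == 0%N then x else y)); apply.
  by move=> v; apply: derD.
- have := @elemK_forall (Feq (Tder (Tmul (Tvar 0) (Tvar 1)))
    (Tadd (Tmul (Tvar 0) (Tder (Tvar 1))) (Tmul (Tder (Tvar 0)) (Tvar 1)))) isT.
  move=> /(_ _ (fun j => if j == 0%N then x else y)); apply.
  by move=> v; apply: derM.
Qed.

Lemma elemK_const_dense a b : a < b -> exists c, [/\ dK c = 0, a < c & c < b].
Proof.
move=> ab.
pose f := Fimp (Flt (Tvar 1) (Tvar 2)) (Fex 0 (Fbetween (Feq (Tder (Tvar 0)) T0))).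
have Hf : satK dK (fun j => if j == 1%N then a else b) f.
  apply: elemK_forall => // v; rewrite /satK sat_Fimp /= => v12.
  exact: codf_const_dense.
move: Hf; rewrite /satK sat_Fimp => /(_ ab)[c].
by rewrite /= /upd /= => -[h1 [h2 h3]]; exists c.
Qed.

(** The coefficients now range over K, outside the reach of elementarity with parameters in R. Their
    not all vanishing is therefore written into the formula ([nz]), and the universally valid
    implication is transferred. *)
Lemma elemK_generic_dense (w : nat -> K) (Ps : list (seq (seq nat * nat))) :
  w 1%N < w 2%N ->
  (forall P, List.In P Ps -> well_formed P /\ exists2 q, q \in P & w q.2.+1 != 0) ->
  exists x, satK dK (upd w 0 x) (Fbetween (Fnonroots Ps)).
Proof.
move=> ab HP.
pose nz (P : seq (seq nat * nat)) := Fnot (Fands [seq Feq (Tvar q.2.+1) T0 | q <- P]).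
pose f := Fimp (Fand (Flt (Tvar 1) (Tvar 2)) (Fands (List.map nz Ps)))
  (Fex 0 (Fbetween (Fnonroots Ps))).
have nzP (T : realFieldType) (d : T -> T) (v : nat -> T) P :
    satK d v (nz P) <-> exists2 q, q \in P & v q.2.+1 != 0.
  rewrite /nz /satK /=; elim: P => [|q P IH] /=; first by split=> [[]|[]].
  split.
    move=> H; have [e|ne] := eqVneq (v q.2.+1) 0; last by exists q; rewrite ?mem_head.
    have [|q' q'P nq'] := (proj1 IH); first by move=> HP'; apply: H.
    by exists q'; rewrite // inE q'P orbT.
  move=> [q' ]; rewrite inE => /orP[/eqP->|q'P] nq' [/eqP e H].
    by rewrite e in nq'.
  by case: (proj2 IH); [exists q' | exact: H].
have cf : nocst f.
  have c1 : nocst (Fnonroots Ps) by rewrite /Fnonroots; elim: (Ps).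
  have c2 : nocst (Fands (List.map nz Ps)).
    elim: (Ps) => //= P Qs ->; rewrite andbT.
    by elim: P.
  by rewrite /f /= c1 c2.
have : satK dK w f.
  apply: elemK_forall cf _ _ => v; rewrite /satK sat_Fimp /= => -[v12 Hv].
  apply: codf_generic_dense => // P PPs; split; first by have [] := HP P PPs.
  by apply/(nzP _ delta); move/sat_Fands: Hv; apply; apply: List.in_map.
rewrite /satK sat_Fimp /=; apply; split=> //.
apply/sat_Fands => _ /List.in_map_iff[P [<- PPs]].
by apply/nzP; have [] := HP P PPs.
Qed.

Fixpoint Thorner k n x := if n is m.+1 then Tadd (Tvar k) (Tmul x (Thorner k.+1 m x)) else T0.

Lemma teval_Thorner (T : realFieldType) (d : T -> T) v k (p : seq T) x :
  (forall i, (i < size p)%N -> v (k + i)%N = nth 0 p i) ->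
  teval d v (Thorner k (size p) x) = (Poly p).[teval d v x].
Proof.
elim: p k => [|c p IH] k H /=; first by rewrite horner0.
rewrite horner_cons IH; last by move=> i ip; rewrite addSnnS H.
by have := H 0%N isT; rewrite addn0 => ->; rewrite /= addrC mulrC.
Qed.

(** For each size [n] the intermediate value property of polynomials of that size is one universally
    valid formula over R. *)
Lemma elemK_rcf : Num.real_closed_axiom K.
Proof.
move=> p a b ab /andP[pa pb]; set n := size p.
pose le s t := Fnot (Flt t s).
pose f := Fimp (Fand (le (Tvar 1) (Tvar 2))
    (Fand (le (Thorner 3 n (Tvar 1)) T0) (le T0 (Thorner 3 n (Tvar 2)))))
  (Fex 0 (Fand (Feq (Thorner 3 n (Tvar 0)) T0)
     (Fand (le (Tvar 1) (Tvar 0)) (le (Tvar 0) (Tvar 2))))).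
have leP (T : realFieldType) (d : T -> T) v s t :
    sat d (kerd d) v (le s t) <-> teval d v s <= teval d v t.
  by rewrite /= leNgt; split=> /negP.
pose pv (T : realFieldType) (v : nat -> T) := Poly (mkseq (fun i => v (3 + i)%N) n).
have horn (T : realFieldType) (d : T -> T) (v w : nat -> T) t :
    (forall j, (2 < j)%N -> w j = v j) ->
    teval d w (Thorner 3 n t) = (pv T v).[teval d w t].
  move=> wv; rewrite -{1}(size_mkseq (fun i => v (3 + i)%N) n).
  apply: teval_Thorner => i; rewrite size_mkseq => iN.
  by rewrite nth_mkseq // wv.
have cn k m t : nocst (Feq (Thorner k m t) T0) by [].
(* Variables 1 and 2 are the endpoints, and variable 3 + i is the coefficient of degree i. *)
have Hf : satK dK (fun j => if j == 1%N then a else if j == 2%N then b else nth 0 p (j - 3)) f.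
  apply: elemK_forall => // v; rewrite /satK sat_Fimp.
  move=> [h1 [h2 h3]].
  have {}h1 := proj1 (leP R delta v (Tvar 1) (Tvar 2)) h1.
  have {}h2 := proj1 (leP R delta v (Thorner 3 n (Tvar 1)) T0) h2.
  have {}h3 := proj1 (leP R delta v T0 (Thorner 3 n (Tvar 2))) h3.
  rewrite /= (horn _ _ v v) // in h2; rewrite /= (horn _ _ v v) // in h3.
  have [|x /andP[x1 x2] /rootP px] := @poly_ivt R (pv R v) _ _ h1; first by rewrite h2.
  exists x; split; last by split; [apply: (proj2 (leP R delta _ (Tvar 1) (Tvar 0))) | apply: (proj2 (leP R delta _ (Tvar 0) (Tvar 2)))].
  by rewrite /= (horn _ _ v) // => -[|[|]].
move: Hf; rewrite /satK sat_Fimp; set w := fun j => _.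
have pw : pv K w = p.
  apply/polyP => i; rewrite coef_Poly.
  have [iN|iN] := ltnP i n; last by rewrite !nth_default ?size_mkseq.
  by rewrite nth_mkseq // /w /= addKn.
case.
  split; first exact: (proj2 (leP K dK w (Tvar 1) (Tvar 2))).
  split; [apply: (proj2 (leP K dK w (Thorner 3 n (Tvar 1)) T0)) |
          apply: (proj2 (leP K dK w T0 (Thorner 3 n (Tvar 2))))].
    by rewrite (horn _ _ w w) // pw.
  by rewrite (horn _ _ w w) // pw.
move=> x [Hx [x1 x2]]; exists x.
  by rewrite (proj1 (leP K dK (upd w 0 x) (Tvar 1) (Tvar 0)) x1)
    (proj1 (leP K dK (upd w 0 x) (Tvar 0) (Tvar 2)) x2).
by apply/rootP; move: Hx; rewrite /= (horn _ _ w) ?pw // => -[|[|]].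
Qed.
End Transfer.

Lemma gen_dfield_terms (K : realFieldType) (d : K -> K) (d_der : derivation d) (U : seq K) x :
  gen_dfield d (fun z => z \in U) x ->
  exists a b, teval d (nth 0 U) b != 0 /\ x = teval d (nth 0 U) a / teval d (nth 0 U) b.
Proof.
set ev := teval d (nth 0 U).
pose Q x := exists a b, ev b != 0 /\ x = ev a / ev b.
have n1 : ev T1 != 0 by rewrite /ev /= oner_neq0.
move=> Hx; apply: (Hx Q) => //.
- by move=> y /(nthP 0)[i _ <-]; exists (Tvar i), T1; rewrite /ev /= divr1.
- by exists T0, T1; rewrite /ev /= mul0r.
- by exists T1, T1; rewrite /ev /= divr1.
- move=> _ _ [a [b [b0 ->]]] [a' [b' [b0' ->]]].
  by exists (Tadd (Tmul a b') (Tmul a' b)), (Tmul b b'); rewrite /ev /= mulf_neq0 // addf_div.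
- by move=> _ [a [b [b0 ->]]]; exists (Topp a), b; rewrite /ev /= mulNr.
- move=> _ _ [a [b [b0 ->]]] [a' [b' [b0' ->]]].
  by exists (Tmul a a'), (Tmul b b'); rewrite /ev /= mulf_neq0 // mulf_div.
- move=> _ [a [b [b0 ->]]]; have [a0|a0] := eqVneq (ev a) 0.
    by exists T0, T1; rewrite a0 /ev /= !mul0r invr0.
  by exists b, a; rewrite invf_div.
- move=> _ [a [b [b0 ->]]].
  exists (Tadd (Tmul (Tder a) b) (Topp (Tmul a (Tder b)))), (Tmul b b).
  rewrite /ev /= mulf_neq0 //; split=> //; rewrite derM // derV // -/ev.
  by field.
Qed.

Section GenericTypes.
Variables (R : rcfType) (delta : R -> R) (hK : CODF delta).
Variables (K : rcfType) (d : K -> K) (iota : R -> K).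
Hypothesis hKel : elemK delta d iota.

Let d_der : derivation d := elemK_derivation hK hKel.

Definition shift_pol (P : seq (seq nat * term)) := Tpol [seq (q.1, tren S q.2) | q <- P].

(** Variable 0 is not a zero of any nonzero differential polynomial whose coefficients are
    differential terms in [l] and R. The renaming by [S] in [shift_pol] keeps variable 0 out of the
    coefficients. *)
Definition generic_type (l : seq K) (f : formula) (e : nat -> K) : Prop :=
  (forall j, e j \in l \/ exists r, e j = iota r) /\
  exists P, [/\ f = Fnot (Feq (shift_pol P) T0), well_formed P &
    has (fun q => teval d (e \o S) q.2 != 0) P].

(** A finite part of the type involves finitely many coefficient values. Listed in [vals], they
    replace the coefficient terms by plain variables, the form that [elemK_generic_dense]
    handles. *)
Lemma generic_type_dense l a b (s : list (formula * (nat -> K))) : a < b ->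
  (forall q, List.In q s -> generic_type l q.1 q.2) ->
  exists y, [/\ a < y, y < b & forall q, List.In q s -> sat d (kerd d) (upd q.2 0 y) q.1].
Proof.
move=> ab Hs.
have [ls [Hls sls]] : exists ls : list (seq (seq nat * term) * (nat -> K)),
    (forall p, List.In p ls -> well_formed p.1 /\ has (fun q => teval d (p.2 \o S) q.2 != 0) p.1) /\
    forall q, List.In q s -> exists2 p, List.In p ls &
      q = (Fnot (Feq (shift_pol p.1) T0), p.2).
  elim: s Hs => [|[f e] s IH] Hs; first by exists nil; split.
  have [|ls [H1 H2]] := IH; first by move=> q qs; apply: Hs; right.
  have [_ [P [/= ef wP hP]]] := Hs (f, e) (or_introl erefl).
  exists ((P, e) :: ls); split=> [p [<-//|/H1//]|q [<-|/H2[p pls ->]]].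
    by exists (P, e); [left | rewrite ef].
  by exists p => //; right.
have [vals Hvals] : exists vals : seq K, forall p, List.In p ls ->
    all (fun q => teval d (p.2 \o S) q.2 \in vals) p.1.
  elim: (ls) => [|p ls' [vals Hv]]; first by exists [::].
  exists ([seq teval d (p.2 \o S) q.2 | q <- p.1] ++ vals) => p' [<-|/Hv].
    by elim: p.1 => //= q P IH; rewrite inE eqxx /=; apply: sub_all IH => q'; rewrite inE orbC => ->.
  by apply: sub_all => q'; rewrite mem_cat orbC => ->.
pose F (p : seq (seq nat * term) * (nat -> K)) :=
  [seq (q.1, (index (teval d (p.2 \o S) q.2) vals).+2) | q <- p.1].
(* Index 0 is reserved for the unknown and 1, 2 are the endpoints, so values start at 3; [coefs_pol]
   adds the last unit to the [.+2] of [F]. *)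
pose w j := nth 0 [:: 0, a, b & vals] j.
have wE p : List.In p ls -> all (fun q => w (index (teval d (p.2 \o S) q.2) vals).+3 == teval d (p.2 \o S) q.2) p.1.
  by move=> /Hvals; apply: sub_all => q qv; rewrite /w /= nth_index.
have [|y] := @elemK_generic_dense R delta hK K d iota hKel w (List.map F ls) ab.
  move=> P /List.in_map_iff[p [<- pls]]; have [[uP [n sP]] hP] := Hls p pls; split.
    by split; [rewrite -map_comp | exists n; rewrite all_map].
  have wp := wE p pls.
  have : has (fun q => w q.2.+1 != 0) (F p).
    rewrite has_map /=; elim: (p.1) wp hP => //= q P' IH /andP[/eqP wq wP].
    by rewrite wq => /orP[->//|/(IH wP)->]; rewrite orbT.
  by move/hasP => [q qF q0]; exists q.
rewrite /satK /= => -[y1 [y2 Hy]]; exists y; split=> //.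
move=> q /sls[p pls ->] /=.
move/sat_Fands: Hy => /(_ _ (List.in_map _ _ _ (List.in_map _ _ _ pls))) /=.
rewrite /shift_pol /coefs_pol !teval_Tpol !big_map /=.
have wp := wE p pls; congr (~ _ ); congr (_ = _).
elim: (p.1) wp => [|q' P IH] /=; first by rewrite !big_nil.
move=> /andP[/eqP wq /IH E]; rewrite !big_cons E; congr (_ * _ + _).
by rewrite [LHS]wq teval_tren.
Qed.

(** A differential polynomial vanishing at [y] has coefficients in the generated differential field.
    Multiplying by a common denominator [b] makes them values of terms, and the leading one is
    nonzero, so its negated equation belongs to the type. *)
Lemma generic_type_realized l y :
  (forall f e, generic_type l f e -> sat d (kerd d) (upd e 0 y) f) ->
  ~ dalg d (fun z => z \in l \/ exists r, z = iota r) y.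
Proof.
move=> Hy /(diff_alg_dalg d_der)[k [P [P0 [PA Py]]]].
have [l' [Hl' PA']] : exists l' : seq K,
    (forall x, x \in l' -> x \in l \/ exists r, x = iota r) /\
    forall m, m \in msupp P -> gen_dfield d (fun z => z \in l') P@_m.
  elim: (msupp P) => [|m s [l' [H1 H2]]]; first by exists [::].
  have [l2 [H3 H4]] := gen_finitary (PA m).
  exists (l2 ++ l'); split=> [x|m']; first by rewrite mem_cat => /orP[/H3|/H1].
  rewrite inE => /orP[/eqP->|/H2 H].
    by apply: gen_mono H4 => x xl; rewrite mem_cat xl.
  by apply: gen_mono H => x xl; rewrite mem_cat xl orbT.
have [c [b [b0 cP]]] : exists (c : 'X_{1..k.+1} -> term) b, teval d (nth 0 l') b != 0 /\
    forall m, m \in msupp P -> teval d (nth 0 l') (c m) = teval d (nth 0 l') b * P@_m.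
  elim: (msupp P) PA' => [|m s IH] PA'; first by exists (fun=> T0), T1; rewrite /= oner_neq0.
  have [|c [b [b0 cP]]] := IH; first by move=> m' ms; apply: PA'; rewrite inE ms orbT.
  have [u [v [v0 puv]]] := gen_dfield_terms d_der (PA' m (mem_head _ _)).
  exists (fun m' => if m' == m then Tmul u b else Tmul v (c m')), (Tmul b v).
  split; first by rewrite /= mulf_neq0.
  move=> m'; rewrite inE; case: eqP => [-> _|_ /= /cP e] /=; first by rewrite puv; field.
  by rewrite e mulrCA mulrA.
pose Q := [seq (((m : 'X_{1..k.+1}) : seq nat), c m) | m <- msupp P].
pose e j := nth 0 (0 :: l') j.
have := Hy (Fnot (Feq (shift_pol Q) T0)) e; case.
- split.
    move=> [|j]; first by right; exists 0; rewrite /e /= (elemK_iota0 hKel).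
    rewrite /e /=; have [jl|jl] := ltnP j (size l'); first by apply/Hl'/mem_nth.
    by right; exists 0; rewrite nth_default // (elemK_iota0 hKel).
  exists Q; split=> //.
    split; first by rewrite /Q -map_comp map_inj_uniq ?msupp_uniq // => m m' /= em;
       apply/mnmP => i; rewrite !(mnm_nth 0%N) em.
    by exists k.+1; rewrite all_map; apply/allP => m _ /=; rewrite size_tuple.
  rewrite has_map; apply/hasP; exists (mlead P); first by rewrite mlead_supp.
  rewrite /= -[e \o S]/(nth 0 l') cP ?mlead_supp //.
  by rewrite mulf_neq0 // mleadc_eq0.
rewrite /= /shift_pol teval_Tpol 2!big_map /=.
transitivity (teval d (nth 0 l') b * P.@[fun i : 'I_k.+1 => iter i d y]); last by rewrite Py mulr0.
rewrite mevalE mulr_sumr big_seq [RHS]big_seq; apply: eq_bigr => m mP.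
rewrite teval_tren -[_ \o _]/(nth 0 l') cP // -mulrA; congr (_ * (_ * _)).
have -> : upd e 0 y 0%N = y by [].
rewrite (eq_bigr (fun i : 'I_k.+1 => (iter i d y) ^+ nth 0%N (m : seq nat) i)); last first.
  by move=> i _; rewrite (mnm_nth 0%N).
have G s k0 : monov (fun i => iter i d y) k0 s = \prod_(i < size s) (iter (k0 + i) d y) ^+ nth 0%N s i.
  elim: s k0 => [|a s IH] k0; first by rewrite big_ord0.
  rewrite big_ord_recl /= addn0 IH; congr (_ * _).
  by apply: eq_bigr => i _; rewrite /bump /= add1n addnS.
by rewrite G size_tuple; apply: eq_bigr => i _; rewrite add0n.
Qed.

Lemma generic_types l : exists Sigma0 : formula -> (nat -> K) -> Prop,
  [/\ forall f e, Sigma0 f e -> params iota l f e,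
    forall a b, a < b -> forall s : list (formula * (nat -> K)),
      (forall q, List.In q s -> Sigma0 q.1 q.2) ->
      exists y, [/\ a < y, y < b &
        forall q, List.In q s -> sat d (kerd d) (upd q.2 0 y) q.1] &
    forall y, (forall f e, Sigma0 f e -> sat d (kerd d) (upd e 0 y) f) ->
      ~ dalg d (fun z => z \in l \/ exists r, z = iota r) y].
Proof.
exists (generic_type l); split.
- by move=> f e [He [P [-> _ _]]].
- by move=> a b ab s; apply: generic_type_dense.
- exact: generic_type_realized.
Qed.
End GenericTypes.

(** * Algebraic elements of an ordered field are definable *)

Section AlgebraicIsDefinable.
Variable K : realFieldType.

(** A descending chain of roots: it counts roots below [x] from below only, but translates directly
    into a formula. *)
Fixpoint has_roots_below (p : {poly K}) (h : nat) (x : K) : Prop :=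
  root p x /\ if h is h'.+1 then exists2 z, z < x & has_roots_below p h' z else True.

Lemma has_roots_below_size p h x : p != 0 -> has_roots_below p h x -> (h < size p)%N.
Proof.
move=> p0 Hx.
apply: ltnW; suff [rs [rsx urs srs]] : exists rs : seq K,
    [/\ all (fun z => (z <= x) && root p z) rs, uniq rs & size rs = h.+1].
  rewrite -srs; apply: max_poly_roots => //.
  by apply: sub_all rsx => z /andP[].
elim: h x Hx => [|h IH] x [px Hx]; first by exists [:: x]; rewrite /= lexx px.
have [z zx /IH[rs [rsz urs srs]]] := Hx; exists (x :: rs); split.
- rewrite /= lexx px /=; apply: sub_all rsz => t /andP[tz ->].
  by rewrite andbT (le_trans tz) // ltW.
- rewrite /= urs andbT; apply/negP => /(allP rsz)/andP[xz _].
  by have := lt_le_trans zx xz; rewrite ltxx.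
- by rewrite /= srs.
Qed.

(** The bound variable exceeds both [k] and [n], as variables 1 to [n] hold the parameters of the
    polynomial. *)
Fixpoint Frho (E : nat -> term) (n h k : nat) : formula :=
  if h is h'.+1 then
    Fand (Feq (E k) T0) (Fex (maxn n.+1 k.+1)
      (Fand (Flt (Tvar (maxn n.+1 k.+1)) (Tvar k)) (Frho E n h' (maxn n.+1 k.+1))))
  else Feq (E k) T0.

Lemma Frho_noder E n h k : (forall j, noder_t (E j)) -> noder (Frho E n h k) && nocst (Frho E n h k).
Proof. by move=> nE; elim: h k => [|h IH] k /=; rewrite nE // IH. Qed.

(* A root is singled out by the number of roots below it. *)
Lemma acl_dcl (S : K -> Prop) y : (exists z, S z) -> acl S y -> dcl S y.
Proof.
move=> [z0 Sz0] /acl_finitary[l [lS /acl_terms[m [c [nc cm e]]]]].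
pose n := size l; pose sh i := if (i < n)%N then Tvar i.+1 else T0.
have nsh i : noder_t (sh i) by rewrite /sh; case: ifP.
pose p := \poly_(i < m.+1) termval l (c i).
have p0 : p != 0.
  apply/eqP => /(congr1 (fun q : {poly K} => q`_m)) /eqP.
  by rewrite coef_poly ltnSn coef0 (negPf cm).
have py : root p y by apply/rootP; rewrite horner_poly e.
pose E k := Trel c sh k m.+1.
have nE k : noder_t (E k) by apply: noder_Trel.
have EE v k : (forall i, (i < n)%N -> v i.+1 = nth 0 l i) ->
    teval (fun x => x) v (E k) = p.[v k].
  move=> vl; rewrite teval_Trel horner_poly; apply: eq_bigr => i _; congr (_ * _).
  congr teval; apply: functional_extensionality => j; rewrite /sh.
  by case: (ltnP j n) => jn /=; [apply: vl | rewrite nth_default].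
clearbody E.
have rhoE h k v : (forall i, (i < n)%N -> v i.+1 = nth 0 l i) ->
    satM (fun _ => False) v (Frho E n h k) <-> has_roots_below p h (v k).
  rewrite /satM; elim: h k v => [|h IH] k v vl /=.
    by rewrite EE //; split=> [/rootP|[/rootP]].
  rewrite EE //; set k' := maxn _ _.
  have kk' : k != k' by rewrite neq_ltn /k' leq_max ltnSn orbT.
  have vl' z i : (i < n)%N -> upd v k' z i.+1 = nth 0 l i.
    move=> iN; rewrite /upd; case: eqP => [ik|_]; last exact: vl.
    by have := leq_maxl n.+1 k.+1; rewrite -/k' -ik ltnS leqNgt iN.
  have uk z : upd v k' z k = v k by rewrite /upd (negPf kk').
  split=> [[/rootP px [z [zx /(IH _ _ (vl' z)) Hz]]]|[/rootP px [z zx Hz]]]; split=> //.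
    move: Hz zx; rewrite upd_same uk => Hz zx; by exists z.
  exists z; rewrite upd_same uk; split=> //; apply/IH; first exact: vl'.
  by rewrite upd_same.
have [h [h1 h2]] : exists h, has_roots_below p h y /\ ~ has_roots_below p h.+1 y.
  have H0 : has_roots_below p 0 y by [].
  apply: NNPP => H.
  have Hall h : has_roots_below p h y.
    by elim: h => // h IH; apply: NNPP => nh; apply: H; exists h.
  by have := has_roots_below_size p0 (Hall (size p)); rewrite ltnn.
(* The default must lie in [S], since [dcl] requires this of every parameter of positive index. *)
pose w : nat -> K := fun j => if (j.-1 < n)%N then nth 0 l j.-1 else z0.
have wl z i : (i < n)%N -> upd w 0 z i.+1 = nth 0 l i by rewrite /upd /w /= => ->.
have fE z : satM (fun _ => False) (upd w 0 z) (Fand (Frho E n h 0) (Fnot (Frho E n h.+1 0))) <->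
    has_roots_below p h z /\ ~ has_roots_below p h.+1 z.
  have H1 := rhoE h 0%N _ (wl z); have H2 := rhoE h.+1 0%N _ (wl z).
  rewrite !upd_same in H1 H2; rewrite /satM in H1 H2 *.
  by move: H1 H2; set f1 := Frho E n h.+1 0; set P1 := has_roots_below p h.+1 z => /= H1 H2; tauto.
exists (Fand (Frho E n h 0) (Fnot (Frho E n h.+1 0))), w; split; [|split; [|split; [|split]]].
- have /andP[a1 _] := Frho_noder n h 0 nE; have /andP[a2 _] := Frho_noder n h.+1 0 nE.
  by change (noder (Frho E n h 0) && noder (Frho E n h.+1 0)); rewrite a1.
- have /andP[_ a1] := Frho_noder n h 0 nE; have /andP[_ a2] := Frho_noder n h.+1 0 nE.
  by change (nocst (Frho E n h 0) && nocst (Frho E n h.+1 0)); rewrite a1.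
- move=> [//|j] _; rewrite /w /=; case: ifP => // jn; apply: lS.
  exact: mem_nth.
- exact/fE.
(* Of two distinct roots, the larger would have the smaller one and its chain below it, hence a
   chain longer than [h]. *)
- move=> z /fE[z1 z2]; case: (ltgtP z y) => // zy.
    by case: h2; split; [case: (h) h1 => [|?] [] | exists z].
  by case: z2; split; [case: (h) z1 => [|?] [] | exists y].
Qed.
End AlgebraicIsDefinable.

(** * Transfer between the pair and the differential field *)

Section Renaming.

(** Bound variables are renamed together with free ones; injectivity of [s] then excludes
    capture. *)
Fixpoint fren (s : nat -> nat) (f : formula) : formula :=
  match f with
  | Feq a b => Feq (tren s a) (tren s b)
  | Flt a b => Flt (tren s a) (tren s b)
  | Fcst a => Fcst (tren s a)
  | Fnot g => Fnot (fren s g)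
  | Fand g h => Fand (fren s g) (fren s h)
  | Fex i g => Fex (s i) (fren s g)
  end.

Lemma noder_fren s f : noder (fren s f) = noder f.
Proof. by elim: f => //= [a b|a b|a|g -> h ->]; rewrite ?noder_tren. Qed.

Lemma sat_fren (T : realFieldType) (d : T -> T) C v s f : injective s ->
  sat d C v (fren s f) <-> sat d C (v \o s) f.
Proof.
move=> si; elim: f v => [a b|a b|a|g IH|g IHg h IHh|i g IH] v /=.
- by rewrite !teval_tren.
- by rewrite !teval_tren.
- by rewrite teval_tren.
- by have := IH v; tauto.
- by have := IHg v; have := IHh v; tauto.
- have E x : upd v (s i) x \o s = upd (v \o s) i x.
    by apply: functional_extensionality => j; rewrite /upd /= (inj_eq si).
  by split=> -[x Hx]; exists x; move: Hx; rewrite IH E.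
Qed.

Definition splice (T : Type) n (a q : nat -> T) j := if (j < n)%N then a j else q j.

Lemma splice_upd (T : Type) n (a q : nat -> T) x :
  splice n.+1 (upd a n x) q = upd (splice n a q) n x.
Proof.
apply: functional_extensionality => j; rewrite /splice /upd ltnS leq_eqVlt.
by case: eqP.
Qed.

(** Exchanges the coordinate [n] to be added with variable 0, the variable in which saturation
    realizes types. *)
Definition swap0 n j := if j == 0%N then n else if j == n then 0%N else j.

Lemma swap0K n : involutive (swap0 n).
Proof.
move=> j; rewrite /swap0; case: (eqVneq j 0%N) => [->|j0]; first by rewrite eqxx; case: eqP.
by case: (eqVneq j n) => [->|jn] //; rewrite (negPf j0) (negPf jn).
Qed.

End Renaming.

(** * Types over R in two saturated structures *)

Section Types.
Variable R : rcfType.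

Definition same_type (T1 T2 : realFieldType) (C1 : T1 -> Prop) (C2 : T2 -> Prop)
    (iota1 : R -> T1) (iota2 : R -> T2) n (a : nat -> T1) (b : nat -> T2) :=
  forall f p, noder f -> satM C1 (splice n a (iota1 \o p)) f <-> satM C2 (splice n b (iota2 \o p)) f.

Section Extension.
Variables (T1 T2 : realFieldType) (C1 : T1 -> Prop) (C2 : T2 -> Prop).
Variables (iota1 : R -> T1) (iota2 : R -> T2).
Hypothesis sat2 : saturated R noder (satM C2).

(** The type of [a n] over R and the first [n] coordinates, read over [b], is finitely satisfiable
    because an existential formula true of [a] is true of [b]; saturation realizes it. *)
Lemma same_type_ext n a b : same_type C1 C2 iota1 iota2 n a b ->
  exists y, same_type C1 C2 iota1 iota2 n.+1 a (upd b n y).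
Proof.
move=> ab; pose e0 p := splice n b (iota2 \o p) \o swap0 n.
pose Sigma f e := exists g p, [/\ noder g, f = fren (swap0 n) g,
  satM C1 (splice n.+1 a (iota1 \o p)) g & e = e0 p].
have e0E p y g : satM C2 (upd (e0 p) 0 y) (fren (swap0 n) g) <->
    satM C2 (splice n.+1 (upd b n y) (iota2 \o p)) g.
  rewrite /satM sat_fren; last exact: (inv_inj (swap0K n)).
  rewrite splice_upd; suff -> : upd (e0 p) 0 y \o swap0 n = upd (splice n b (iota2 \o p)) n y by [].
  apply: functional_extensionality => j; rewrite /upd /e0 /=.
  rewrite -[X in _ == X](_ : swap0 n n = 0%N); last by rewrite /swap0 eqxx; case: eqP.
  by rewrite (inj_eq (inv_inj (swap0K n))) swap0K.
have [||y Hy] := @saturated_small R T2 iota2 (fun x => x) C2 noder (mkseq b n) Sigma sat2.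
- move=> f e [g [p [ng -> _ ->]]]; split; first by rewrite noder_fren.
  move=> j; rewrite /e0 /= /splice; case: ltnP => jn; last by right; eexists.
  by left; apply/mapP; exists (swap0 n j); rewrite // mem_iota.
- move=> s Hs.
  suff [g [p [ng Hg H]]] : exists g p, [/\ noder g, satM C1 (splice n.+1 a (iota1 \o p)) g &
      forall y, satM C2 (splice n.+1 (upd b n y) (iota2 \o p)) g ->
        forall q, List.In q s -> satM C2 (upd q.2 0 y) q.1].
    have : satM C1 (splice n a (iota1 \o p)) (Fex n g).
      exists (a n); rewrite -splice_upd; move: Hg; rewrite /satM.
      suff -> : splice n.+1 a (iota1 \o p) = splice n.+1 (upd a n (a n)) (iota1 \o p) by [].
      apply: functional_extensionality => j; rewrite /splice /upd.
      by case: ifP => // _; case: eqP => [->|].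
    move=> /(ab (Fex n g) p ng)[y Hy]; exists y; apply: (H y).
    by rewrite splice_upd.
  elim: s Hs => [|[f e] s IH] Hs.
    by exists Ftrue, (fun=> 0); split.
  have [|g2 [p2 [ng2 Hg2 H2]]] := IH; first by move=> q qs; apply: Hs; right.
  have [g1 [p1 [ng1 /= fE Hg1 eE]]] := Hs (f, e) (or_introl erefl).
  (* The two formulas come with different parameter assignments; those of the second are moved up by
     [N], beyond anything [g1] mentions, so that one assignment serves the conjunction. *)
  pose N := formula_bound g1; pose sh j := if (j < n.+1)%N then j else (j + N)%N.
  have shi : injective sh.
    by move=> i j; rewrite /sh; case: ltnP => ?; case: ltnP => ? ?; lia.
  pose p j := if (j < n.+1 + N)%N then p1 j else p2 (j - N)%N.
  have E1 (T : realFieldType) (C : T -> Prop) c (h : R -> T) :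
      satM C (splice n.+1 c (h \o p)) g1 <-> satM C (splice n.+1 c (h \o p1)) g1.
    apply: sat_agree => j jN; rewrite /splice /= /p.
    by have -> : (j < n.+1 + N)%N by lia.
  have E2 (T : realFieldType) (C : T -> Prop) c (h : R -> T) :
      satM C (splice n.+1 c (h \o p)) (fren sh g2) <-> satM C (splice n.+1 c (h \o p2)) g2.
    rewrite /satM sat_fren //; apply: sat_agree => j _; rewrite /splice /= /sh /p.
    case: (ltnP j n.+1) => jn; first by rewrite jn.
    have -> : (j + N < n.+1)%N = false by lia.
    by rewrite ltn_add2r ltnNge jn /= addnK.
  exists (Fand g1 (fren sh g2)), p; split.
  - by rewrite /= ng1 noder_fren.
  - by split; [apply/E1 | apply/E2].
  - move=> y [/E1 Hy1 /E2 Hy2] q [<-|]; last exact: H2.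
    by rewrite /= fE eE; apply/e0E.
exists y => f p nf.
have Hf g : noder g -> satM C1 (splice n.+1 a (iota1 \o p)) g ->
    satM C2 (splice n.+1 (upd b n y) (iota2 \o p)) g.
  by move=> ng Hg; apply/e0E; apply: Hy; exists g, p.
split; first exact: Hf.
by move=> H2; apply: NNPP => H1; apply: (Hf (Fnot f)).
Qed.

Lemma same_type_exts n N a b : same_type C1 C2 iota1 iota2 n a b ->
  exists b', (forall j, (j < n)%N -> b' j = b j) /\ same_type C1 C2 iota1 iota2 (n + N) a b'.
Proof.
move=> ab; elim: N => [|N [b' [bb' ab']]]; first by exists b; rewrite addn0.
have [y Hy] := same_type_ext ab'; exists (upd b' (n + N) y); rewrite addnS; split=> // j jn.
by rewrite /upd ltn_eqF ?bb' // (leq_trans jn) // leq_addr.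
Qed.

End Extension.

Lemma same_type_sym T1 T2 C1 C2 iota1 iota2 n a b :
  @same_type T1 T2 C1 C2 iota1 iota2 n a b -> same_type C2 C1 iota2 iota1 n b a.
Proof. by move=> ab f p nf; rewrite ab. Qed.

Lemma same_type_agree T1 T2 C1 C2 iota1 iota2 n a b a' b' :
  (forall j, (j < n)%N -> a' j = a j) -> (forall j, (j < n)%N -> b' j = b j) ->
  @same_type T1 T2 C1 C2 iota1 iota2 n a b -> same_type C1 C2 iota1 iota2 n a' b'.
Proof.
have E (T : Type) (c c' q : nat -> T) : (forall j, (j < n)%N -> c' j = c j) ->
    splice n c' q = splice n c q.
  move=> H; apply: functional_extensionality => j; rewrite /splice.
  by case: ifP => // /H.
by move=> aa' bb' ab f p nf; rewrite (E _ _ _ _ aa') (E _ _ _ _ bb'); apply: ab.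
Qed.

Section Transfer.
Variables (T1 T2 : realFieldType) (C1 : T1 -> Prop) (C2 : T2 -> Prop).
Variables (iota1 : R -> T1) (iota2 : R -> T2).
Hypotheses (sat1 : saturated R noder (satM C1)) (sat2 : saturated R noder (satM C2)).

(** The parameters of a defining formula are appended to [a] and matched in the second structure,
    where equality with coordinates, membership in R and constancy are all part of the type.
    Uniqueness is checked by matching a second solution back into the first structure, which is why
    both saturations enter. *)
Lemma scl_transfer n a b i (J : nat -> Prop) : same_type C1 C2 iota1 iota2 n a b ->
  (i < n)%N -> (forall k, J k -> (k < n)%N) ->
  scl iota1 C1 (fun y => exists2 k, J k & y = a k) (a i) ->
  scl iota2 C2 (fun y => exists2 k, J k & y = b k) (b i).
Proof.
move=> ab0 iN JN [f [w [nf [cf [Sw [Hf Uf]]]]]]; pose N := formula_bound f.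
pose a' j := if (j < n)%N then a j else w (j - n)%N.
have a'E j : (j < n)%N -> a' j = a j by rewrite /a' => ->.
have a'w j : a' (n + j)%N = w j by rewrite /a' ltnNge leq_addr /= addKn.
have ab1 : same_type C1 C2 iota1 iota2 n a' b by apply: same_type_agree ab0.
have [b' [bb' ab]] := same_type_exts sat2 N ab1.
have lN j : (j < n)%N -> (j < n + N)%N by move=> jn; rewrite ltn_addr.
have b'S j : (0 < j)%N -> (j < N)%N ->
    (exists2 k, J k & b' (n + j)%N = b k) \/ (exists r, b' (n + j)%N = iota2 r) \/ C2 (b' (n + j)%N).
  move=> j0 jN; have jnN : (n + j < n + N)%N by rewrite ltn_add2l.
  case: (Sw j j0) => [[k Jk wk]|[[r wr]|Cw]].
  - left; exists k => //; rewrite -bb' ?JN //.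
    have := ab (Feq (Tvar (n + j)) (Tvar k)) (fun=> 0) isT.
    by rewrite /satM /= /splice jnN lN ?JN // a'w a'E ?JN // wk => -[H _]; apply: H.
  - right; left; exists r.
    have := ab (Feq (Tvar (n + j)) (Tvar (n + N))) (fun=> r) isT.
    by rewrite /satM /= /splice jnN ltnn a'w wr => -[H _]; apply: H.
  - right; right.
    have := ab (Fcst (Tvar (n + j))) (fun=> 0) isT.
    by rewrite /satM /= /splice jnN a'w => -[H _]; apply: H.
pose w2 j := if (0 < j < N)%N then b' (n + j)%N else iota2 0.
exists f, w2; split=> //; split=> //; split; last split.
- move=> j j0; rewrite /w2 j0 /=; case: ltnP => jN; first exact: b'S.
  by right; left; exists 0.
- pose s j := if j == 0%N then i else (n + j)%N.
  have si : injective s by move=> j k; rewrite /s; do !case: eqP => ?; lia.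
  have Hs (T : realFieldType) (C : T -> Prop) c v q : c i = v 0%N ->
      (forall j, (0 < j < N)%N -> c (n + j)%N = v j) ->
      satM C (splice (n + N) c q) (fren s f) <-> satM (fun=> False) v f.
    move=> c0 cv; rewrite /satM sat_fren // (sat_nocst _ _ (fun=> False)) //.
    apply: sat_agree => j jN; rewrite /splice /= /s.
    case: posnP => [->|j0]; first by rewrite lN.
    by rewrite ltn_add2l jN cv // j0.
  have Ha : satM C1 (splice (n + N) a' (iota1 \o fun=> 0)) (fren s f).
    apply/(Hs _ _ _ (upd w 0 (a i))) => //; first by rewrite upd_same a'E.
    by move=> j /andP[j0 _]; rewrite a'w /upd; case: posnP j0.
  move/(ab (fren s f) (fun=> 0)): Ha; rewrite noder_fren => /(_ nf).
  move/(Hs _ _ _ (upd w2 0 (b i))); apply; first by rewrite upd_same bb'.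
  by move=> j jN; rewrite /w2 /upd jN; case: posnP jN => // ->.
- move=> z Hz.
  (* The competing solution [z] occupies position n + N; indices from [N] on move one further up to
     keep [s] injective. *)
  pose s j := if j == 0%N then (n + N)%N else if (j < N)%N then (n + j)%N else (n + j).+1.
  have si : injective s.
    by move=> j k; rewrite /s; do ![case: eqP => ?|case: ltnP => ?]; lia.
  have sN j : (j < N)%N -> (s j < (n + N).+1)%N by rewrite /s => jN; case: eqP => ?; rewrite ?jN; lia.
  have [|x ab2] := @same_type_ext T2 T1 C2 C1 iota2 iota1 sat1 (n + N) (upd b' (n + N) z) a'.
    apply: same_type_agree (same_type_sym ab) => // j jnN.
    by rewrite /upd ltn_eqF.
  have Hs (T : realFieldType) (C : T -> Prop) c v q : c (n + N)%N = v 0%N ->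
      (forall j, (0 < j < N)%N -> c (n + j)%N = v j) ->
      satM C (splice (n + N).+1 c q) (fren s f) <-> satM (fun=> False) v f.
    move=> c0 cv; rewrite /satM sat_fren // (sat_nocst _ _ (fun=> False)) //.
    apply: sat_agree => j jN; rewrite /splice /= sN // /s.
    by case: posnP => [->//|j0]; rewrite jN cv // j0.
  have Hx : satM C1 (splice (n + N).+1 (upd a' (n + N) x) (iota1 \o fun=> 0)) (fren s f).
    apply/(ab2 _ (fun=> 0)); first by rewrite noder_fren.
    apply/(Hs _ _ _ (upd w2 0 z)) => //; first by rewrite !upd_same.
    move=> j jN; rewrite /w2 /upd jN; case: posnP jN => // j0 jN.
    by rewrite eqn_add2l ltn_eqF.
  have xa : x = a i.
    apply: Uf; apply: (iffLR (Hs _ _ _ (upd w 0 x) _ _ _) Hx); first by rewrite !upd_same.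
    move=> j /andP[j0 jN]; rewrite /upd eqn_add2l (ltn_eqF jN) a'w.
    by case: posnP j0.
  have := ab2 (Feq (Tvar (n + N)) (Tvar i)) (fun=> 0) isT.
  have iN' : (i < n + N)%N by apply: lN.
  rewrite /satM /= /splice ltnSn (ltn_trans iN' (ltnSn _)) !upd_same /upd (ltn_eqF iN').
  by rewrite a'E // xa bb' // => -[_ H]; apply: H.
Qed.
End Transfer.
End Types.

Section Dimension.
Variables (T : Type) (cl : (T -> Prop) -> T -> Prop) (n : nat) (a : 'I_n -> T).

(** Only a lower bound for one value of [cl_dim] is claimed, which is the form that [is_max_iff]
    consumes. *)
Lemma indep_extend (I : {set 'I_n}) : indep cl a I ->
  exists2 e, (#|I| <= e)%N & cl_dim cl a e.
Proof.
have cn (J : {set 'I_n}) : (#|J| <= n)%N by rewrite -[X in (_ <= X)%N]card_ord max_card.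
move: {2}(n - #|I|)%N (leqnn (n - #|I|)) => k; elim: k I => [|k IH] I In iI.
  exists #|I| => //; exists I; split=> //; split=> // J /proper_card.
  by have := cn J; lia.
have [[J [IJ iJ]]|H] := classic (exists J : {set 'I_n}, I \proper J /\ indep cl a J).
  have IJ' := proper_card IJ.
  have [|e Je He] := IH J _ iJ; first by have := cn J; lia.
  by exists e => //; lia.
exists #|I| => //; exists I; split=> //; split=> // J IJ iJ.
by apply: H; exists J.
Qed.
End Dimension.

(** Two sets of numbers, each dominated by the other, have the same maximum; no comparison of
    dimensions tuple by tuple is made. *)
Lemma is_max_iff (S1 S2 : nat -> Prop) :
  (forall e, S1 e -> exists2 e', (e <= e')%N & S2 e') ->
  (forall e, S2 e -> exists2 e', (e <= e')%N & S1 e') ->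
  forall d, is_max S1 d <-> is_max S2 d.
Proof.
have half A B : (forall e, A e -> exists2 e', (e <= e')%N & B e') ->
  (forall e, B e -> exists2 e', (e <= e')%N & A e') -> forall d : nat, is_max A d -> is_max B d.
  move=> AB BA d [Ad dA]; have dB e : B e -> (e <= d)%N.
    by move=> /BA[e' ee' /dA]; apply: leq_trans.
  split=> //; have [e de Be] := AB d Ad.
  by rewrite (_ : d = e) //; apply/eqP; rewrite eqn_leq de dB.
by move=> S12 S21 d; split; apply: half.
Qed.

Lemma env_splice (T : Type) n (a : 'I_n -> T) c p : env a p = splice n (env a c) p.
Proof.
apply: functional_extensionality => j; rewrite /splice /env.
by case: insubP => [i ji _|/negPf->//]; rewrite ji.
Qed.

Lemma splice_env (T : Type) n (b q : nat -> T) : splice n b q = env (fun i : 'I_n => b i) q.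
Proof.
apply: functional_extensionality => j; rewrite /splice /env.
by case: insubP => [i -> <-|/negPf->].
Qed.

(** * Comparison of the two dimensions *)

Section Comparison.
Variables (R : rcfType) (delta : R -> R) (hK : CODF delta).
Variables (K : rcfType) (d : K -> K) (iota : R -> K).
Hypothesis hKel : elemK delta d iota.
Hypothesis Ksat : saturated R nocst (satK d).
Variables (M : realFieldType) (C : M -> Prop) (iotaM : R -> M).
Hypothesis hMel : elemM delta C iotaM.
Hypothesis Msat : saturated R noder (satM C).

(** A type in the language of the pair becomes one in the differential language through [trC], with
    the same parameters. *)
Lemma saturated_pair : saturated R noder (satM (kerd d)).
Proof.
move=> g Sigma nS fS.
pose Sigma' e := exists f, Sigma (f, e.2) /\ e.1 = trC f.
have [||x Hx] := Ksat (g := g) (Sigma := Sigma').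
- by move=> e [f [_ ->]]; apply: nocst_trC.
- move=> l lS.
  have [l' [l'S ll']] : exists l', (forall e, List.In e l' -> Sigma e) /\
      forall e, List.In e l -> exists f, List.In (f, e.2) l' /\ e.1 = trC f.
    elim: l lS => [|e l IH] lS; first by exists nil.
    have [|l' [l'S ll']] := IH; first by move=> q ql; apply: lS; right.
    have [f [Sf ef]] := lS e (or_introl erefl); exists ((f, e.2) :: l'); split.
      by move=> q [<-|/l'S].
    move=> q [<-|/ll'[f' [f'l' qf']]]; first by exists f; split=> //; left.
    by exists f'; split=> //; right.
  have [x Hx] := fS l' l'S; exists x => e /ll'[f [fl' ->]].
  by apply/satK_trC; [apply: (nS (f, e.2)); apply: l'S | apply: (Hx (f, e.2))].
- exists x => -[f e] Sfe; apply/(satK_trC d _ (nS _ Sfe)).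
  by apply: (Hx (trC f, e)); exists f.
Qed.

(** The starting point for extending types: both pairs are elementary extensions of the pair over R,
    so the empty tuples agree. *)
Lemma same_type_prime (a : nat -> M) (b : nat -> K) :
  same_type C (kerd d) iotaM iota 0 a b.
Proof.
move=> f p nf; rewrite -(hMel p nf) -(satK_trC d _ nf) -(hKel p (nocst_trC f)).
exact: iff_sym (satK_trC delta p nf).
Qed.

Lemma others_scl (T : realFieldType) (CT : T -> Prop) (iT : R -> T) n (a : 'I_n -> T) (b : nat -> T)
    (I : {set 'I_n}) i : (forall j, a j = b j) ->
  scl iT CT (fun y => exists2 j, (j \in I) && (j != i) & y = a j) (a i) =
  scl iT CT (fun y => exists2 k : nat, (exists2 j : 'I_n, (j \in I) && (j != i) & k = j) & y = b k) (b i).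
Proof.
move=> ab; rewrite ab; congr (scl _ _ _ _).
apply: functional_extensionality => y; apply: propositional_extensionality.
split=> [[j ji ->]|[k [j ji ->] ->]]; last by exists j.
by exists j => //; exists j.
Qed.

(** A tuple of the same type is found in the differential field; its independence is for [scl],
    hence by [acl_dcl] for algebraic closure over R and the constants, as [generic_copy]
    requires. *)
Lemma ldim_le_ddim n (a : 'I_n -> M) phi p e : noder phi ->
  satM C (env a (iotaM \o p)) phi -> cl_dim (scl iotaM C) a e ->
  exists b : 'I_n -> K, satK d (env b (iota \o p)) (trC phi) /\
    exists2 e', (e <= e')%N & cl_dim (cld iota d) b e'.
Proof.
move=> nphi Ha [I [[iI _] <-]]; pose a0 := env a (fun=> 0).
have [b [_ ab]] := same_type_exts saturated_pair n (same_type_prime a0 (fun=> 0)).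
rewrite add0n in ab; pose b0 (i : 'I_n) := b i.
have aE j : a j = a0 j by rewrite /a0 /env valK.
have K0 := elemK_iota0 hKel; have d_der := elemK_derivation hK hKel.
have [|||b1 [Hb1 ib1]] := @generic_copy R K d iota d_der K0 Ksat
  (elemK_const_dense hK hKel) (generic_types hK hKel) n b0 I (iota \o p) phi nphi _ _ _.
- by move=> j; exists (p j).
- by move: Ha; rewrite (env_splice a (fun=> 0)) => /(ab _ _ nphi); rewrite splice_env.
- move=> i iI' Hi; apply: (iI i iI').
  rewrite (@others_scl _ C iotaM n a a0) //.
  apply: (scl_transfer saturated_pair Msat (same_type_sym ab)) => //.
    by move=> k [j _ ->].
  rewrite -(@others_scl _ (kerd d) iota n b0 b) //.
  rewrite /scl; have := acl_dcl _ Hi; case; first by exists 0; right; apply: der0.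
  move=> f [w [nf [cf [wS H]]]]; exists f, w; do 2!split=> //; split=> // j j0.
  by case: (wS j j0) => [[|]|]; [left | right; left | right; right].
exists b1; split; first exact/satK_trC.
apply: indep_extend => i iI' /diff_alg_dalg Hi.
by apply: (ib1 i iI'); apply: Hi.
Qed.

(** A dependence for [scl] in M is carried back to the differential field, becomes algebraic by
    [dcl_acl], and is then differential by [dalg_acl_const]. *)
Lemma ddim_le_ldim n (b : 'I_n -> K) phi p e : noder phi ->
  satK d (env b (iota \o p)) (trC phi) -> cl_dim (cld iota d) b e ->
  exists a : 'I_n -> M, satM C (env a (iotaM \o p)) phi /\
    exists2 e', (e <= e')%N & cl_dim (scl iotaM C) a e'.
Proof.
move=> nphi /(satK_trC _ _ nphi) Hb [I [[iI _] <-]]; pose b0 := env b (fun=> 0).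
have [a [_ ba]] := same_type_exts Msat n (same_type_sym (same_type_prime (fun=> 0) b0)).
rewrite add0n in ba.
have bE j : b j = b0 j by rewrite /b0 /env valK.
have K0 := elemK_iota0 hKel; have d_der := elemK_derivation hK hKel.
exists (fun i => a i); split.
  by rewrite -splice_env; apply/(ba _ p nphi); rewrite -env_splice.
apply: indep_extend => i iI'; rewrite (@others_scl _ C iotaM n _ a) // => Hi.
apply: (iI i iI'); apply/diff_alg_dalg => //.
apply: dalg_acl_const => //.
have : scl iota (kerd d) (fun y => exists2 j, (j \in I) && (j != i) & y = b j) (b i).
  rewrite (@others_scl _ (kerd d) iota n b b0) //.
  by apply: (scl_transfer Msat saturated_pair (same_type_sym ba)) Hi => // k [j _ ->].
move=> /(dcl_acl K0 Ksat); apply: acl_mono => y [?|[?|?]]; by [left; left | left; right | right].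
Qed.

End Comparison.

(** An equality of structures, so that the given ordered field can be replaced by a real closed one
    by substitution, with all hypotheses about it kept. *)
Lemma realField_rcf (F : realFieldType) : Num.real_closed_axiom F ->
  exists K : rcfType, (K : realFieldType) = F.
Proof.
move=> H.
pose K : rcfType := HB.pack F (Num.RealField_isClosed.Build F H).
by exists K; case: (F) H @K.
Qed.

Theorem theorem1p1 (R : rcfType) (delta : R -> R) (hK : CODF delta)
    (n : nat) (X : ('I_n -> R) -> Prop) (phi : formula) (p : nat -> R)
    (hX : defines_M delta X phi p)
    (Ks : realFieldType) (dKs : Ks -> Ks) (iotaK : R -> Ks)
    (hKel : elemK delta dKs iotaK)
    (hKsat : saturated R nocst (fun v f => satK dKs v f))
    (Ms : realFieldType) (CMs : Ms -> Prop) (iotaM : R -> Ms)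
    (hMel : elemM delta CMs iotaM)
    (hMsat : saturated R noder (fun v f => satM CMs v f)) :
  forall d : nat,
    ldim_is CMs iotaM n phi p d <-> ddim_is dKs iotaK n phi p d.
Proof.
have [K KE] := realField_rcf (elemK_rcf hKel); case: hX => nphi _.
subst Ks; apply: is_max_iff => e [x [Hx He]].
  have [y [Hy [e' ee' He']]] := ldim_le_ddim hK hKel hKsat hMel hMsat nphi Hx He.
  by exists e' => //; exists y.
have [y [Hy [e' ee' He']]] := ddim_le_ldim hK hKel hKsat hMel hMsat nphi Hx He.
by exists e' => //; exists y.
Qed.
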